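(* There is an absolute constant $C>0$ such that for every $\alpha>0$ there exists $\varepsilon_\alpha>0$ with $\varepsilon_\alpha=\exp(-O(1/\alpha^3))$ (i.e. $\varepsilon_\alpha\ge \exp(-C/\alpha^3)$) such that for every $q\in\mathbb N$ and all sufficiently large $n$: if $(G,\Pi)$ is an $n$-variable instance of Unique Games with alphabet size $q$ and $\mathrm{SA}_{2n^\alpha\log q}(G,\Pi)\ge 1-\varepsilon_\alpha$, then there exists an assignment $x\in[q]^n$ with $\sum_{\{i,j\}} w_{ij}\Pi_{ij}(x_i,x_j)\ge \varepsilon_\alpha/8$. Furthermore, there is a polynomial-time rounding algorithm which takes a Sherali–Adams pseudodistribution of degree $2\log q\cdot n^\alpha$ and objective value at least $1-\varepsilon_\alpha$ and finds such an assignment $x$.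
   Context: An $n$-variable 2CSP instance with alphabet $[q]$ is a pair $(G,\Pi)$: $G$ is an $n$-vertex graph with nonnegative edge weights $w_{ij}$ summing to $1$ (simple, undirected, no isolated vertices), and $\Pi$ assigns to each edge $\{i,j\}$ a predicate $\Pi_{ij}:[q]\times[q]\to\{0,1\}$. It is a Unique Games instance if each $\Pi_{ij}$ is the graph of a bijection $\sigma_{ij}:[q]\to[q]$, i.e. $\Pi_{ij}(a,b)=1$ iff $b=\sigma_{ij}(a)$. A $q$-ary $t$-local pseudodistribution is a collection $\{\mu_S\}_{|S|=t}$ of distributions on $[q]^S$ whose marginals on any common subset of size at most $t$ agree. $\mathrm{SA}_t(G,\Pi)$ is the maximum, over $q$-ary $t$-local pseudodistributions, of $\sum_{\{i,j\}} w_{ij}\Pr_{\mu_{ij}}[\Pi_{ij}(X_i,X_j)=1]$, where $\mu_{ij}$ is the common marginal on $\{i,j\}$ (the degree-$t$ Sherali–Adams LP value).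
   Formalization: For α>1 the bound ε_α ≥ exp(-C/α³) is replaced by ε_α ≥ exp(-C): there the degree exceeds n, so SA is undefined or equals the optimum, and the literal bound tends to 1 and fails; the degree is rounded down and clipped to [2,n]. *)

(* Defs.v *)
From HB Require Import structures.
From mathcomp Require Import all_boot all_order all_algebra all_fingroup.
From mathcomp Require Import archimedean.
From mathcomp Require Import all_classical all_reals all_analysis.

Set Implicit Arguments.
Unset Strict Implicit.
Unset Printing Implicit Defensive.

Import Order.TTheory GRing.Theory Num.Theory.
Local Open Scope ring_scope.

(* Weights and constraints are given on ordered pairs and are symmetric on
   edges; off the edges they are irrelevant.  The field of scalars is a
   parameter because algorithms take rational data. *)
Record instance (F : realFieldType) (n q : nat) := Instance {
  adj : rel 'I_n;
  wt : 'I_n -> 'I_n -> F;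
  cstr : 'I_n -> 'I_n -> 'I_q -> 'I_q -> bool;
  adj_sym : forall i j, adj i j = adj j i;
  adj_irrefl : forall i, ~~ adj i i;
  no_isolated : forall i, exists j, adj i j;
  wt_sym : forall i j, adj i j -> wt i j = wt j i;
  wt_ge0 : forall i j, adj i j -> 0 <= wt i j;
  wt_sum1 : \sum_(i < n) \sum_(j < n | (i < j)%N && adj i j) wt i j = 1;
  cstr_sym : forall i j a b, adj i j -> cstr i j a b = cstr j i b a
}.

Definition unique_games (F : realFieldType) (n q : nat) (I : instance F n q) :=
  forall i j, adj I i j ->
    exists sigma : {perm 'I_q}, forall a b, cstr I i j a b = (b == sigma a).

Definition value (F : realFieldType) (n q : nat) (I : instance F n q)
    (x : {ffun 'I_n -> 'I_q}) : F :=
  \sum_(i < n) \sum_(j < n | (i < j)%N && adj I i j)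
    wt I i j * (cstr I i j (x i) (x j))%:R.

Definition passign (n q : nat) (S : {set 'I_n}) :=
  {ffun {i : 'I_n | i \in S} -> 'I_q}.

(* The probability, under the weights [p] on [q]^S, that the assignment agrees
   with [z] on [U]; only the values of [z] on [U] matter. *)
Definition marginal (F : realFieldType) (n q : nat) (S : {set 'I_n})
    (p : passign q S -> F) (U : {set 'I_n}) (z : {ffun 'I_n -> 'I_q}) : F :=
  \sum_(y : passign q S |
        [forall i : {i : 'I_n | i \in S}, (val i \in U) ==> (y i == z (val i))])
    p y.

Definition local_weights (F : realFieldType) (n q : nat) :=
  forall S : {set 'I_n}, passign q S -> F.

Definition is_pseudodist (F : realFieldType) (n q t : nat)
    (mu : local_weights F n q) : Prop :=
  [/\ forall S : {set 'I_n}, #|S| = t -> forall y, 0 <= mu S y,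
      forall S : {set 'I_n}, #|S| = t -> \sum_y mu S y = 1 &
      forall S T U : {set 'I_n}, #|S| = t -> #|T| = t ->
        U \subset S :&: T ->
        forall z, marginal (mu S) U z = marginal (mu T) U z].

(* [psd_fun m S] is meaningful only when [#|S| = t]. *)
Record pseudodist (F : realFieldType) (n q t : nat) := Pseudodist {
  psd_fun : local_weights F n q;
  psd_axiom : is_pseudodist t psd_fun
}.
Arguments psd_fun {F n q t} p S y : rename.

(* The probability that (X_i, X_j) = (a, b) under the common marginal on
   {i, j}, for [i != j]; by consistency it does not depend on the set [S]
   picked, and such a set exists as soon as 2 <= t <= n. *)
Definition pair_prob (F : realFieldType) (n q t : nat)
    (m : pseudodist F n q t) (i j : 'I_n) (a b : 'I_q) : F :=
  if [pick S : {set 'I_n} | (#|S| == t) && ([set i; j] \subset S)] is Some V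
  then marginal (psd_fun m V) [set i; j] [ffun k => if k == i then a else b]
  else 0.

Definition sa_objective (F : realFieldType) (n q t : nat) (I : instance F n q)
    (m : pseudodist F n q t) : F :=
  \sum_(i < n) \sum_(j < n | (i < j)%N && adj I i j)
    wt I i j * \sum_(a < q) \sum_(b < q | cstr I i j a b) pair_prob m i j a b.

(* The set of objective values is compact, so this supremum is a maximum
   whenever t-local pseudodistributions exist. *)
Definition sherali_adams (R : realType) (n q t : nat) (I : instance R n q) : R :=
  sup (range (fun m : pseudodist R n q t => sa_objective I m)).

(* The degree 2 n^alpha log q, rounded down and clipped to the interval [2, n]
   in which t-local pseudodistributions on n variables have pair marginals: at
   t = n they are distributions on [q]^n. *)
Definition sa_degree (R : realType) (alpha : R) (n q : nat) : nat :=
  minn n (maxn 2 (Num.truncn (2 * n%:R `^ alpha * ln q%:R))).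

Section RandomAccessMachine.
Local Open Scope nat_scope.

(* A random access machine with a read-only input array, a write-only output
   tape and natural-number registers.  As in Papadimitriou's book, the
   arithmetic is addition, truncated subtraction and halving: registers grow by
   at most one bit per step, so that the unit-cost time is polynomially related
   to Turing machine time. *)
Inductive instr :=
| IConst of nat & nat        (* M[r] := c *)
| IAdd of nat & nat & nat    (* M[r] := M[a] + M[b] *)
| ISub of nat & nat & nat    (* M[r] := M[a] - M[b] *)
| IHalf of nat & nat         (* M[r] := M[a] / 2 *)
| ILoad of nat & nat         (* M[r] := M[M[a]] *)
| IStore of nat & nat        (* M[M[a]] := M[b] *)
| IRead of nat & nat         (* M[r] := input[M[a]] *)
| IWrite of nat.             (* append M[a] to the output *)

Inductive program :=
| Do of instr
| Seq of program & program
| If of nat & program & program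
| While of nat & program.

Definition state := ((nat -> nat) * seq nat)%type.

Definition upd (m : nat -> nat) (r v : nat) : nat -> nat :=
  fun k => if k == r then v else m k.

Definition step (inp : seq nat) (s : state) (c : instr) : state :=
  let: (m, out) := s in
  match c with
  | IConst r k => (upd m r k, out)
  | IAdd r a b => (upd m r (m a + m b), out)
  | ISub r a b => (upd m r (m a - m b), out)
  | IHalf r a => (upd m r (m a)./2, out)
  | ILoad r a => (upd m r (m (m a)), out)
  | IStore a b => (upd m (m a) (m b), out)
  | IRead r a => (upd m r (nth 0 inp (m a)), out)
  | IWrite a => (m, rcons out (m a))
  end.

(* [exec inp c s T s']: started in [s], [c] halts in [s'] after [T] steps. *)
Inductive exec (inp : seq nat) : program -> state -> nat -> state -> Prop :=
| exec_do c (s : state) : exec inp (Do c) s 1 (step inp s c)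
| exec_seq c1 c2 s1 s2 s3 T1 T2 :
    exec inp c1 s1 T1 s2 -> exec inp c2 s2 T2 s3 ->
    exec inp (Seq c1 c2) s1 (T1 + T2) s3
| exec_if_true r c1 c2 (s s' : state) T :
    s.1 r != 0 -> exec inp c1 s T s' -> exec inp (If r c1 c2) s T.+1 s'
| exec_if_false r c1 c2 (s s' : state) T :
    s.1 r = 0 -> exec inp c2 s T s' -> exec inp (If r c1 c2) s T.+1 s'
| exec_while_false r c (s : state) : s.1 r = 0 -> exec inp (While r c) s 1 s
| exec_while_true r c (s1 s2 s3 : state) T1 T2 :
    s1.1 r != 0 -> exec inp c s1 T1 s2 -> exec inp (While r c) s2 T2 s3 ->
    exec inp (While r c) s1 (T1 + T2).+1 s3.

(* Initially M[0] is the length of the input and the other registers are 0. *)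
Definition computes_in (c : program) (inp : seq nat) (T : nat) (out : seq nat) :=
  exists m, exec inp c (upd (fun=> 0) 0 (size inp), [::]) T (m, out).

Definition computes (c : program) (inp out : seq nat) :=
  exists T, computes_in c inp T out.

Definition bitsize (s : seq nat) := \sum_(x <- s) (trunc_log 2 x).+1.

Definition polytime_on (D : seq nat -> Prop) (c : program) :=
  exists k, forall inp, D inp ->
    exists T out, computes_in c inp T out /\ T <= k * (bitsize inp).+1 ^ k.

End RandomAccessMachine.

Definition enc_rat (r : rat) : seq nat := [:: `|numq r|%N; `|denq r|%N].

Definition enc_instance (n q : nat) (I : instance rat n q) : seq nat :=
  [:: n, q &
    flatten [seq
      (adj I p.1 p.2 : nat) ::
      enc_rat (if adj I p.1 p.2 then wt I p.1 p.2 else 0) ++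
      [seq (adj I p.1 p.2 && cstr I p.1 p.2 ab.1 ab.2 : nat)
         | ab <- [seq (a, b) | a <- enum 'I_q, b <- enum 'I_q]]
      | p <- [seq (i, j) | i <- enum 'I_n, j <- enum 'I_n]]].

(* A partial assignment is a row of [n] numbers: 0 outside [S], and one plus
   the value on [S]. *)
Definition enc_passign (n q : nat) (S : {set 'I_n}) (y : passign q S) : seq nat :=
  [seq if insub i is Some s then (y s).+1 else 0%N | i <- enum 'I_n].

Definition enc_pseudodist (n q t : nat) (m : pseudodist rat n q t) : seq nat :=
  flatten [seq flatten [seq enc_passign y ++ enc_rat (psd_fun m V y)
                          | y <- enum {: passign q V}]
             | V : {set 'I_n} <- enum {set 'I_n} & #|V| == t].

Definition enc_input (n q t : nat) (I : instance rat n q)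
    (m : pseudodist rat n q t) : seq nat :=
  enc_instance I ++ enc_pseudodist m.

Definition enc_assignment (n q : nat) (x : {ffun 'I_n -> 'I_q}) : seq nat :=
  [seq (x i : nat) | i <- enum 'I_n].

Definition is_input (s : seq nat) :=
  exists n q t (I : instance rat n q) (m : pseudodist rat n q t),
    s = enc_input I m.

(* Main.v *)
(* Conditioning the pseudodistribution on a polynomial number of variables makes
   the covariances of every variable with the others negligible on average,
   since each conditioning would otherwise raise the collision probability of
   the marginals.  Work inside a dense vertex set all of whose much smaller
   subsets lose most of their density; there the random walk spreads, so after
   [l = 2 ^ J] steps, with [2 ^ l] a small power of [n], its kernel has small
   second moment, and by Cauchy-Schwarz the covariance carried by the label walk
   (which composes the bijections along the walk) is tiny.  Pseudo-covariances
   of a large degree are almost positive semidefinite, as sampling shows, so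
   doubling the length of the walk at worst squares that covariance: it was
   already small for one step.  Hence edges are satisfied little more often than
   by independent sampling from the marginals, so most marginals in the set are
   nearly deterministic, and their likeliest labels satisfy a constant fraction
   of its edges.  Repeat on the remaining vertices.

   The likeliest labels given a conditioning can be compared by reading the
   table of the pseudodistribution, so the algorithm tries each row with one
   vertex dropped as the conditioning; the largest set of vertices whose labels
   satisfy, towards the set, a constant fraction of each degree is found by
   peeling off bad vertices.  Every set that the argument produces is contained
   in it, so a single pass over the rows suffices. *)

Require Import Defs.
From mathcomp Require Import all_boot all_order all_algebra all_fingroup.
From mathcomp Require Import archimedean.
From mathcomp Require Import all_classical all_reals all_analysis.
From mathcomp Require Import fintype finset ring lra zify.

Set Implicit Arguments.
Unset Strict Implicit.
Unset Printing Implicit Defensive.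
Import Order.TTheory GRing.Theory Num.Theory.
Local Open Scope ring_scope.

(** * Local distributions *)

(** Two rates compete along a walk of length l = 2^J. Doubling keeps a covariance of 2 * 64^-1 alive
    only at 2 * 64^-l, while expansion has to bring the second moment of the walk, of order n at the
    start, below that. With h = 2^l the two sides are of order h^-6 and n * h^-(2B+1), where n <=
    h^B and B is of order 1/alpha. The contraction per step must therefore be 2^-(2B+1), which
    demands expansion 2^-O(B). Each of the at most B passages to a much smaller subset costs that
    factor in density, so the final constant is 2^-O(B^2).

    The program has no access to the choices made in the argument. Conditioning sets are therefore
    padded to exactly t - 1 vertices, so that one more vertex gives a row of the table, and every
    label decoded outside them has conditional probability above 1/2, so that it is the unique
    largest entry among the comparable rows. Sampling enters the analysis only: the program is
    deterministic. *)

Section LocalDistributions.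
Variables (F : realFieldType) (V L : finType).
Implicit Types (P : {set V} -> {ffun V -> L} -> F) (S T U : {set V}).
Implicit Types (f g : {ffun V -> L} -> F) (x y z : {ffun V -> L}).

Definition depends_on U f := forall x y, {in U, x =1 y} -> f x = f y.

Definition expect P T f := \sum_x P T x * f x.

(** Each [P T] weights total assignments, so that all sets share one type. Only its expectations of
    functions depending on [T] are meaningful, and consistency is asked of those alone. *)
Definition local_dist t P :=
  [/\ forall T x, (#|T| <= t)%N -> 0 <= P T x,
      forall T, (#|T| <= t)%N -> \sum_x P T x = 1 &
      forall T U f, U \subset T -> (#|T| <= t)%N -> depends_on U f ->
        expect P T f = expect P U f].

Definition agree S z x := [forall i, (i \in S) ==> (x i == z i)].

Definition cond P S z T x :=
  P (S :|: T) x * (agree S z x)%:R / expect P S (fun y => (agree S z y)%:R).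

Definition set_at z s b : {ffun V -> L} := [ffun i => if i == s then b else z i].

Definition prob P v a := expect P [set v] (fun x => (x v == a)%:R).

Definition cov P u (g : L -> F) v (h : L -> F) :=
  expect P [set u; v] (fun x => g (x u) * h (x v)) -
  expect P [set u] (fun x => g (x u)) * expect P [set v] (fun x => h (x v)).

Lemma agreeP S z x : reflect {in S, x =1 z} (agree S z x).
Proof.
apply: (iffP forallP) => [h i iS|h i].
  by move: (h i); rewrite iS => /eqP.
by apply/implyP => iS; rewrite h.
Qed.

Lemma agree_depends S z : depends_on S (fun x => (agree S z x)%:R).
Proof.
move=> x y xy; congr (_%:R); congr nat_of_bool; apply: eq_forallb => i.
by case: (boolP (i \in S)) => // iS; rewrite xy.
Qed.

Lemma depends_sub S T f : S \subset T -> depends_on S f -> depends_on T f.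
Proof. by move=> /subsetP ST h x y xy; apply: h => i /ST; apply: xy. Qed.

Lemma depends_mul S f g : depends_on S f -> depends_on S g ->
  depends_on S (fun x => f x * g x).
Proof. by move=> hf hg x y xy; rewrite (hf x y xy) (hg x y xy). Qed.

Lemma depends_at S v (h : L -> F) : v \in S -> depends_on S (fun x => h (x v)).
Proof. by move=> vS x y xy; rewrite xy. Qed.

Lemma eq_expect P T f g : f =1 g -> expect P T f = expect P T g.
Proof. by move=> fg; apply: eq_bigr => x _; rewrite fg. Qed.

Lemma expectD P T f g : expect P T (fun x => f x + g x) = expect P T f + expect P T g.
Proof. by rewrite -big_split; apply: eq_bigr => x _; rewrite mulrDr. Qed.

Lemma expectZ P T c f : expect P T (fun x => c * f x) = c * expect P T f.
Proof. by rewrite mulr_sumr; apply: eq_bigr => x _; rewrite mulrCA. Qed.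

Lemma expectB P T f g : expect P T (fun x => f x - g x) = expect P T f - expect P T g.
Proof.
rewrite (@eq_expect P T (fun x => f x - g x) (fun x => f x + -1 * g x)) => [|x];
  last by rewrite mulN1r.
by rewrite expectD expectZ mulN1r.
Qed.

Lemma expect_sum P T (I : Type) (r : seq I) (Q : pred I) (f : I -> {ffun V -> L} -> F) :
  expect P T (fun x => \sum_(i <- r | Q i) f i x) =
  \sum_(i <- r | Q i) expect P T (f i).
Proof.
by rewrite /expect exchange_big; apply: eq_bigr => x _; rewrite mulr_sumr.
Qed.

Section Consistent.
Variables (t : nat) (P : {set V} -> {ffun V -> L} -> F).
Hypothesis HP : local_dist t P.

Lemma expect_ge0 T f : (#|T| <= t)%N -> (forall x, 0 <= f x) -> 0 <= expect P T f.
Proof.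
by case: HP => h _ _ hT hf; apply: sumr_ge0 => x _; apply: mulr_ge0; rewrite ?h.
Qed.

Lemma expect_cst T c : (#|T| <= t)%N -> expect P T (fun=> c) = c.
Proof. by case: HP => _ h _ hT; rewrite /expect -mulr_suml h ?mul1r. Qed.

Lemma expect_le T f g : (#|T| <= t)%N -> (forall x, f x <= g x) ->
  expect P T f <= expect P T g.
Proof.
move=> hT fg; rewrite -subr_ge0 -expectB; apply: expect_ge0 => // x.
by rewrite subr_ge0.
Qed.

Lemma expect_sub T U f : U \subset T -> (#|T| <= t)%N -> depends_on U f ->
  expect P T f = expect P U f.
Proof. by case: HP => _ _; apply. Qed.

Lemma expect_null T f g : (#|T| <= t)%N -> (forall x, 0 <= g x) ->
  (forall x, g x = 0 -> f x = 0) -> expect P T g = 0 -> expect P T f = 0.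
Proof.
case: HP => h _ _ hT hg gf /eqP.
rewrite psumr_eq0 => [/allP /= h0|x _]; last by rewrite mulr_ge0 ?h.
apply: big1 => x _; have := h0 x (mem_index_enum x).
by rewrite mulf_eq0 => /orP[/eqP->|/eqP/gf->]; rewrite ?mul0r ?mulr0.
Qed.

Lemma prob_ge0 v a : (0 < t)%N -> 0 <= prob P v a.
Proof. by move=> t0; apply: expect_ge0; rewrite ?cards1. Qed.

Lemma sum_prob v : (0 < t)%N -> \sum_a prob P v a = 1.
Proof.
move=> t0; rewrite -expect_sum -[RHS](@expect_cst [set v]) ?cards1 //.
apply: eq_expect => x; rewrite (bigD1 (x v)) //= eqxx big1 ?addr0 // => b.
by rewrite eq_sym => /negPf->.
Qed.

Lemma prob_le1 v a : (0 < t)%N -> prob P v a <= 1.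
Proof.
move=> t0; rewrite -(sum_prob v t0) (bigD1 a) //= lerDl.
by apply: sumr_ge0 => b _; apply: prob_ge0.
Qed.

Lemma expect_cond S z T f :
  expect (cond P S z) T f =
  expect P (S :|: T) (fun x => (agree S z x)%:R * f x) /
  expect P S (fun y => (agree S z y)%:R).
Proof. by rewrite mulr_suml; apply: eq_bigr => x _; rewrite /cond; ring. Qed.

Lemma cond_local S z : (#|S| <= t)%N -> expect P S (fun y => (agree S z y)%:R) != 0 ->
  local_dist (t - #|S|) (cond P S z).
Proof.
move=> St nz.
have cST T : (#|T| <= t - #|S|)%N -> (#|S :|: T| <= t)%N.
  by move=> hT; apply: leq_trans (leq_card_setU S T) _; move: hT; rewrite leq_subRL.
split=> [T x hT|T hT|T U f UT hT dU].
- apply: mulr_ge0; last by rewrite invr_ge0 expect_ge0.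
  by apply: mulr_ge0; case: HP => // h _ _; rewrite h ?cST.
- transitivity (expect (cond P S z) T (fun=> 1)).
    by apply: eq_bigr => x _; rewrite mulr1.
  rewrite expect_cond (@eq_expect _ _ _ (fun x => (agree S z x)%:R)) => [|x].
    by rewrite (expect_sub (subsetUl S T)) ?divff ?cST //; apply: agree_depends.
  by rewrite mulr1.
- rewrite !expect_cond; congr (_ / _); apply: expect_sub.
  + exact: setUS.
  + exact: cST.
  + apply: depends_mul.
      by apply: (@depends_sub S); [exact: subsetUl | exact: agree_depends].
    by apply: depends_sub dU; apply: subsetUr.
Qed.

End Consistent.

End LocalDistributions.

(** * Conditioning on the label of one vertex *)

Section Conditioning.
Variables (F : realFieldType) (V L : finType).
Implicit Types (P : {set V} -> {ffun V -> L} -> F) (S T U : {set V}).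
Implicit Types (f : {ffun V -> L} -> F) (x y z : {ffun V -> L}).

Lemma card_pair t (u v : V) : (1 < t)%N -> (#|[set u; v]| <= t)%N.
Proof. by move=> t1; rewrite cards2; case: eqP => _ //; apply: ltnW. Qed.

Definition ind (a : L) : L -> F := fun c => (c == a)%:R.

Definition mass P S z := expect P S (fun x => (agree S z x)%:R).

Definition cond1 P s b := cond P [set s] [ffun=> b].

Definition pcov P u a v b := cov P u (ind a) v (ind b).

Lemma covC P u (g : L -> F) v (h : L -> F) : cov P u g v h = cov P v h u g.
Proof.
rewrite /cov setUC mulrC; congr (_ - _).
by apply: eq_expect => x; rewrite mulrC.
Qed.

Lemma expect_cond1 P s b T f :
  expect (cond1 P s b) T f =
  expect P (s |: T) (fun x => (x s == b)%:R * f x) / prob P s b.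
Proof.
rewrite /cond1 expect_cond; congr (_ / _); apply: eq_expect => x;
  suff -> : agree [set s] [ffun=> b] x = (x s == b) by [].
  by apply/agreeP/eqP => [h|<- i /set1P->]; rewrite ?ffunE // h ?inE ?ffunE.
by apply/agreeP/eqP => [h|<- i /set1P->]; rewrite ?ffunE // h ?inE ?ffunE.
Qed.

(** An averaging argument that also returns positive weight, without which conditioning on the
    outcome found would divide by zero. *)
Lemma mean_witness (I : finType) (p y : I -> F) c :
  (forall i, 0 <= p i) -> \sum_i p i = 1 -> c <= \sum_i p i * y i ->
  exists2 i, 0 < p i & c <= y i.
Proof.
move=> p0 p1 hc; case: (pickP (fun i => (0 < p i) && (c <= y i))) => [i /andP[]|h].
  by exists i.
have [i pi0] : exists i, 0 < p i.
  case: (pickP (fun i => 0 < p i)) => [i|h0]; first by exists i.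
  move: p1; rewrite big1 => [/esym/eqP|i _]; first by rewrite oner_eq0.
  by apply/eqP; rewrite eq_le p0 leNgt h0.
have d0 j : 0 <= p j * (c - y j).
  have := h j; case: ltgtP (p0 j) => //= [pj|<-] _; last by rewrite mul0r.
  by move/negbT; rewrite -ltNge => /ltW hj; rewrite mulr_ge0 ?subr_ge0 ?(ltW pj).
have : \sum_j p j * (c - y j) == 0.
  rewrite eq_le sumr_ge0 // andbT; under eq_bigr do rewrite mulrBr.
  by rewrite sumrB -mulr_suml p1 mul1r subr_le0.
rewrite psumr_eq0 // => /allP /(_ i (mem_index_enum i)) /=.
rewrite mulf_eq0 gt_eqF //= subr_eq0 => /eqP cy.
by have := h i; rewrite pi0 cy lexx.
Qed.

Section Consistent.
Variables (t : nat) (P : {set V} -> {ffun V -> L} -> F).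
Hypothesis HP : local_dist t P.

(** When [prob P s b] is 0 both sides vanish: the left by its factor, the right because the event is
    null. *)
Lemma prob_expect_cond1 s b T f : (#|s |: T| <= t)%N ->
  prob P s b * expect (cond1 P s b) T f =
  expect P (s |: T) (fun x => (x s == b)%:R * f x).
Proof.
move=> hT; rewrite expect_cond1; have [p0|p0] := eqVneq (prob P s b) 0; last first.
  by rewrite mulrC divfK.
rewrite p0 mul0r; symmetry.
apply: (expect_null HP (g := fun x => (x s == b)%:R)) => // [x /eqP|].
  by rewrite pnatr_eq0 eqb0 => /negPf->; rewrite mul0r.
rewrite (expect_sub HP (U := [set s])) ?subsetUl //; try exact: p0.
by apply: (@depends_at _ _ _ _ _ (fun c => (c == b)%:R)); rewrite inE.
Qed.

Lemma total_expectation s T f : (#|s |: T| <= t)%N -> depends_on T f ->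
  \sum_b prob P s b * expect (cond1 P s b) T f = expect P T f.
Proof.
move=> hT dT.
under eq_bigr do rewrite prob_expect_cond1 //.
rewrite -expect_sum -[RHS](expect_sub HP (subsetUr [set s] T)) //.
apply: eq_expect => x; rewrite (bigD1 (x s)) //= eqxx mul1r big1 ?addr0 // => b.
by rewrite eq_sym => /negPf->; rewrite mul0r.
Qed.

Lemma prob_cond1 s b v a : (1 < t)%N ->
  prob P s b * prob (cond1 P s b) v a = pcov P s b v a + prob P s b * prob P v a.
Proof.
move=> t1; rewrite /prob prob_expect_cond1; last by apply: card_pair.
by rewrite /pcov /cov subrK.
Qed.

Lemma sum_pcov s v a : (1 < t)%N -> \sum_b pcov P s b v a = 0.
Proof.
move=> t1; rewrite /pcov /cov sumrB -expect_sum -mulr_suml.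
rewrite (sum_prob HP) ?mul1r; last by lia.
apply/eqP; rewrite subr_eq0; apply/eqP.
rewrite -(expect_sub HP (subsetUr [set s] [set v])); last first.
- by apply: (@depends_at _ _ _ _ _ (ind a)); rewrite inE.
- by apply: card_pair.
apply: eq_expect => x; rewrite -mulr_suml (bigD1 (x s)) //= /ind eqxx big1 ?addr0 ?mul1r //.
by move=> b; rewrite eq_sym => /negPf->.
Qed.

(** Let p, r and q be the probabilities of [b] at [s], of [a] at [v], and of [a] at [v] given [b].
    The covariance is p (q - r), the mean of q^2 exceeds r^2 by the sum of p (q - r)^2, and p >=
    p^2. *)
Lemma collision_step s v a : (1 < t)%N ->
  prob P v a ^+ 2 + \sum_b pcov P s b v a ^+ 2 <=
  \sum_b prob P s b * prob (cond1 P s b) v a ^+ 2.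
Proof.
move=> t1; have t0 : (0 < t)%N by lia.
have -> : prob P v a ^+ 2 = \sum_b (prob P s b * prob P v a ^+ 2 +
                                     2 * prob P v a * pcov P s b v a).
  by rewrite big_split /= -mulr_suml -mulr_sumr sum_pcov // (sum_prob HP) // mulr0 mul1r addr0.
rewrite -big_split; apply: ler_sum => b _ /=.
have := prob_cond1 s b v a t1; set C := pcov _ _ _ _ _; set q := prob (cond1 _ _ _) _ _.
have := prob_ge0 HP s b t0; have := prob_le1 HP s b t0.
set p := prob P s b; set r := prob P v a => p1 p0 /eqP.
rewrite -subr_eq => /eqP <-.
have : 0 <= p * (1 - p) * (q - r) ^+ 2.
  by rewrite mulr_ge0 ?sqr_ge0 // mulr_ge0 // subr_ge0.
lra.
Qed.

Lemma prob_cond_agree S z s b : (#|s |: S| <= t)%N -> 0 < mass P S z ->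
  0 < prob (cond P S z) s b -> s \in S -> z s = b.
Proof.
move=> hS m0; rewrite /prob expect_cond => hp sS.
have [//|zb] := eqVneq (z s) b; move: hp.
rewrite (@eq_expect _ _ _ _ _ _ (fun=> 0 * 0)) => [|x].
  by rewrite expectZ mul0r mul0r ltxx.
case: agreeP => [h|_]; last by rewrite !mul0r.
by rewrite h // (negPf zb) !mulr0.
Qed.

Lemma agree_set_at S z s b x : (s \in S -> z s = b) ->
  (agree S z x)%:R * (x s == b)%:R = (agree (s |: S) (set_at z s b) x)%:R :> F.
Proof.
move=> hs; rewrite -natrM mulnb; congr (_%:R); congr nat_of_bool.
apply/andP/agreeP => [[/agreeP h /eqP xs] i|h].
  by rewrite !inE ffunE; case: eqP => [-> //|_] /=; apply: h.
split; last by rewrite h ?inE ?eqxx // ffunE eqxx.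
apply/agreeP => i iS; rewrite h ?inE ?iS ?orbT // ffunE.
by case: eqP iS => // -> /hs.
Qed.

Lemma mass_set_at S z s b : (s \in S -> z s = b) ->
  mass P (s |: S) (set_at z s b) =
  expect P (S :|: [set s]) (fun x => (agree S z x)%:R * (x s == b)%:R).
Proof.
move=> hs; rewrite /mass (setUC S); apply: eq_expect => x; by rewrite agree_set_at.
Qed.

(** Conditioning twice is conditioning once on the union. The vertex [s] may already lie in [S];
    positive probability then forces [b] to be its old value. *)
Lemma cond1_cond S z s b : (#|s |: S| <= t)%N -> 0 < mass P S z ->
  0 < prob (cond P S z) s b ->
  0 < mass P (s |: S) (set_at z s b) /\
  forall T f, expect (cond1 (cond P S z) s b) T f =
              expect (cond P (s |: S) (set_at z s b)) T f.
Proof.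
move=> hS m0 p0; have hs := prob_cond_agree hS m0 p0.
have pE : prob (cond P S z) s b = mass P (s |: S) (set_at z s b) / mass P S z.
  by rewrite mass_set_at // /prob expect_cond.
have m1 : 0 < mass P (s |: S) (set_at z s b).
  by move: p0; rewrite pE pmulr_lgt0 ?invr_gt0.
split=> // T f; rewrite expect_cond1 pE !expect_cond -/(mass _ _ _) -/(mass _ _ _).
rewrite (@eq_expect _ _ _ _ (S :|: (s |: T)) _
  (fun x => (agree (s |: S) (set_at z s b) x)%:R * f x)); last first.
  by move=> x; rewrite mulrA agree_set_at.
rewrite setUCA setUA; field.
by rewrite !gt_eqF.
Qed.

End Consistent.
End Conditioning.

(** * Saturating the influences by repeated conditioning *)

Section Saturation.
Variables (F : realFieldType) (V L : finType).
Implicit Types (P : {set V} -> {ffun V -> L} -> F) (S T U : {set V}).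
Implicit Types (x y z : {ffun V -> L}).
Variables (pi : V -> F) (om : V -> V -> F) (bad : V -> V -> {ffun V -> L} -> F) (lam : F).
Hypotheses (pi_ge0 : forall v, 0 <= pi v) (pi_sum : \sum_v pi v = 1).
Hypotheses (om_ge0 : forall u v, 0 <= om u v) (lam_ge0 : 0 <= lam).
Hypotheses (bad_ge0 : forall u v x, 0 <= bad u v x)
  (bad_dep : forall u v, depends_on [set u; v] (bad u v)).

Definition coll P := \sum_v pi v * \sum_a prob P v a ^+ 2.
Definition loss P := \sum_u \sum_v om u v * expect P [set u; v] (bad u v).
(** Conditioning raises [coll] on average and leaves the mean of [loss] unchanged. The weighted
    difference allows a single outcome to be chosen that gains on the first while the penalty [lam]
    keeps the second from growing much. *)
Definition potential P := coll P - lam * loss P.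
Definition influence P s := \sum_v pi v * \sum_a \sum_b pcov P s b v a ^+ 2.
Definition deviation (Lb : V -> L) P :=
  \sum_v pi v * expect P [set v] (fun x => (x v != Lb v)%:R).

Lemma eq_potential P P' : (forall T f, expect P T f = expect P' T f) ->
  potential P = potential P'.
Proof.
move=> h; congr (_ - _ * _); first apply: eq_bigr => v _.
  by congr (_ * _); apply: eq_bigr => a _; rewrite /prob h.
by apply: eq_bigr => u _; apply: eq_bigr => v _; rewrite h.
Qed.

Lemma eq_deviation Lb P P' : (forall T f, expect P T f = expect P' T f) ->
  deviation Lb P = deviation Lb P'.
Proof. by move=> h; apply: eq_bigr => u _; rewrite h. Qed.

Lemma coll_le1 t P : local_dist t P -> (0 < t)%N -> coll P <= 1.
Proof.
move=> HP t0; rewrite -[leRHS]pi_sum; apply: ler_sum => v _.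
rewrite -[leRHS]mulr1 ler_wpM2l // -(sum_prob HP v t0); apply: ler_sum => a _.
by rewrite expr2 ler_piMr ?(prob_ge0 HP) ?(prob_le1 HP).
Qed.

Lemma coll_ge0 P : 0 <= coll P.
Proof. by apply: sumr_ge0 => v _; rewrite mulr_ge0 // sumr_ge0 // => a _; rewrite sqr_ge0. Qed.

Lemma loss_ge0 t P : local_dist t P -> (1 < t)%N -> 0 <= loss P.
Proof.
move=> HP t1; apply: sumr_ge0 => u _; apply: sumr_ge0 => v _.
by rewrite mulr_ge0 // (expect_ge0 HP) // card_pair.
Qed.

Lemma potential_step t P s : local_dist t P -> (2 < t)%N ->
  exists2 b, 0 < prob P s b & potential P + influence P s <= potential (cond1 P s b).
Proof.
move=> HP t2; apply: mean_witness; [by move=> b; apply: (prob_ge0 HP); lia|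
  by apply: (sum_prob HP); lia|].
have c3 u v : (#|s |: [set u; v]| <= t)%N.
  by apply: leq_trans t2; rewrite cardsU1 cards2; case: (s \notin _); case: (u != v).
under eq_bigr do rewrite /potential mulrBr.
rewrite sumrB.
have -> : \sum_b prob P s b * (lam * loss (cond1 P s b)) = lam * loss P.
  under eq_bigr do rewrite mulrCA.
  rewrite -mulr_sumr; congr (_ * _); under eq_bigr do rewrite mulr_sumr.
  rewrite exchange_big; apply: eq_bigr => u _ /=.
  under eq_bigr do rewrite mulr_sumr.
  rewrite exchange_big; apply: eq_bigr => v _ /=.
  under eq_bigr do rewrite mulrCA.
  by rewrite -mulr_sumr (total_expectation HP).
rewrite /potential addrAC lerD2r.
under [leRHS]eq_bigr do rewrite /coll mulr_sumr.
rewrite exchange_big /= /coll /influence -big_split; apply: ler_sum => v _ /=.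
under [leRHS]eq_bigr do rewrite mulrCA.
rewrite -mulr_sumr -mulrDr ler_wpM2l //.
under [leRHS]eq_bigr do rewrite mulr_sumr.
rewrite [leRHS]exchange_big -big_split /=; apply: ler_sum => a _.
by apply: (collision_step HP); lia.
Qed.

(* The influence of a variable is what the potential gains, in expectation, by
   conditioning on it. *)
Lemma saturate t P (d : F) N S z : local_dist t P -> 0 < d ->
  (#|S| + N + 2 <= t)%N -> 0 < mass P S z ->
  1 - potential (cond P S z) < N%:R * d ->
  exists S', exists z', [/\ (#|S'| <= #|S| + N)%N, 0 < mass P S' z',
    potential (cond P S z) <= potential (cond P S' z') &
    forall s, influence (cond P S' z') s < d].
Proof.
move=> HP d0; elim: N S z => [|N IH] S z hN m0 hp.
  have HC : local_dist (t - #|S|) (cond P S z) by apply: cond_local; rewrite // ?gt_eqF //; lia.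
  move: hp; rewrite mul0r subr_lt0 ltNge => /negP[]; rewrite lerBlDr.
  apply: le_trans (coll_le1 HC _) _; first by lia.
  by rewrite lerDl mulr_ge0 // (loss_ge0 HC) //; lia.
have HC : local_dist (t - #|S|) (cond P S z) by apply: cond_local; rewrite // ?gt_eqF //; lia.
case: (pickP (fun s => d <= influence (cond P S z) s)) => [s hs|h]; last first.
  exists S, z; split=> // [|s]; first by lia.
  by have := h s; rewrite ltNge => ->.
have [|b pb hb] := potential_step s HC; first by lia.
have sS : (#|s |: S| <= #|S| + 1)%N by rewrite cardsU1; case: (s \notin S); lia.
have [|m1 hE] := cond1_cond (t := t) _ m0 pb; first by lia.
have e1 := eq_potential hE.
have [|//||S' [z' [h1 h2 h3 h4]]] := IH (s |: S) (set_at z s b); first by lia.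
  by rewrite -e1; move: hp hb; rewrite -natr1 mulrDl mul1r; lra.
exists S', z'; split=> //; first by lia.
by apply: le_trans h3; rewrite -e1; apply: le_trans hb; lra.
Qed.

(** [deviation] is linear in the distribution, so some outcome of every further conditioning does
    not increase it. The labels [Lb] stay fixed while the conditioning set is brought to a
    prescribed size. *)
Lemma pad t P Lb N S z : local_dist t P -> (#|S| + N < t)%N -> (t <= #|V|)%N ->
  0 < mass P S z ->
  exists S', exists z', [/\ #|S'| = (#|S| + N)%N, 0 < mass P S' z' &
    deviation Lb (cond P S' z') <= deviation Lb (cond P S z)].
Proof.
clear lam_ge0; move=> HP + tV; elim: N S z => [|N IH] S z hN m0.
  by exists S, z; split=> //; rewrite addn0.
have HC : local_dist (t - #|S|) (cond P S z) by apply: cond_local; rewrite // ?gt_eqF //; lia.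
have [s sS] : exists s, s \notin S.
  have : (#|S| < #|V|)%N by lia.
  rewrite -cardsT => hlt; case: (pickP (fun s => s \notin S)) => [s|h]; first by exists s.
  move: hlt; suff -> : S = setT by rewrite ltnn.
  by apply/setP => s; have := h s; rewrite inE => /negbT/negPn ->.
have [b pb hb] : exists2 b, 0 < prob (cond P S z) s b &
    - deviation Lb (cond P S z) <= - deviation Lb (cond1 (cond P S z) s b).
  apply: mean_witness; [by move=> b; apply: (prob_ge0 HC); lia|
    by apply: (sum_prob HC); lia|].
  under eq_bigr do rewrite mulrN.
  rewrite sumrN lerN2; under eq_bigr do rewrite mulr_sumr.
  rewrite exchange_big; apply: ler_sum => v _ /=.
  under eq_bigr do rewrite mulrCA.
  rewrite -mulr_sumr (total_expectation HC) //; first by apply: card_pair; lia.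
  by apply: (@depends_at _ _ _ _ _ (fun c => (c != Lb v)%:R)); rewrite inE.
have cS : #|s |: S| = (#|S| + 1)%N by rewrite cardsU1 sS addnC.
have [|m1 hE] := cond1_cond (t := t) _ m0 pb; first by lia.
have [||S' [z' [h1 h2 h3]]] := IH (s |: S) (set_at z s b); rewrite ?cS //; first by lia.
exists S', z'; split=> //; first by lia.
by apply: le_trans h3 _; rewrite -(eq_deviation Lb hE) -lerN2.
Qed.

End Saturation.

(** * Sampled positive semidefiniteness *)

Section SampleAverage.
Variables (F : realFieldType) (V : finType) (rho : V -> F).
Hypotheses (rho_ge0 : forall v, 0 <= rho v) (rho_sum : \sum_v rho v = 1).

Fixpoint sample_avg r (f : seq V -> F) : F :=
  if r is r'.+1 then \sum_u rho u * sample_avg r' (fun s => f (u :: s)) else f [::].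

Lemma eq_sample_avg r f g : f =1 g -> sample_avg r f = sample_avg r g.
Proof.
by elim: r f g => [|r IH] f g fg //=; apply: eq_bigr => u _; rewrite (IH _ (fun s => g (u :: s))).
Qed.

Lemma sample_avg_ge0 r f : (forall s, size s = r -> 0 <= f s) -> 0 <= sample_avg r f.
Proof.
elim: r f => [|r IH] f hf /=; first exact: hf.
by apply: sumr_ge0 => u _; rewrite mulr_ge0 // IH // => s hs; rewrite hf //= hs.
Qed.

Lemma sample_avgD r f g :
  sample_avg r (fun s => f s + g s) = sample_avg r f + sample_avg r g.
Proof.
elim: r f g => [|r IH] f g //=; rewrite -big_split; apply: eq_bigr => u _ /=.
by rewrite IH mulrDr.
Qed.

Lemma sample_avgZ r c f : sample_avg r (fun s => c * f s) = c * sample_avg r f.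
Proof.
elim: r f => [|r IH] f //=; rewrite mulr_sumr; apply: eq_bigr => u _ /=.
by rewrite IH mulrCA.
Qed.

Lemma sample_avg_cst r c : sample_avg r (fun=> c) = c.
Proof. by elim: r => [|r IH] //=; rewrite -mulr_suml rho_sum mul1r IH. Qed.

Lemma sample_avg_sum r (f : V -> F) :
  sample_avg r (fun s => \sum_(u <- s) f u) = r%:R * \sum_u rho u * f u.
Proof.
elim: r => [|r IH] /=; first by rewrite big_nil mul0r.
under eq_bigr do rewrite (eq_sample_avg r (fun s => big_cons _ _ _ _ _ _))
  sample_avgD sample_avg_cst IH mulrDr.
by rewrite big_split /= -mulr_suml rho_sum mul1r -natr1; ring.
Qed.

(** Of the r^2 ordered pairs of samples, r coincide and r (r - 1) are independent. *)
Lemma sample_avg_quad r (c : V -> V -> F) : (forall u v, c u v = c v u) ->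
  sample_avg r (fun s => \sum_(u <- s) \sum_(v <- s) c u v) =
  r%:R * \sum_u rho u * c u u +
  r%:R * (r%:R - 1) * \sum_u rho u * \sum_v rho v * c u v.
Proof.
move=> cC; elim: r => [|r IH] /=; first by rewrite big_nil !mul0r addr0.
have E u s : \sum_(u0 <- u :: s) \sum_(v <- u :: s) c u0 v =
    c u u + (2 * \sum_(v <- s) c u v + \sum_(u0 <- s) \sum_(v <- s) c u0 v).
  rewrite !big_cons; under [X in _ + X]eq_bigr do rewrite big_cons cC.
  by rewrite big_split /=; ring.
under eq_bigr do rewrite (eq_sample_avg r (E _)) sample_avgD sample_avg_cst
  sample_avgD sample_avgZ sample_avg_sum IH mulrDr mulrDr.
rewrite big_split big_split /= -mulr_suml rho_sum mul1r.
under [X in _ + (X + _) = _]eq_bigr do rewrite mulrCA (mulrCA (rho _)).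
by rewrite -!mulr_sumr -natr1; ring.
Qed.

End SampleAverage.

Section ApproximatePSD.
Variables (F : realFieldType) (V L : finType) (t : nat).
Variables (P : {set V} -> {ffun V -> L} -> F).
Hypothesis HP : local_dist t P.

Lemma cov_centered u (g : L -> F) v (h : L -> F) :
  (#|[set u; v]| <= t)%N ->
  cov P u g v h = expect P [set u; v] (fun x =>
    (g (x u) - expect P [set u] (fun x => g (x u))) *
    (h (x v) - expect P [set v] (fun x => h (x v)))).
Proof.
move=> ht; rewrite /cov; set a := expect P [set u] _; set b := expect P [set v] _.
rewrite (@eq_expect _ _ _ _ _ (fun x => (g (x u) - a) * (h (x v) - b))
  (fun x => (g (x u) * h (x v) - a * h (x v)) - (b * g (x u) - a * b))); last first.
  by move=> x; ring.
rewrite !expectB !expectZ (expect_cst HP) //.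
rewrite (expect_sub HP (f := fun x => h (x v)) (U := [set v])) ?subsetUr //;
  last by apply: (@depends_at _ _ _ _ _ h); rewrite inE.
rewrite (expect_sub HP (f := fun x => g (x u)) (U := [set u])) ?subsetUl //;
  last by apply: (@depends_at _ _ _ _ _ g); rewrite inE.
by rewrite -/a -/b; ring.
Qed.

(** The double sum is the variance of the sum of the listed functions under the joint distribution
    of the vertices involved, which is available because the list has at most [t] entries. Vertices
    may repeat, as samples do. *)
Lemma cov_list_ge0 (l : seq (V * (L -> F))) : (size l <= t)%N ->
  0 <= \sum_(p <- l) \sum_(p' <- l) cov P p.1 p.2 p'.1 p'.2.
Proof.
move=> hl; pose T := [set v in map fst l].
have hT : (#|T| <= t)%N.
  by rewrite cardsE; apply: leq_trans (card_size _) _; rewrite size_map.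
pose c (p : V * (L -> F)) (x : {ffun V -> L}) :=
  p.2 (x p.1) - expect P [set p.1] (fun x => p.2 (x p.1)).
have -> : \sum_(p <- l) \sum_(p' <- l) cov P p.1 p.2 p'.1 p'.2 =
    expect P T (fun x => (\sum_(p <- l) c p x) * (\sum_(p <- l) c p x)).
  rewrite (@eq_expect _ _ _ _ _ _ (fun x => \sum_(p <- l) \sum_(p' <- l) c p x * c p' x));
    last by move=> x; rewrite big_distrlr.
  rewrite expect_sum big_tnth [RHS]big_tnth; apply: eq_bigr => i _.
  rewrite expect_sum big_tnth [RHS]big_tnth; apply: eq_bigr => j _.
  have memT k : (tnth (in_tuple l) k).1 \in T.
    by rewrite inE -(tnth_map fst) mem_tnth.
  move: (memT i) (memT j); set p := tnth _ i; set p' := tnth _ j => pT p'T.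
  have sT : [set p.1; p'.1] \subset T.
    by apply/subsetP => v; rewrite !inE => /orP[] /eqP->; move: pT p'T; rewrite !inE.
  rewrite cov_centered ?(leq_trans (subset_leq_card sT)) //; symmetry.
  apply: (expect_sub HP) => //.
  by move=> x y xy; rewrite /c !xy ?inE ?eqxx ?orbT.
by apply: (expect_ge0 HP) => // x; rewrite -expr2 sqr_ge0.
Qed.

Lemma covZ u (g : L -> F) k v (h : L -> F) :
  cov P u (fun c => k * g c) v h = k * cov P u g v h.
Proof.
rewrite /cov mulrBr mulrA; congr (_ - _ * _); rewrite -expectZ //.
by apply: eq_expect => x; rewrite mulrA.
Qed.

Lemma cov_sum u (g : L -> F) v (h : L -> F) :
  cov P u g v h = \sum_a \sum_b g a * h b * pcov P u a v b.
Proof.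
have E (k : L -> F) c : k c = \sum_a k a * ind F a c.
  rewrite (bigD1 c) //= /ind eqxx mulr1 big1 ?addr0 // => a.
  by rewrite eq_sym => /negPf->; rewrite mulr0.
have E1 w (k : L -> F) : expect P [set w] (fun x => k (x w)) =
    \sum_a k a * expect P [set w] (fun x => ind F a (x w)).
  rewrite (eq_expect _ _ (fun x => E k (x w))) expect_sum.
  by under eq_bigr do rewrite expectZ.
have -> : \sum_a \sum_b g a * h b * pcov P u a v b =
  \sum_a \sum_b g a * h b * expect P [set u; v] (fun x => ind F a (x u) * ind F b (x v)) -
  \sum_a \sum_b g a * h b * (expect P [set u] (fun x => ind F a (x u)) *
                             expect P [set v] (fun x => ind F b (x v))).
  rewrite -sumrB; apply: eq_bigr => a _; rewrite -sumrB; apply: eq_bigr => b _.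
  by rewrite -mulrBr.
rewrite /cov; congr (_ - _).
  under [RHS]eq_bigr do under eq_bigr do rewrite -expectZ.
  under [RHS]eq_bigr do rewrite -expect_sum.
  rewrite -expect_sum; apply: eq_expect => x.
  rewrite (E g) (E h) big_distrlr; apply: eq_bigr => a _; apply: eq_bigr => b _ /=.
  by ring.
rewrite (E1 u) (E1 v) big_distrlr; apply: eq_bigr => a _; apply: eq_bigr => b _ /=.
by ring.
Qed.

(* Averaging [cov_list_ge0] over r independent samples: the covariances are
   positive semidefinite up to a diagonal correction of relative size 1/r. *)
Lemma sampled_psd r z (h : L -> F) (x : F) (rho : V -> F) (G : V -> L -> F) :
  (r < t)%N -> (0 < r)%N -> (forall v, 0 <= rho v) -> \sum_v rho v = 1 ->
  let beta := \sum_u rho u * \sum_v rho v * cov P u (G u) v (G v) in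
  0 <= r%:R * (x ^+ 2 * cov P z h z h + 2 * x * \sum_u rho u * cov P z h u (G u) + beta) +
       (\sum_u rho u * cov P u (G u) u (G u) - beta).
Proof.
move=> rt r0 rho0 rho1; set beta := \sum_u _ * \sum_v _; cbv zeta.
(* Scaling the single copy of [h] by r balances it against the r samples: every term then carries a
   factor r, which is divided out at the end. *)
pose p0 := (z, fun c => (r%:R * x) * h c); pose lift u := (u, G u).
have : 0 <= sample_avg rho r (fun s => \sum_(p <- p0 :: map lift s)
    \sum_(p' <- p0 :: map lift s) cov P p.1 p.2 p'.1 p'.2).
  apply: sample_avg_ge0 => // s hs; apply: cov_list_ge0.
  by rewrite /= size_map hs.
have E s : \sum_(p <- p0 :: map lift s)
    \sum_(p' <- p0 :: map lift s) cov P p.1 p.2 p'.1 p'.2 =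
    (r%:R * x) ^+ 2 * cov P z h z h + (2 * (r%:R * x) * \sum_(u <- s) cov P z h u (G u) +
    \sum_(u <- s) \sum_(v <- s) cov P u (G u) v (G v)).
  rewrite !big_cons /= !big_map.
  under [X in _ + X = _]eq_bigr do rewrite big_cons big_map /= covC covZ.
  under [X in _ + X + _ = _]eq_bigr do rewrite covZ.
  rewrite [X in _ + X = _]big_split /= -!mulr_sumr covZ (covC P z h) covZ.
  by ring.
rewrite (eq_sample_avg _ _ E) !sample_avgD sample_avg_cst // sample_avgZ sample_avg_sum //.
rewrite sample_avg_quad // -/beta => [|u v]; last exact: covC.
set A := \sum_u _; set B := \sum_u _; set C := cov _ _ _ _ _ => H.
have r0' : 0 < r%:R :> F by rewrite ltr0n.
rewrite -(pmulr_rge0 _ r0'); move: H; congr (0 <= _); ring.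
Qed.

End ApproximatePSD.

Section CauchySchwarz.
Variables (F : realFieldType) (I : finType).
Implicit Types (p x y : I -> F).

Lemma sum_sqr_le p x : (forall i, 0 <= p i) -> \sum_i p i = 1 ->
  (\sum_i p i * x i) ^+ 2 <= \sum_i p i * x i ^+ 2.
Proof.
move=> p0 p1; set m := \sum_i p i * x i.
have : 0 <= \sum_i p i * (x i - m) ^+ 2.
  by apply: sumr_ge0 => i _; rewrite mulr_ge0 ?sqr_ge0.
rewrite (eq_bigr (fun i => p i * x i ^+ 2 - 2 * m * (p i * x i) + m ^+ 2 * p i)).
  rewrite big_split sumrB /= -!mulr_sumr p1 -/m; lra.
by move=> i _; ring.
Qed.

End CauchySchwarz.

(** * Correlation when the walk is doubled *)

Section Doubling.
Variables (F : realFieldType) (V L : finType) (t : nat).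
Variables (P : {set V} -> {ffun V -> L} -> F).
Hypothesis HP : local_dist t P.
Variables (pi : V -> F) (K : V * L -> V * L -> F) (k : V -> V -> F).
Hypotheses (pi_ge0 : forall v, 0 <= pi v) (pi_sum : \sum_v pi v = 1).
Hypotheses (K_ge0 : forall i j, 0 <= K i j) (K_sym : forall i j, K i j = K j i).
Hypotheses (K_marg : forall u a v, \sum_b K (u, a) (v, b) = k u v).
Hypotheses (k_sym : forall u v, k u v = k v u) (k_sum : forall v, \sum_u k u v = pi v).

Definition corr (K : V * L -> V * L -> F) :=
  \sum_i \sum_j K i j * pcov P i.1 i.2 j.1 j.2.

(** A kernel is the joint law of a stationary pair, each label of a vertex carrying the full mass of
    that vertex; composing two kernels therefore divides by the mass of the middle vertex. *)
Definition comp (K K' : V * L -> V * L -> F) i j := \sum_w K i w * K' w j / pi w.1.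

Lemma sum_pair (G : V * L -> F) : \sum_i G i = \sum_u \sum_a G (u, a).
Proof. by rewrite pair_bigA; apply: eq_bigr => -[]. Qed.

Lemma kernel_marg_ge0 (a0 : L) u v : 0 <= k u v.
Proof. by rewrite -(K_marg u a0 v) sumr_ge0. Qed.

Lemma kernel_le u a w c : K (u, a) (w, c) <= k u w.
Proof. by rewrite -(K_marg u a w) (bigD1 c) //= lerDl sumr_ge0. Qed.

Lemma kernel_null u a w c : k u w = 0 -> K (u, a) (w, c) = 0.
Proof. by move=> k0; apply/le_anti; rewrite K_ge0 -k0 kernel_le. Qed.

Lemma kernel_marg_null (a0 : L) u w : pi w = 0 -> k u w = 0.
Proof.
move=> p0; apply/le_anti; rewrite (kernel_marg_ge0 a0) andbT.
rewrite -p0 -(k_sum w) (bigD1 u) //= lerDl sumr_ge0 // => v _.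
exact: (kernel_marg_ge0 a0).
Qed.

(** [b w] correlates the label of [w] with that of a random neighbour, and [be w] the labels of two
    independent neighbours that are consistent with the same label of [w]. Their means are the
    correlations of the walk and of its double. *)
Let b w := \sum_c \sum_i K i (w, c) / pi w * pcov P w c i.1 i.2.
Let be w := \sum_c \sum_i \sum_j
  K i (w, c) / pi w * (K j (w, c) / pi w) * pcov P i.1 i.2 j.1 j.2.

Lemma corrE : corr K = \sum_w pi w * b w.
Proof.
rewrite /corr exchange_big sum_pair; apply: eq_bigr => w _; rewrite mulr_sumr.
apply: eq_bigr => c _; rewrite mulr_sumr; apply: eq_bigr => -[u a] _ /=.
rewrite /pcov covC; have [p0|p0] := eqVneq (pi w) 0; last by field.
by rewrite kernel_null ?(kernel_marg_null a) // !mul0r mulr0.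
Qed.

Lemma corr_compE : corr (comp K K) = \sum_w pi w * be w.
Proof.
rewrite /corr /comp.
transitivity (\sum_w \sum_i \sum_j K i w * K w j / pi w.1 * pcov P i.1 i.2 j.1 j.2).
  rewrite [RHS]exchange_big; apply: eq_bigr => i _; rewrite [RHS]exchange_big.
  by apply: eq_bigr => j _; rewrite mulr_suml.
rewrite sum_pair; apply: eq_bigr => w _; rewrite mulr_sumr; apply: eq_bigr => c _.
rewrite mulr_sumr; apply: eq_bigr => -[u a] _; rewrite mulr_sumr; apply: eq_bigr => j _ /=.
rewrite (K_sym (w, c)); have [p0|p0] := eqVneq (pi w) 0; last by field.
by rewrite kernel_null ?(kernel_marg_null a) // !mul0r mulr0.
Qed.

(** This is [sampled_psd] for the indicator of each label of [w] against the labels it imposes on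
    the neighbours, summed over the labels. *)
Lemma corr_at w r : (r < t)%N -> (0 < r)%N -> 0 < pi w ->
  r%:R * b w ^+ 2 <= r%:R * be w + (1 - be w).
Proof.
move=> rt r0 p0; have t0 : (0 < t)%N by lia.
have pw : pi w != 0 by rewrite gt_eqF.
pose rho u := k u w / pi w; pose G c u a := K (u, a) (w, c) / k u w.
have rhoG c u a : rho u * G c u a = K (u, a) (w, c) / pi w.
  rewrite /rho /G; have [k0|k0] := eqVneq (k u w) 0; last by field; rewrite k0 pw.
  by rewrite kernel_null // k0 !mul0r.
case: (pickP (@predT L)) => [a0 _|L0]; last first.
  have L0' (H : L -> F) : \sum_c H c = 0 by apply: big1 => c; have := L0 c.
  have := sum_prob HP w t0; rewrite L0' => /eqP; by rewrite eq_sym oner_eq0.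
have k_ge0 := kernel_marg_ge0 a0.
have rho_ge0 u : 0 <= rho u by rewrite divr_ge0.
have rho_sum : \sum_u rho u = 1 by rewrite -mulr_suml k_sum divff.
have t1 (v : V) : (#|[set v]| <= t)%N by rewrite cards1.
pose cw c := cov P w (ind F c) w (ind F c).
pose bc c := \sum_u rho u * cov P w (ind F c) u (G c u).
pose gc c := \sum_u rho u * \sum_v rho v * cov P u (G c u) v (G c v).
pose dc c := \sum_u rho u * cov P u (G c u) u (G c u).
(* Summed over [c], the quadratic in the free scalar x is at most x^2 + 2 x b + be, whose minimum is
   at x = - b. *)
have H c : 0 <= r%:R * ((- b w) ^+ 2 * cw c + 2 * (- b w) * bc c + gc c) + (dc c - gc c).
  exact: (sampled_psd HP w (ind F c) (- b w) (G c) rt r0 rho_ge0 rho_sum).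
have Sb : \sum_c bc c = b w.
  apply: eq_bigr => c _; rewrite sum_pair; apply: eq_bigr => u _.
  rewrite cov_sum (bigD1 c) //= [X in _ + X]big1 ?addr0 => [|c' cc']; last first.
    by apply: big1 => a _; rewrite /ind (negPf cc') !mul0r.
  by rewrite mulr_sumr; apply: eq_bigr => a _; rewrite /ind eqxx mul1r mulrA rhoG.
have Sg : \sum_c gc c = be w.
  apply: eq_bigr => c _; rewrite sum_pair; apply: eq_bigr => u _.
  rewrite mulr_sumr.
  transitivity (\sum_a \sum_v \sum_b K (u, a) (w, c) / pi w * (K (v, b) (w, c) / pi w) *
    pcov P u a v b); last by apply: eq_bigr => a _; rewrite [RHS]sum_pair.
  rewrite [RHS]exchange_big; apply: eq_bigr => v _ /=; rewrite cov_sum !mulr_sumr.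
  apply: eq_bigr => a _; rewrite !mulr_sumr; apply: eq_bigr => b' _.
  by rewrite -!rhoG; ring.
have Sw : \sum_c cw c <= 1.
  rewrite -(sum_prob HP w t0); apply: ler_sum => c _; rewrite /cw /cov.
  rewrite lerBlDr -expr2 -[leLHS]addr0 lerD ?sqr_ge0 // setUid.
  by apply: (expect_le HP) => // x; rewrite /ind -natrM mulnb andbb.
have Sd : \sum_c dc c <= 1.
  rewrite exchange_big -[leRHS]rho_sum; apply: ler_sum => u _ /=.
  rewrite -mulr_sumr -[leRHS]mulr1 ler_wpM2l //.
  rewrite -(expect_cst HP 1 (t1 u)).
  apply: (@le_trans _ _ (expect P [set u] (fun x => \sum_c G c u (x u)))).
    rewrite expect_sum; apply: ler_sum => c _; rewrite /cov lerBlDr -expr2.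
    rewrite -[leLHS]addr0 lerD ?sqr_ge0 // setUid; apply: (expect_le HP) => // x.
    rewrite ler_piMl // /G ?divr_ge0 //.
    have [k0|k0] := eqVneq (k u w) 0; first by rewrite k0 invr0 mulr0.
    by rewrite ler_pdivrMr ?mul1r ?kernel_le // lt_def k0 k_ge0.
  apply: (expect_le HP) => // x; rewrite -mulr_suml K_marg.
  by have [->|k0] := eqVneq (k u w) 0; rewrite ?mul0r ?divff.
have : 0 <= \sum_c (r%:R * ((- b w) ^+ 2 * cw c + 2 * (- b w) * bc c + gc c) + (dc c - gc c)).
  by apply: sumr_ge0.
rewrite big_split /= sumrB -mulr_sumr !big_split /= -!mulr_sumr Sb Sg => {}H.
have : r%:R * b w ^+ 2 * \sum_c cw c <= r%:R * b w ^+ 2 * 1.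
  by rewrite ler_wpM2l // mulr_ge0 ?ler0n ?sqr_ge0.
move: H Sd; set X := \sum_c _; set Y := \sum_c _; lra.
Qed.

Lemma corr_doubling r : (r < t)%N -> (0 < r)%N ->
  r%:R * corr K ^+ 2 <= r%:R * corr (comp K K) + (1 - corr (comp K K)).
Proof.
move=> rt r0; rewrite corrE corr_compE.
apply: (@le_trans _ _ (r%:R * \sum_w pi w * b w ^+ 2)).
  by rewrite ler_wpM2l ?ler0n // sum_sqr_le.
set Y := \sum_w pi w * be w.
have -> : 1 - Y = \sum_w (pi w - pi w * be w) by rewrite sumrB pi_sum.
rewrite /Y [leLHS]mulr_sumr [X in _ <= X + _]mulr_sumr -big_split /=; apply: ler_sum => w _.
have [p0|p0] := eqVneq (pi w) 0; first by rewrite p0 !mul0r !mulr0 subrr addr0.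
have pw : 0 < pi w by rewrite lt_def p0 pi_ge0.
have := ler_wpM2l (ltW pw) (corr_at rt r0 pw).
by set x := b w; set y := be w; lra.
Qed.

End Doubling.

(** * Random walks and small-set expansion *)

Section Spread.
Variables (F : realFieldType) (V : finType) (k : V -> V -> F) (pi : V -> F).
Hypotheses (k_ge0 : forall u v, 0 <= k u v) (k_sym : forall u v, k u v = k v u).
Hypotheses (k_sum : forall v, \sum_u k u v = pi v) (pi_sum : \sum_v pi v = 1).

Lemma kernel_pi_ge0 v : 0 <= pi v.
Proof. by rewrite -k_sum sumr_ge0. Qed.

Lemma kernel_pi_null u v : pi v = 0 -> k u v = 0.
Proof.
move=> p0; apply/le_anti; rewrite k_ge0 andbT -p0 -k_sum (bigD1 u) //= lerDl.
exact: sumr_ge0.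
Qed.

Lemma sum_kernel_l (f : V -> F) : \sum_u \sum_v k u v * f u = \sum_u pi u * f u.
Proof.
apply: eq_bigr => u _; rewrite -mulr_suml -k_sum; congr (_ * _).
by apply: eq_bigr => v _; rewrite k_sym.
Qed.

Lemma sum_kernel_r (f : V -> F) : \sum_u \sum_v k u v * f v = \sum_u pi u * f u.
Proof. by rewrite exchange_big; apply: eq_bigr => v _; rewrite -mulr_suml k_sum. Qed.

Lemma amgm (x y s : F) : 0 < s -> x * y <= (s * x ^+ 2 + y ^+ 2 / s) / 2.
Proof.
move=> s0; rewrite -subr_ge0.
have -> : (s * x ^+ 2 + y ^+ 2 / s) / 2 - x * y = (s * x - y) ^+ 2 / (2 * s).
  by field; rewrite gt_eqF.
by rewrite divr_ge0 ?sqr_ge0 // mulr_ge0 // ltW.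
Qed.

Lemma sum_kernel_amgm (g h : V -> F) s : 0 < s ->
  \sum_u \sum_v k u v * (g u * h v) <=
  (s * \sum_v pi v * g v ^+ 2 + (\sum_v pi v * h v ^+ 2) / s) / 2.
Proof.
move=> s0; rewrite -sum_kernel_l -sum_kernel_r mulr_sumr mulr_suml -big_split mulr_suml.
apply: ler_sum => u _; rewrite mulr_sumr mulr_suml -big_split mulr_suml.
apply: ler_sum => v _ /=; have := ler_wpM2l (k_ge0 u v) (amgm (g u) (h v) s0).
by move=> H; apply: le_trans H _; rewrite le_eqVlt; apply/orP; left; apply/eqP; ring.
Qed.

(** Subtracting from [f] its least positive value on its support splits both sides into a level-set
    term, bounded by the hypothesis, and the same claim for a smaller support. *)
Lemma layer_cake (Z : {set V}) (th : F) (f : V -> F) :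
  (forall Y : {set V}, Y \subset Z ->
     \sum_(u in Y) \sum_(v in Y) k u v <= th * \sum_(u in Y) pi u) ->
  (forall v, 0 <= f v) -> (forall v, v \notin Z -> f v = 0) ->
  \sum_u \sum_v k u v * Num.min (f u) (f v) <= th * \sum_v pi v * f v.
Proof.
move=> hZ; move: {2}(#|[set v | f v != 0]|) (leqnn #|[set v | f v != 0]|) => n.
elim: n f => [|n IH] f hn f0 fZ.
  have {}f0 v : f v = 0.
    apply/eqP; move: hn; rewrite leqn0 cards_eq0 => /eqP/setP/(_ v).
    by rewrite !inE => /negbT/negPn.
  rewrite [X in _ <= _ * X]big1 => [|v _]; last by rewrite f0 mulr0.
  by rewrite mulr0 big1 // => u _; apply: big1 => v _; rewrite !f0 minxx mulr0.
have [v0 v0f|nov] := pickP (fun v => f v != 0); last first.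
  by apply: IH => //; rewrite (_ : [set v | _] = set0) ?cards0 //; apply/setP=> v; rewrite !inE nov.
pose Y := [set v | f v != 0]; pose w := [arg min_(v < v0 | f v != 0) f v]%O; pose m := f w.
have [wf wmin] : f w != 0 /\ forall v, f v != 0 -> m <= f v.
  by rewrite /m /w; case: arg_minP => // i fi mi; split.
pose f' v := if v \in Y then f v - m else 0.
have YZ : Y \subset Z.
  by apply/subsetP => v; rewrite inE; apply: contraR => /fZ->.
have f'0 v : 0 <= f' v by rewrite /f' inE; case: eqP => //= /eqP/wmin; rewrite subr_ge0.
have fE v : f v = f' v + m * (v \in Y)%:R.
  by rewrite /f' inE; case: eqP => [->|] /=; rewrite ?mulr1 ?subrK ?mulr0 ?addr0.
have m0 : 0 <= m by apply: f0.
have mE u v : Num.min (f u) (f v) = Num.min (f' u) (f' v) + m * ((u \in Y)%:R * (v \in Y)%:R).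
  have f'z z : z \in Y = false -> f' z = 0 by rewrite /f' => ->.
  rewrite (fE u) (fE v); case uY: (u \in Y); case vY: (v \in Y); rewrite ?mulr1.
  - by rewrite addr_minl.
  - by rewrite (f'z v) // ?mulr0 ?addr0 !min_r // addr_ge0.
  - by rewrite (f'z u) // ?mul0r ?mulr0 ?addr0 !min_l // addr_ge0.
  - by rewrite ?mul0r ?mulr0 ?addr0.
have -> : \sum_u \sum_v k u v * Num.min (f u) (f v) =
    \sum_u \sum_v k u v * Num.min (f' u) (f' v) + m * \sum_(u in Y) \sum_(v in Y) k u v.
  rewrite [X in m * X]big_mkcond mulr_sumr -big_split; apply: eq_bigr => u _ /=.
  transitivity (\sum_v (k u v * Num.min (f' u) (f' v) + m * ((u \in Y)%:R * (v \in Y)%:R * k u v))).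
    by apply: eq_bigr => v _; rewrite mE; ring.
  rewrite big_split -mulr_sumr /=; congr (_ + _ * _); case: (u \in Y); last first.
    by apply: big1 => v _; rewrite !mul0r.
  by rewrite [RHS]big_mkcond; apply: eq_bigr => v _; case: (v \in Y); rewrite /= ?mul1r ?mul0r.
have -> : \sum_v pi v * f v = \sum_v pi v * f' v + m * \sum_(v in Y) pi v.
  rewrite [X in m * X]big_mkcond mulr_sumr -big_split; apply: eq_bigr => v _ /=.
  by rewrite fE mulrDr; case: (v \in Y); rewrite ?mulr1 ?(mulrC m) ?mulr0 ?mul0r ?mulr0.
rewrite mulrDr lerD //; last by rewrite mulrCA ler_wpM2l // hZ.
apply: IH => [|//|v vZ]; last first.
  by rewrite /f'; case: ifP => // /(subsetP YZ); rewrite (negPf vZ).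
rewrite -ltnS; apply: leq_trans hn; apply: proper_card; apply/properP; split.
  by apply/subsetP => v; rewrite !inE /f' inE; case: (f v =P 0) => //= _; rewrite eqxx.
exists w; rewrite !inE ?wf // /f' inE wf -/m subrr eqxx //.
Qed.

Variables (b tau : F).
Hypotheses (b_gt0 : 0 < b) (tau_gt0 : 0 < tau).
Hypothesis sse : forall Z : {set V}, \sum_(v in Z) pi v <= tau ->
  \sum_(u in Z) \sum_(v in Z) k u v <= b ^+ 2 / 2 * \sum_(v in Z) pi v.

(** For h u <= h v, AM-GM gives h u * h v <= h u^2 / (2 b) + b h v^2 / 2. The minimum of the squares
    is controlled through level sets at the cost of b / 4, and the remaining terms cost b: hence 5 /
    4. *)
Lemma sse_form (Z : {set V}) (h : V -> F) : \sum_(v in Z) pi v <= tau ->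
  (forall v, 0 <= h v) -> (forall v, v \notin Z -> h v = 0) ->
  \sum_u \sum_v k u v * (h u * h v) <= 5 / 4 * b * \sum_v pi v * h v ^+ 2.
Proof.
move=> hZ h0 hZ0.
have lc : \sum_u \sum_v k u v * Num.min (h u ^+ 2) (h v ^+ 2) <=
    b ^+ 2 / 2 * \sum_v pi v * h v ^+ 2.
  apply: (layer_cake (Z := Z)) => [Y YZ|v|v /hZ0->]; rewrite ?sqr_ge0 ?expr0n //.
  apply: sse; apply: le_trans hZ; rewrite [leRHS](big_setID Y) /= (setIidPr YZ) lerDl.
  by apply: sumr_ge0 => v _; apply: kernel_pi_ge0.
have pw u v : k u v * (h u * h v) <=
    (k u v * Num.min (h u ^+ 2) (h v ^+ 2)) / b / 2 +
    b / 2 * (k u v * h u ^+ 2 + k u v * h v ^+ 2).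
  have -> : forall m, k u v * m / b / 2 + b / 2 * (k u v * h u ^+ 2 + k u v * h v ^+ 2) =
     k u v * (m / b / 2 + b / 2 * (h u ^+ 2 + h v ^+ 2)).
    by move=> m; field; rewrite gt_eqF.
  apply: ler_wpM2l => //.
  wlog uv : u v / h u <= h v.
    move=> H; case: (leP (h u) (h v)) => [|/ltW] /H //.
    by rewrite minC mulrC (addrC (h v ^+ 2)).
  rewrite min_l ?ler_pXn2r // ?nnegrE //.
  have := amgm (h v) (h u) b_gt0; rewrite mulrC => /le_trans; apply.
  have := mulr_ge0 (ltW b_gt0) (sqr_ge0 (h u)); lra.
apply: (@le_trans _ _ (\sum_u \sum_v ((k u v * Num.min (h u ^+ 2) (h v ^+ 2)) / b / 2 +
    b / 2 * (k u v * h u ^+ 2 + k u v * h v ^+ 2)))).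
  by apply: ler_sum => u _; apply: ler_sum => v _.
under eq_bigr do rewrite big_split -!mulr_suml -mulr_sumr big_split.
rewrite big_split -!mulr_suml -mulr_sumr big_split /= sum_kernel_l sum_kernel_r.
set X := \sum_v pi v * _ in lc *; set M := \sum_u \sum_v k u v * _ in lc *.
have : M / b <= b / 2 * X.
  by rewrite ler_pdivrMr //; apply: le_trans lc _; rewrite le_eqVlt; apply/orP; left; apply/eqP;
    ring.
lra.
Qed.

(** Polarisation: the quadratic bound is applied to [s * g + h], and nonnegativity lets the two
    square terms on the left be dropped. *)
Lemma sse_bilinear (Z : {set V}) (g h : V -> F) s : \sum_(v in Z) pi v <= tau -> 0 < s ->
  (forall v, 0 <= g v) -> (forall v, v \notin Z -> g v = 0) ->
  (forall v, 0 <= h v) -> (forall v, v \notin Z -> h v = 0) ->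
  \sum_u \sum_v k u v * (g u * h v) <=
  5 / 4 * b * (s * \sum_v pi v * g v ^+ 2 + (\sum_v pi v * h v ^+ 2) / s).
Proof.
move=> hZ s0 g0 gZ h0 hZ0.
have H : \sum_u \sum_v k u v * ((s * g u + h u) * (s * g v + h v)) <=
    5 / 4 * b * \sum_v pi v * (s * g v + h v) ^+ 2.
  apply: (@sse_form Z (fun v => s * g v + h v)) => // v => [|vZ].
    by rewrite addr_ge0 // mulr_ge0 // ltW.
  by rewrite gZ // hZ0 // mulr0 addr0.
set A := \sum_u _ in H.
have H1 : 2 * s * \sum_u \sum_v k u v * (g u * h v) <= A.
  have E : \sum_u \sum_v k u v * (g u * h v) = \sum_u \sum_v k u v * (g v * h u).
    by rewrite exchange_big; apply: eq_bigr => u _; apply: eq_bigr => v _; rewrite k_sym.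
  have -> : forall S : F, 2 * s * S = s * S + s * S by move=> S; ring.
  rewrite {2}E !mulr_sumr -big_split.
  apply: ler_sum => u _ /=; rewrite !mulr_sumr -big_split; apply: ler_sum => v _ /=.
  have := mulr_ge0 (mulr_ge0 (ltW s0) (ltW s0)) (mulr_ge0 (k_ge0 u v) (mulr_ge0 (g0 u) (g0 v))).
  have := mulr_ge0 (k_ge0 u v) (mulr_ge0 (h0 u) (h0 v)); lra.
have H2 : \sum_v pi v * (s * g v + h v) ^+ 2 <=
    2 * s ^+ 2 * (\sum_v pi v * g v ^+ 2) + 2 * \sum_v pi v * h v ^+ 2.
  rewrite !mulr_sumr -big_split; apply: ler_sum => v _ /=.
  by have := mulr_ge0 (kernel_pi_ge0 v) (sqr_ge0 (s * g v - h v)); lra.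
have s2 : 0 < 2 * s by rewrite mulr_gt0.
rewrite -(ler_pM2l s2); apply: (le_trans H1); apply: (le_trans H).
have b5 : 0 <= 5 / 4 * b by rewrite mulr_ge0 ?ltW // divr_gt0.
apply: le_trans (ler_wpM2l b5 H2) _; rewrite le_eqVlt; apply/orP; left; apply/eqP.
by field; rewrite gt_eqF.
Qed.


Definition smooth (h : V -> F) v := \sum_w k v w / pi v * h w.

Lemma pi_smooth h v : pi v * smooth h v = \sum_w k v w * h w.
Proof.
rewrite mulr_sumr; apply: eq_bigr => w _; have [p0|p0] := eqVneq (pi v) 0.
  by rewrite k_sym kernel_pi_null // !mul0r mulr0.
by field.
Qed.

Lemma smooth_ge0 h : (forall v, 0 <= h v) -> forall v, 0 <= smooth h v.
Proof.
by move=> h0 v; apply: sumr_ge0 => w _; rewrite mulr_ge0 ?divr_ge0 ?kernel_pi_ge0.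
Qed.

Lemma sum_smooth h : \sum_v pi v * smooth h v = \sum_v pi v * h v.
Proof. by under eq_bigr do rewrite pi_smooth; rewrite sum_kernel_r. Qed.

Lemma sqr_smooth h : \sum_v pi v * smooth h v ^+ 2 =
  \sum_u \sum_v k u v * (smooth h u * h v).
Proof.
apply: eq_bigr => v _; rewrite expr2 mulrA pi_smooth mulr_suml.
by apply: eq_bigr => w _; ring.
Qed.

Lemma smooth_contract h :
  \sum_v pi v * smooth h v ^+ 2 <= \sum_v pi v * h v ^+ 2.
Proof.
have := @sum_kernel_amgm (smooth h) h 1 ltr01.
by rewrite -sqr_smooth mul1r divr1; lra.
Qed.

(* Truncate [h] and [smooth h] to the set where either is large: that set is
   small, so expansion bounds what the walk carries inside it, while the rest
   has a small second moment. *)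
Lemma smooth_decay h : (forall v, 0 <= h v) -> \sum_v pi v * h v <= 1 ->
  2 / (b ^+ 2 * tau) <= \sum_v pi v * smooth h v ^+ 2 ->
  \sum_v pi v * smooth h v ^+ 2 <= 32 * b ^+ 2 * \sum_v pi v * h v ^+ 2.
Proof.
move=> h0 h1; have := smooth_contract h; have g0 := smooth_ge0 h0.
have g1 : \sum_v pi v * smooth h v <= 1 by rewrite sum_smooth.
have := sqr_smooth h; set g := smooth h in g0 g1 *.
set N := \sum_v pi v * h v ^+ 2; set N' := \sum_v pi v * g v ^+ 2 => NE NN hT.
pose a := b ^+ 2; have a0 : 0 < a by rewrite exprn_gt0.
have N'0 : 0 < N' by apply: lt_le_trans hT; rewrite divr_gt0 // mulr_gt0.
have N0 : 0 < N by apply: lt_le_trans NN.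
(* By Markov this set has measure at most 2 / (a * N'), which the assumed lower bound on N' makes at
   most [tau]. *)
pose Z := [set v | (a * N < h v) || (a * N' < g v)].
have markov (f : V -> F) c : 0 < c -> (forall v, 0 <= f v) -> \sum_v pi v * f v <= 1 ->
    \sum_(v | c < f v) pi v <= c^-1.
  move=> c0 f0 f1; rewrite -[leRHS]mul1r ler_pdivlMr //; apply: le_trans f1.
  rewrite mulr_suml big_mkcond; apply: ler_sum => v _; case: ifP => [/ltW cf|_].
    by rewrite ler_wpM2l // kernel_pi_ge0.
  by rewrite mulr_ge0 // kernel_pi_ge0.
have hZ : \sum_(v in Z) pi v <= tau.
  apply: (@le_trans _ _ (\sum_(v | a * N < h v) pi v + \sum_(v | a * N' < g v) pi v)).
    rewrite [leLHS]big_mkcond [X in _ <= X + _]big_mkcond [X in _ <= _ + X]big_mkcond.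
    rewrite -big_split; apply: ler_sum => v _ /=; rewrite inE.
    by have := kernel_pi_ge0 v; do 2!case: (_ < _) => /=; lra.
  apply: (@le_trans _ _ ((a * N)^-1 + (a * N')^-1)).
    by rewrite lerD // markov // mulr_gt0.
  apply: (@le_trans _ _ (2 / (a * N'))).
    have : (a * N)^-1 <= (a * N')^-1 by rewrite lef_pV2 ?posrE ?mulr_gt0 // ler_pM2l.
    by set x := (a * N)^-1; set y := (a * N')^-1; lra.
  rewrite ler_pdivrMr ?mulr_gt0 //; move: hT; rewrite ler_pdivrMr ?mulr_gt0 //.
  by rewrite -/a; lra.
pose h1' v := if v \in Z then h v else 0; pose h2 v := if v \in Z then 0 else h v.
pose g1' v := if v \in Z then g v else 0; pose g2 v := if v \in Z then 0 else g v.
have hE v : h v = h1' v + h2 v by rewrite /h1' /h2; case: ifP; rewrite ?addr0 ?add0r.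
have gE v : g v = g1' v + g2 v by rewrite /g1' /g2; case: ifP; rewrite ?addr0 ?add0r.
have h1N : \sum_v pi v * h1' v ^+ 2 <= N.
  apply: ler_sum => v _; rewrite ler_wpM2l ?kernel_pi_ge0 // /h1'.
  by case: ifP => // _; rewrite expr0n sqr_ge0.
have g1N : \sum_v pi v * g1' v ^+ 2 <= N'.
  apply: ler_sum => v _; rewrite ler_wpM2l ?kernel_pi_ge0 // /g1'.
  by case: ifP => // _; rewrite expr0n sqr_ge0.
have small (f f2 : V -> F) c : 0 <= c -> (forall v, 0 <= f v) -> \sum_v pi v * f v <= 1 ->
    (forall v, 0 <= f2 v <= f v) -> (forall v, f2 v <= c) -> \sum_v pi v * f2 v ^+ 2 <= c.
  move=> c0 f0 f1 f2f f2c; apply: (@le_trans _ _ (c * \sum_v pi v * f v)).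
    rewrite mulr_sumr; apply: ler_sum => v _; rewrite [leRHS]mulrCA ler_wpM2l ?kernel_pi_ge0 //.
    by have /andP[? ?] := f2f v; rewrite expr2 ler_pM.
  by rewrite -[leRHS]mulr1 ler_wpM2l.
have h2N : \sum_v pi v * h2 v ^+ 2 <= a * N.
  apply: (small h) => //; first by rewrite ltW // mulr_gt0.
    by move=> v; rewrite /h2; case: ifP; rewrite ?lexx ?h0.
  move=> v; rewrite /h2 inE; case: ltP => //= hv; last by case: ifP => // _;
    rewrite ltW // mulr_gt0.
  by rewrite ltW // mulr_gt0.
have g2N : \sum_v pi v * g2 v ^+ 2 <= a * N'.
  apply: (small g) => //; first by rewrite ltW // mulr_gt0.
    by move=> v; rewrite /g2; case: ifP; rewrite ?lexx ?g0.
  move=> v; rewrite /g2 inE orbC; case: ltP => //= hv; last by case: ifP => // _;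
    rewrite ltW // mulr_gt0.
  by rewrite ltW // mulr_gt0.
have E : N' = \sum_u \sum_v k u v * (g1' u * h1' v) + \sum_u \sum_v k u v * (g2 u * h v)
            + \sum_u \sum_v k u v * (g1' u * h2 v).
  rewrite NE -!big_split; apply: eq_bigr => u _; rewrite -!big_split; apply: eq_bigr => v _ /=.
  by rewrite (gE u) (hE v); ring.
(* The three weights charge N' / 8 to each piece; what remains is 5/8 N' <= 33/2 a N, within the
   factor 32. *)
have B1 := @sse_bilinear Z g1' h1' (10 * b)^-1 hZ.
have B2 := @sum_kernel_amgm g2 h (4 * a)^-1.
have B3 := @sum_kernel_amgm g1' h2 4^-1.
have {}B1 : \sum_u \sum_v k u v * (g1' u * h1' v) <= N' / 8 + 25 / 2 * a * N.
  apply: le_trans (B1 _ _ _ _ _) _; rewrite ?invr_gt0 ?mulr_gt0 //.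
  - by move=> v; rewrite /g1'; case: ifP.
  - by move=> v /negPf; rewrite /g1' => ->.
  - by move=> v; rewrite /h1'; case: ifP.
  - by move=> v /negPf; rewrite /h1' => ->.
  rewrite invrK mulrDr.
  have -> : 5 / 4 * b * ((10 * b)^-1 * \sum_v pi v * g1' v ^+ 2) = (\sum_v pi v * g1' v ^+ 2) / 8.
    by field; rewrite gt_eqF.
  have := ler_wpM2l (ltW a0) h1N; rewrite /a; lra.
have {}B2 : \sum_u \sum_v k u v * (g2 u * h v) <= N' / 8 + 2 * a * N.
  apply: le_trans (B2 _) _; rewrite ?invr_gt0 ?mulr_gt0 // -/N invrK.
  have : (4 * a)^-1 * \sum_v pi v * g2 v ^+ 2 <= N' / 4.
    by rewrite mulrC ler_pdivrMr ?mulr_gt0 //; lra.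
  by lra.
have {}B3 : \sum_u \sum_v k u v * (g1' u * h2 v) <= N' / 8 + 2 * a * N.
  by apply: le_trans (B3 _) _; rewrite ?invr_gt0 // invrK; lra.
have := mulr_gt0 a0 N0; rewrite -/a; lra.
Qed.

(** Density with respect to [pi] of the position after [m] steps from [u]. *)
Fixpoint density u m : V -> F :=
  if m is m'.+1 then smooth (density u m') else fun v => (v == u)%:R / pi u.

Lemma density_ge0 u m v : 0 <= density u m v.
Proof.
elim: m v => [|m IH] v /=; last exact: smooth_ge0.
by rewrite divr_ge0 ?kernel_pi_ge0.
Qed.

Lemma density_sum u m : 0 < pi u -> \sum_v pi v * density u m v <= 1.
Proof.
move=> p0; elim: m => [|m IH] /=; last by rewrite sum_smooth.
rewrite (bigD1 u) //= eqxx mul1r divff ?gt_eqF // big1 ?addr0 // => v /negPf->.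
by rewrite mul0r mulr0.
Qed.

(** At each step the second moment either is already below the threshold in the first term or
    contracts by the factor 32 b^2; it starts at 1 / pi u. *)
Lemma density_spread u m : 0 < pi u -> 32 * b ^+ 2 <= 1 ->
  \sum_v pi v * density u m v ^+ 2 <=
  2 / (b ^+ 2 * tau) + (32 * b ^+ 2) ^+ m / pi u.
Proof.
move=> p0 rho1; have r0 : 0 <= 32 * b ^+ 2 by rewrite mulr_ge0 ?sqr_ge0.
have T0 : 0 < 2 / (b ^+ 2 * tau) by rewrite divr_gt0 ?mulr_gt0 ?exprn_gt0.
elim: m => [|m IH] /=.
  rewrite (bigD1 u) //= eqxx mul1r big1 ?addr0 => [|v /negPf->]; last by rewrite mul0r expr0n mulr0.
  by rewrite ?mul1r expr2 mulrA divff ?gt_eqF // ?mul1r lerDr ltW.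
case: (leP (2 / (b ^+ 2 * tau)) (\sum_v pi v * smooth (density u m) v ^+ 2)) => [hT|/ltW hT].
  have := smooth_decay (density_ge0 u m) (density_sum m p0) hT.
  move=> /le_trans; apply; apply: le_trans (ler_wpM2l r0 IH) _.
  by rewrite mulrDr (exprS _ m) -(mulrA _ _ (pi u)^-1) lerD2r -[leRHS]mul1r ler_wpM2r // ltW.
by apply: (le_trans hT); rewrite lerDl divr_ge0 ?(ltW p0) ?exprn_ge0.
Qed.

(** Joint law of the endpoints of m + 1 steps: index 0 is a single step, so a walk of length 2^J
    carries the index (2^J).-1. *)
Fixpoint walk_kernel m : V -> V -> F :=
  if m is m'.+1 then fun u v => \sum_w k u w * walk_kernel m' w v / pi w else k.

Lemma walk_kernelE m u v : 0 < pi u ->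
  walk_kernel m v u = pi u * pi v * density u m.+1 v.
Proof.
move=> p0; elim: m v => [|m IH] v.
  rewrite -mulrA [density _ _ _]/= pi_smooth (bigD1 u) //= eqxx mul1r.
  rewrite big1 ?addr0 => [|w /negPf->]; last by rewrite mul0r mulr0.
  by field; rewrite gt_eqF.
rewrite [LHS]/= -mulrA -[density u m.+2 v]/(smooth (density u m.+1) v) pi_smooth mulr_sumr;
  apply: eq_bigr => w _.
rewrite IH; have [w0|w0] := eqVneq (pi w) 0; last by field.
by rewrite (kernel_pi_null v w0) !mul0r mulr0.
Qed.

(** The factor #|V| is the sum over starting points of pi u times the initial second moment 1 / pi
    u. *)
Lemma walk_spread m : 32 * b ^+ 2 <= 1 ->
  \sum_u \sum_v walk_kernel m v u ^+ 2 / (pi u * pi v) <=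
  2 / (b ^+ 2 * tau) + (32 * b ^+ 2) ^+ m.+1 * #|V|%:R.
Proof.
move=> rho1; have r0 : 0 <= 32 * b ^+ 2 by rewrite mulr_ge0 ?sqr_ge0.
have T0 : 0 < 2 / (b ^+ 2 * tau) by rewrite divr_gt0 ?mulr_gt0 ?exprn_gt0.
apply: (@le_trans _ _ (\sum_u (pi u * (2 / (b ^+ 2 * tau)) + (32 * b ^+ 2) ^+ m.+1))).
  apply: ler_sum => u _; have [p0|p0] := eqVneq (pi u) 0.
    rewrite big1 => [|v _]; last by rewrite p0 mul0r invr0 mulr0.
    by rewrite p0 mul0r add0r exprn_ge0.
  have pu : 0 < pi u by rewrite lt_def p0 kernel_pi_ge0.
  apply: (@le_trans _ _ (pi u * \sum_v pi v * density u m.+1 v ^+ 2)).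
    rewrite mulr_sumr; apply: ler_sum => v _; rewrite walk_kernelE //.
    have [v0|v0] := eqVneq (pi v) 0; last by rewrite le_eqVlt; apply/orP; left; apply/eqP; field;
      rewrite p0 v0.
    by rewrite v0 mulr0 !mul0r expr0n mul0r mulr0.
  apply: le_trans (ler_wpM2l (ltW pu) (density_spread m.+1 pu rho1)) _.
  by rewrite mulrDr [X in _ + X]mulrCA divff // mulr1.
by rewrite big_split /= -mulr_suml pi_sum mul1r sumr_const mulr_natr.
Qed.

End Spread.

(** * Walks that carry labels *)

Section Cluster.
Variables (F : realFieldType) (V L : finType) (k : V -> V -> F) (pi : V -> F).
Variables (sat : V -> V -> L -> L -> bool).
Hypotheses (k_ge0 : forall u v, 0 <= k u v) (k_sym : forall u v, k u v = k v u).
Hypotheses (k_sum : forall v, \sum_u k u v = pi v) (pi_sum : \sum_v pi v = 1).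
Hypotheses (sat_sym : forall u v a b, k u v != 0 -> sat u v a b = sat v u b a).
Hypotheses (sat_uniq : forall u v a, k u v != 0 ->
  exists b0, forall b, sat u v a b = (b == b0)).

Definition label_kernel (i j : V * L) : F := k i.1 j.1 * (sat i.1 j.1 i.2 j.2)%:R.

Fixpoint label_walk m : V * L -> V * L -> F :=
  if m is m'.+1 then comp pi label_kernel (label_walk m') else label_kernel.

Lemma label_walk_ge0 m i j : 0 <= label_walk m i j.
Proof.
elim: m i j => [|m IH] i j /=; first by rewrite mulr_ge0.
by apply: sumr_ge0 => w _; rewrite divr_ge0 ?mulr_ge0 // (kernel_pi_ge0 k_ge0 k_sum).
Qed.

Lemma label_kernel_marg u a v : \sum_b label_kernel (u, a) (v, b) = k u v.
Proof.
rewrite /label_kernel /= -mulr_sumr; have [->|k0] := eqVneq (k u v) 0; first by rewrite mul0r.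
have [b0 hb] := sat_uniq a k0.
rewrite (bigD1 b0) //= hb eqxx big1 ?addr0 ?mulr1 // => b.
by rewrite hb => /negPf->.
Qed.

(** Constraints being bijections, a starting label determines the label along any path, so summing
    over the final label forgets the labels altogether. *)
Lemma label_walk_marg m u a v : \sum_b label_walk m (u, a) (v, b) = walk_kernel k pi m u v.
Proof.
elim: m u a => [|m IH] u a /=; first exact: label_kernel_marg.
rewrite exchange_big sum_pair; apply: eq_bigr => w _ /=.
rewrite -(label_kernel_marg u a w) !mulr_suml; apply: eq_bigr => c _.
by rewrite -mulr_suml -mulr_sumr IH.
Qed.

Lemma comp_assoc (K1 K2 K3 : V * L -> V * L -> F) i j :
  comp pi K1 (comp pi K2 K3) i j = comp pi (comp pi K1 K2) K3 i j.
Proof.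
rewrite /comp; transitivity (\sum_w \sum_x K1 i w * K2 w x * K3 x j / pi x.1 / pi w.1).
  by apply: eq_bigr => w _; rewrite mulr_sumr mulr_suml; apply: eq_bigr => x _; ring.
rewrite exchange_big; apply: eq_bigr => x _; rewrite !mulr_suml.
by apply: eq_bigr => w _; ring.
Qed.

Lemma label_walkD a b i j :
  label_walk (a + b).+1 i j = comp pi (label_walk a) (label_walk b) i j.
Proof.
elim: a i j => [|a IH] i j //=; rewrite -comp_assoc; apply: eq_bigr => w _.
by rewrite -IH.
Qed.

Lemma label_kernel_sym i j : label_kernel i j = label_kernel j i.
Proof.
rewrite /label_kernel k_sym; have [->|k0] := eqVneq (k j.1 i.1) 0; first by rewrite !mul0r.
by rewrite sat_sym // k_sym.
Qed.

Lemma label_walk_sym m i j : label_walk m i j = label_walk m j i.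
Proof.
elim: m i j => [|m IH] i j; first exact: label_kernel_sym.
rewrite -[X in label_walk X.+1 j i]addn0 label_walkD; apply: eq_bigr => w _.
by rewrite IH label_kernel_sym; congr (_ / _); apply: mulrC.
Qed.

(** Read off from the symmetric label walk by summing over both labels, which counts each side #|L|
    times; [a0] witnesses that [L] is nonempty. *)
Lemma walk_kernel_sym m u v (a0 : L) : walk_kernel k pi m u v = walk_kernel k pi m v u.
Proof.
have q0 : (#|L|%:R : F) != 0.
  by rewrite pnatr_eq0 -lt0n; apply/card_gt0P; exists a0.
apply: (mulfI q0).
transitivity (\sum_a \sum_b label_walk m (u, a) (v, b)).
  by under eq_bigr do rewrite label_walk_marg; rewrite sumr_const mulr_natl.
rewrite exchange_big; under eq_bigr do under eq_bigr do rewrite label_walk_sym.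
by under eq_bigr do rewrite label_walk_marg; rewrite sumr_const mulr_natl.
Qed.

Lemma walk_kernel_null m u v : pi u = 0 -> walk_kernel k pi m u v = 0.
Proof.
have kn w : pi u = 0 -> k u w = 0.
  by move=> p0; rewrite k_sym; apply: (kernel_pi_null k_ge0 k_sum).
case: m => [|m] /= p0; first exact: kn.
by apply: big1 => w _; rewrite kn // !mul0r.
Qed.

Lemma walk_kernel_sum m v : \sum_u walk_kernel k pi m u v = pi v.
Proof.
elim: m v => [|m IH] v /=; first exact: k_sum.
rewrite exchange_big -[RHS]IH; apply: eq_bigr => w _ /=.
rewrite -!mulr_suml k_sum; have [p0|p0] := eqVneq (pi w) 0; last by field.
by rewrite walk_kernel_null // mulr0 mul0r.
Qed.

Section Correlation.
Variables (t : nat) (P : {set V} -> {ffun V -> L} -> F).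
Hypothesis HP : local_dist t P.

Lemma eq_corr (K K' : V * L -> V * L -> F) : K =2 K' -> corr P K = corr P K'.
Proof. by move=> h; apply: eq_bigr => i _; apply: eq_bigr => j _; rewrite h. Qed.

(** The spare factor 2 becomes 4 when squared. This absorbs the sampling error, of order 1 / r, at
    every doubling as long as r * g^(2^J) >= 1. *)
Lemma corr_walk_ge r (g : F) J : (r < t)%N -> (0 < r)%N -> 0 < g -> g <= 1 ->
  1 <= r%:R * g ^+ (2 ^ J) -> 2 * g <= corr P label_kernel ->
  2 * g ^+ (2 ^ J) <= corr P (label_walk (2 ^ J).-1).
Proof.
move=> rt r0 g0 g1; case: (pickP (@predT L)) => [a0 _|L0]; last first.
  move=> _; rewrite {1}/corr big1 => [h|[u a] _]; last by have := L0 a.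
  by move: h; rewrite pmulr_rle0 // leNgt g0.
elim: J => [|J IH] hr h0; first by rewrite expn0 expr1.
have gJ (i : nat) : 0 < g ^+ i by rewrite exprn_gt0.
have le1 : g ^+ (2 ^ J.+1) <= g ^+ (2 ^ J) by apply: ler_wiXn2l => //;
  [apply: ltW | rewrite leq_exp2l].
have r0' : 0 < r%:R :> F by rewrite ltr0n.
have {}IH : 2 * g ^+ (2 ^ J) <= corr P (label_walk (2 ^ J).-1).
  by apply: IH => //; apply: le_trans hr _; rewrite ler_pM2l.
have := @corr_doubling _ _ _ _ _ HP pi (label_walk (2 ^ J).-1)
  (walk_kernel k pi (2 ^ J).-1) (kernel_pi_ge0 k_ge0 k_sum) pi_sum
  (label_walk_ge0 _) (label_walk_sym _) (label_walk_marg _)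
  (walk_kernel_sum _) r rt r0.
have -> : corr P (comp pi (label_walk (2 ^ J).-1) (label_walk (2 ^ J).-1)) =
    corr P (label_walk (2 ^ J.+1).-1).
  apply: eq_corr => i j; rewrite -label_walkD; congr (label_walk _ _ _).
  by have := expn_gt0 2 J; rewrite expnS /=; lia.
set c := corr P (label_walk (2 ^ J).-1) in IH *; set c' := corr _ _ => H.
rewrite leNgt; apply/negP => c'lt.
have e2 : g ^+ (2 ^ J.+1) = g ^+ (2 ^ J) ^+ 2 by rewrite expnS mulnC exprM.
have c2 : 4 * g ^+ (2 ^ J.+1) <= c ^+ 2.
  have -> : 4 * g ^+ (2 ^ J.+1) = (2 * g ^+ (2 ^ J)) ^+ 2 by rewrite e2; ring.
  by rewrite ler_pXn2r // nnegrE;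
    [rewrite mulr_ge0 // ltW | apply: le_trans IH; rewrite mulr_ge0 // ltW].
have r1 : 1 <= r%:R :> F by rewrite ler1n.
have H1 := ler_wpM2l (ltW r0') c2.
have H2 : (r%:R - 1) * c' <= (r%:R - 1) * (2 * g ^+ (2 ^ J.+1)).
  by rewrite ler_wpM2l ?subr_ge0 // ltW.
have := gJ (2 ^ J.+1)%N; set y := g ^+ (2 ^ J.+1) in hr c'lt c2 H1 H2 *; lra.
Qed.

(** Cauchy-Schwarz with weight [s] between the second moment of the walk and the squared
    covariances, whose averages are influences. The factor #|L|^2 is the price of passing from
    absolute values to squares in the sum over pairs of labels. *)
Lemma corr_walk_le m (s d : F) : 0 < s ->
  (forall v, influence pi P v <= d) ->
  corr P (label_walk m) <=
  (s * (\sum_u \sum_v walk_kernel k pi m v u ^+ 2 / (pi u * pi v)) +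
   #|L|%:R ^+ 2 * d / s) / 2.
Proof.
move=> s0 hd; have p_ge0 := kernel_pi_ge0 k_ge0 k_sum.
pose c u v := \sum_a \sum_b `|pcov P u a v b|.
have c0 u v : 0 <= c u v by apply: sumr_ge0 => a _; apply: sumr_ge0 => b _.
have w0 u v (a0 : L) : 0 <= walk_kernel k pi m u v.
  by rewrite -(label_walk_marg m u a0 v) sumr_ge0 // => b _; apply: label_walk_ge0.
case: (pickP (@predT L)) => [a0 _|L0]; last first.
  rewrite /corr big1 => [|[u a] _]; last by have := L0 a.
  rewrite (eq_card0 L0) expr0n !mul0r addr0 divr_ge0 // mulr_ge0 ?(ltW s0) //.
  by apply: sumr_ge0 => u _; apply: sumr_ge0 => v _; rewrite divr_ge0 ?sqr_ge0 ?mulr_ge0.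
apply: (@le_trans _ _ (\sum_u \sum_v walk_kernel k pi m v u * c v u)).
  rewrite /corr exchange_big sum_pair; apply: ler_sum => u _ /=.
  rewrite exchange_big sum_pair; apply: ler_sum => v _ /=.
  rewrite /c mulr_sumr; apply: ler_sum => a _; rewrite mulr_sumr; apply: ler_sum => b _ /=.
  apply: le_trans (ler_norm _) _; rewrite normrM ger0_norm ?label_walk_ge0 //.
  rewrite ler_wpM2r // -(label_walk_marg m v a u) (bigD1 b) //= lerDl.
  by apply: sumr_ge0 => b' _; apply: label_walk_ge0.
have cs u v : c u v ^+ 2 <= #|L|%:R ^+ 2 * \sum_a \sum_b pcov P u a v b ^+ 2.
  have q0 : 0 < #|L|%:R :> F by rewrite ltr0n; apply/card_gt0P; exists a0.
  have jensen (f : L -> F) : (\sum_a f a) ^+ 2 <= #|L|%:R * \sum_a f a ^+ 2.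
    have H : (\sum_i #|L|%:R^-1 * f i) ^+ 2 <= \sum_i #|L|%:R^-1 * f i ^+ 2.
      apply: (@sum_sqr_le F L (fun=> #|L|%:R^-1) f) => [i|]; first by rewrite invr_ge0 ltW.
      by rewrite sumr_const -[_ *+ _]mulr_natl divff ?gt_eqF.
    rewrite -!mulr_sumr in H.
    have := ler_wpM2l (sqr_ge0 #|L|%:R) H.
    rewrite exprMn mulrA -exprMn divff ?gt_eqF // expr1n mul1r => /le_trans; apply.
    by rewrite expr2 -mulrA mulVKf ?gt_eqF.
  apply: le_trans (jensen _) _; rewrite expr2 -mulrA ler_pM2l // mulr_sumr.
  apply: ler_sum => a _; apply: le_trans (jensen _) _; rewrite ler_pM2l //.
  by apply: ler_sum => b _; rewrite real_normK ?num_real.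
have pw u v : walk_kernel k pi m v u * c v u <=
    (s * (walk_kernel k pi m v u ^+ 2 / (pi u * pi v)) + pi u * (pi v * c v u ^+ 2) / s) / 2.
  have [p0|p0] := eqVneq (pi v) 0.
    by rewrite walk_kernel_null // p0 expr0n /= !mul0r !mulr0 !mul0r addr0 mul0r.
  have [q0|q0] := eqVneq (pi u) 0.
    by rewrite walk_kernel_sym // walk_kernel_null // q0 expr0n /= !mul0r !mulr0 addr0 mul0r.
  set x := walk_kernel _ _ _ _ _; set y := c v u.
  have := ler_wpM2l (mulr_ge0 (p_ge0 u) (p_ge0 v)) (@amgm F (x / (pi u * pi v)) y s s0).
  have -> : pi u * pi v * (x / (pi u * pi v) * y) = x * y by field; rewrite p0 q0.
  move/le_trans; apply; rewrite le_eqVlt; apply/orP; left; apply/eqP; field.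
  by rewrite p0 q0 gt_eqF.
apply: (@le_trans _ _ (\sum_u \sum_v (s * (walk_kernel k pi m v u ^+ 2 / (pi u * pi v)) +
    pi u * (pi v * c v u ^+ 2) / s) / 2)).
  by apply: ler_sum => u _; apply: ler_sum => v _.
under eq_bigr do rewrite -mulr_suml big_split -mulr_sumr -mulr_suml.
rewrite -mulr_suml big_split -mulr_sumr -mulr_suml /=.
rewrite ler_pM2r ?invr_gt0 // lerD2l ler_pM2r ?invr_gt0 //.
apply: (@le_trans _ _ (\sum_u pi u * (#|L|%:R ^+ 2 * d))); last first.
  by rewrite -mulr_suml pi_sum mul1r.
apply: ler_sum => u _; rewrite -mulr_sumr ler_wpM2l //.
apply: le_trans (ler_wpM2l (sqr_ge0 _) (hd u)); rewrite /influence mulr_sumr.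
apply: ler_sum => v _; rewrite [leRHS]mulrCA ler_wpM2l //.
apply: le_trans (cs v u) _; rewrite ler_wpM2l ?sqr_ge0 //.
apply: ler_sum => a _; apply: ler_sum => b _.
by rewrite /pcov covC.
Qed.

(* [corr P label_kernel] is the satisfied fraction minus what independent
   sampling from the marginals satisfies. *)
Lemma coll_ge_corr : (1 < t)%N ->
  1 - loss k (fun u v x => (~~ sat u v (x u) (x v))%:R) P - corr P label_kernel <= coll pi P.
Proof.
move=> t1; have t0 : (0 < t)%N by lia.
pose J u v := expect P [set u; v] (fun x => (sat u v (x u) (x v))%:R).
pose p v := \sum_a prob P v a ^+ 2.
pose M u v := \sum_a \sum_b (sat u v a b)%:R * pcov P u a v b.
have eJ u v : expect P [set u; v] (fun x => (~~ sat u v (x u) (x v))%:R) = 1 - J u v.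
  rewrite (@eq_expect _ _ _ _ _ _ (fun x => 1 - (sat u v (x u) (x v))%:R)).
    by rewrite expectB (expect_cst HP) // card_pair.
  by move=> x; case: sat; rewrite /= ?subr0 ?subrr.
have one w w' a : k w w' != 0 -> \sum_b (sat w w' a b)%:R = 1 :> F.
  move=> kw; have [b0 hb] := sat_uniq a kw.
  by rewrite (bigD1 b0) //= hb eqxx big1 ?addr0 // => b; rewrite hb => /negPf->.
(* The satisfied probability is a covariance plus what independent sampling satisfies. Since each
   label has one partner, AM-GM bounds the latter by the mean of the two collision probabilities. *)
have eC u v : k u v != 0 -> J u v <= M u v + (p u + p v) / 2.
  move=> k0.
  have -> : J u v = \sum_a \sum_b (sat u v a b)%:R *
      expect P [set u; v] (fun x => ind F a (x u) * ind F b (x v)).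
    under eq_bigr do under eq_bigr do rewrite -expectZ.
    under eq_bigr do rewrite -expect_sum.
    rewrite -expect_sum; apply: eq_expect => x.
    rewrite (bigD1 (x u)) //= (bigD1 (x v)) //= /ind !eqxx !mulr1.
    rewrite !big1 ?addr0 // => [a|b] nb; last by rewrite eq_sym (negPf nb) !mulr0.
    by apply: big1 => b _; rewrite eq_sym (negPf nb) mul0r mulr0.
  rewrite -lerBlDl /M -sumrB.
  have -> : \sum_a (\sum_b (sat u v a b)%:R * expect P [set u; v]
        (fun x => ind F a (x u) * ind F b (x v)) -
      \sum_b (sat u v a b)%:R * pcov P u a v b) =
     \sum_a \sum_b (sat u v a b)%:R * (prob P u a * prob P v b).
    apply: eq_bigr => a _; rewrite -sumrB; apply: eq_bigr => b _.
    by rewrite -mulrBr /pcov /cov opprB addrC subrK.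
  apply: (@le_trans _ _ (\sum_a \sum_b ((sat u v a b)%:R * (prob P u a ^+ 2 / 2) +
      (sat u v a b)%:R * (prob P v b ^+ 2 / 2)))).
    apply: ler_sum => a _; apply: ler_sum => b _; rewrite -mulrDr -mulrDl ler_wpM2l //.
    by have := @amgm F (prob P u a) (prob P v b) 1 ltr01; rewrite mul1r divr1.
  under eq_bigr do rewrite big_split.
  rewrite big_split /= mulrDl lerD //.
    by rewrite /p mulr_suml; apply: ler_sum => a _; rewrite -mulr_suml one // mul1r.
  rewrite exchange_big /= /p mulr_suml; apply: ler_sum => b _ /=.
  rewrite -mulr_suml; under eq_bigr do rewrite sat_sym //.
  by rewrite one ?mul1r // k_sym.
have kk : \sum_u \sum_v k u v = 1.
  by rewrite exchange_big -pi_sum; apply: eq_bigr => v _; rewrite k_sum.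
have -> : 1 - loss k (fun u v x => (~~ sat u v (x u) (x v))%:R) P = \sum_u \sum_v k u v * J u v.
  rewrite /loss -[X in X - _]kk -sumrB; apply: eq_bigr => u _; rewrite -sumrB.
  by apply: eq_bigr => v _; rewrite eJ; ring.
have -> : corr P label_kernel = \sum_u \sum_v k u v * M u v.
  rewrite /corr sum_pair; apply: eq_bigr => u _.
  rewrite exchange_big sum_pair; apply: eq_bigr => v _ /=.
  rewrite /M [RHS]mulr_sumr exchange_big; apply: eq_bigr => a _; rewrite mulr_sumr.
  by apply: eq_bigr => b _; rewrite /label_kernel /= mulrA.
apply: (@le_trans _ _ (\sum_u \sum_v (k u v * (p u / 2) + k u v * (p v / 2)))).
  rewrite -sumrB; apply: ler_sum => u _; rewrite -sumrB; apply: ler_sum => v _.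
  rewrite -mulrBr -mulrDr -mulrDl.
  have [->|k0] := eqVneq (k u v) 0; first by rewrite !mul0r.
  by rewrite ler_wpM2l // lerBlDl eC.
under eq_bigr do rewrite big_split.
rewrite big_split /= (sum_kernel_l k_sym k_sum (fun u => p u / 2)).
rewrite (sum_kernel_r k_sum (fun u => p u / 2)) /coll.
under eq_bigr do rewrite mulrA.
rewrite -mulr_suml /p; set X := \sum_v _; lra.
Qed.

End Correlation.
End Cluster.

(** * Dense subsets whose small subsets are sparse *)

Section DenseSubsets.
Variables (F : realFieldType) (V : finType) (w : V -> V -> F) (m : V -> F).
Hypotheses (w_ge0 : forall u v, 0 <= w u v) (w_sym : forall u v, w u v = w v u).
Implicit Types (Z Y X : {set V}).

Definition inner Z := \sum_(u in Z) \sum_(v in Z) w u v.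
Definition meas Z := \sum_(v in Z) m v.

Lemma inner_D1 Z v : v \in Z ->
  inner Z = inner (Z :\ v) + 2 * \sum_(u in Z) w v u - w v v.
Proof.
move=> vZ; rewrite /inner (big_setD1 v vZ) /= (big_setD1 v vZ) /=.
under [X in _ + X = _]eq_bigr do rewrite (big_setD1 v vZ) /= w_sym.
by rewrite big_split /=; ring.
Qed.

(* In a densest subset every degree is at least half the density. *)
Lemma dense_core (c : F) Z : (forall v, 0 < m v) -> Z != set0 -> c * meas Z <= inner Z ->
  exists Y, exists c', [/\ Y \subset Z, Y != set0, c <= c', inner Y = c' * meas Y &
    forall v, v \in Y -> c' * m v <= 2 * \sum_(u in Y) w v u].
Proof.
move=> m_gt0 Z0 hZ.
have mpos X : X != set0 -> 0 < meas X.
  case/set0Pn => v vX; rewrite /meas (big_setD1 v vX) /=.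
  by rewrite ltr_pwDl ?m_gt0 // sumr_ge0 // => u _; rewrite ltW.
have P0 : (Z \subset Z) && (Z != set0) by rewrite subxx.
case: (@arg_maxP _ F _ Z (fun Y : {set V} => (Y \subset Z) && (Y != set0))
  (fun Y => inner Y / meas Y) P0) => Y /andP[YZ Y0] maxY.
have mY := mpos _ Y0; set c' := inner Y / meas Y in maxY.
have eY : inner Y = c' * meas Y by rewrite divfK ?gt_eqF.
exists Y, c'; split=> //.
  by apply: le_trans (maxY Z P0); rewrite ler_pdivlMr ?mpos.
move=> v vY; rewrite leNgt; apply/negP => hv.
have mE : meas Y = m v + meas (Y :\ v) by rewrite /meas (big_setD1 v vY).
have lt1 : c' * meas (Y :\ v) < inner (Y :\ v).
  by move: eY; rewrite (inner_D1 vY) mE mulrDr; have := w_ge0 v v; lra.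
have ne : Y :\ v != set0.
  by apply/negP => /eqP e; move: lt1; rewrite e /meas /inner !big_set0; lra.
have := maxY (Y :\ v); rewrite ne (subset_trans (subsetDl _ _) YZ) => /(_ isT) /=.
by rewrite ler_pdivrMr ?mpos // leNgt lt1.
Qed.

Variables (m0 th tau : F).
Hypotheses (m0_gt0 : 0 < m0) (m_ge : forall v, m0 <= m v).
Hypotheses (th_gt0 : 0 < th) (th_le1 : th <= 1) (tau_gt0 : 0 < tau).

Lemma meas_ge0 Z : 0 <= meas Z.
Proof. by apply: sumr_ge0 => v _; apply: le_trans (m_ge v); apply: ltW. Qed.

Lemma meas_sub Y Z : Y \subset Z -> meas Y <= meas Z.
Proof.
move=> YZ; rewrite /meas [leRHS](big_setID Y) /= (setIidPr YZ) lerDl.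
exact: (meas_ge0 (Z :\: Y)).
Qed.

(* A subset that is smaller by a factor [tau] but keeps a fraction [th] of the
   density replaces the current one; this can happen only [i] times. *)
Lemma expanding_subset i (c : F) Z : 0 < c -> Z != set0 -> c * meas Z <= inner Z ->
  tau ^+ i * meas Z < m0 ->
  exists Y, exists c', [/\ Y \subset Z, Y != set0 & c * th ^+ i <= c'] /\
    [/\ inner Y = c' * meas Y, (forall v, v \in Y -> c' * m v <= 2 * \sum_(u in Y) w v u) &
    forall X, X \subset Y -> meas X <= tau * meas Y -> inner X <= th * c' * meas X].
Proof.
elim: i c Z => [|i IH] c Z c0 Z0 hZ hm.
  (* No shrinking is left: the measure is below [m0], the least measure of a vertex, yet the set is
     nonempty. *)
  move: hm; rewrite expr0 mul1r ltNge => /negP[].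
  have [v vZ] := set0Pn _ Z0; apply: le_trans (m_ge v) _.
  by rewrite /meas (big_setD1 v vZ) lerDl; apply: (meas_ge0 (Z :\ v)).
have mp v : 0 < m v by apply: lt_le_trans (m_ge v).
have [Y [c1 [YZ Y0 cc1 hY dY]]] := dense_core mp Z0 hZ.
have c10 : 0 < c1 by apply: lt_le_trans cc1.
case: (pickP (fun X : {set V} => [&& X \subset Y, meas X <= tau * meas Y &
    th * c1 * meas X < inner X])) => [X /and3P[XY mX hX]|h]; last first.
  exists Y, c1; split; split=> //.
    by apply: le_trans cc1; rewrite -[leRHS]mulr1 ler_wpM2l ?exprn_ile1 // ltW.
  move=> X XY mX; have := h X; rewrite XY mX /= => /negbT.
  by rewrite -leNgt.
have X0 : X != set0.
  by apply/negP => /eqP e; move: hX; rewrite e /meas /inner !big_set0 mulr0 ltxx.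
have thc : 0 < th * c1 by rewrite mulr_gt0.
have hm' : tau ^+ i * meas X < m0.
  apply: le_lt_trans hm; rewrite exprSr -mulrA ler_wpM2l ?exprn_ge0 ?(ltW tau_gt0) //.
  by apply: le_trans mX _; rewrite ler_wpM2l ?(ltW tau_gt0) // meas_sub.
have [Y' [c' [[h1 h2 h3] [h4 h5 h6]]]] := IH (th * c1) X thc X0 (ltW hX) hm'.
exists Y', c'; split; split=> //.
  by apply: subset_trans h1 (subset_trans XY YZ).
apply: le_trans h3; rewrite exprS mulrCA mulrA ler_wpM2r ?exprn_ge0 ?(ltW th_gt0) //.
by rewrite ler_wpM2l ?(ltW th_gt0).
Qed.

End DenseSubsets.

(** * Decoding a cluster of vertices *)

Section Decoding.
Variables (F : realFieldType) (V L : finType) (t : nat) (a0 : L).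
Variables (P : {set V} -> {ffun V -> L} -> F).
Hypotheses (HP : local_dist t P) (tV : (t <= #|V|)%N).
Variables (b tau s d : F) (J N r : nat).
Hypotheses (b_gt0 : 0 < b) (b_small : 32 * b ^+ 2 <= 1) (tau_gt0 : 0 < tau).
Hypotheses (s_gt0 : 0 < s) (d_gt0 : 0 < d) (Nd : 2 < N%:R * d).
Hypotheses (r_gt0 : (0 < r)%N) (Nrt : (N + r + 2 < t)%N).
Hypothesis rg : 1 <= r%:R * 64^-1 ^+ (2 ^ J) :> F.
Hypothesis small_corr :
  (s * (2 / (b ^+ 2 * (tau / 2)) + (32 * b ^+ 2) ^+ (2 ^ J) * #|V|%:R) +
   #|L|%:R ^+ 2 * d / s) / 2 < 2 * 64^-1 ^+ (2 ^ J).

Section OneCluster.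
Variables (k : V -> V -> F) (pi : V -> F) (sat : V -> V -> L -> L -> bool).
Hypotheses (k_ge0 : forall u v, 0 <= k u v) (k_sym : forall u v, k u v = k v u).
Hypotheses (k_sum : forall v, \sum_u k u v = pi v) (pi_sum : \sum_v pi v = 1).
Hypotheses (sat_sym : forall u v a b, k u v != 0 -> sat u v a b = sat v u b a).
Hypotheses (sat_uniq : forall u v a, k u v != 0 ->
  exists b0, forall b, sat u v a b = (b == b0)).
Hypothesis sse : forall Z : {set V}, \sum_(v in Z) pi v <= tau / 2 ->
  \sum_(u in Z) \sum_(v in Z) k u v <= b ^+ 2 / 2 * \sum_(v in Z) pi v.

Let unsat u v (x : {ffun V -> L}) : F := (~~ sat u v (x u) (x v))%:R.

Hypothesis good : forall u v, k u v != 0 -> expect P [set u; v] (unsat u v) <= 64^-1.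

Let p_ge0 := kernel_pi_ge0 k_ge0 k_sum.

Lemma kernel_total : \sum_u \sum_v k u v = 1.
Proof. by rewrite exchange_big -pi_sum; apply: eq_bigr => v _; rewrite k_sum. Qed.

Let unsat_dep u v : depends_on [set u; v] (unsat u v).
Proof. by move=> x y xy; rewrite /unsat !xy // !inE eqxx ?orbT. Qed.

(** Bounds of 1/32 on the loss and on the correlation leave a collision probability of at least
    15/16, so the likeliest labels err with mass at most 1/16. An edge fails only if an end errs or
    the edge is violated: 1 - 2/16 - 1/32 = 27/32, written as 19/32 + 1/4 in view of the later loss
    of 1/4. *)
Lemma cluster_labels : exists (S : {set V}) (z : {ffun V -> L}) (Lb : V -> L),
  [/\ (#|S| <= N)%N, 0 < mass P S z,
      deviation pi Lb (cond P S z) <= 16^-1 &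
      19 / 32 + 1 / 4 <= \sum_u \sum_v k u v * (sat u v (Lb u) (Lb v))%:R].
Proof.
have N0 : (0 < N)%N.
  by move: Nd; case: (N) => //; rewrite mul0r ltNge ler0n.
pose z0 : {ffun V -> L} := [ffun=> a0].
have agree0 x : agree set0 z0 x = true by apply/agreeP => i; rewrite inE.
have mass0 : mass P set0 z0 = 1.
  rewrite /mass (eq_expect _ _ (fun x => f_equal (fun b : bool => b%:R) (agree0 x))) /=.
  by rewrite (expect_cst HP) ?cards0.
have E0 T f : expect (cond P set0 z0) T f = expect P T f.
  rewrite expect_cond -/(mass P set0 z0) mass0 divr1 set0U; apply: eq_expect => x.
  by rewrite agree0 mul1r.
(* With weight 64 the initial penalty is at most 1. The potential starts at -1 or above and never
   exceeds 1, whence the condition 2 < N d; and a final potential of at least -1 forces 64 * loss <=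
   2. *)
pose pot := potential pi k unsat 64.
have l1 : loss k unsat (cond P set0 z0) <= 64^-1.
  apply: (@le_trans _ _ ((\sum_u \sum_v k u v) * 64^-1)); last by rewrite kernel_total mul1r.
  rewrite mulr_suml; apply: ler_sum => u _.
  rewrite mulr_suml; apply: ler_sum => v _; rewrite E0.
  have [->|k0] := eqVneq (k u v) 0; first by rewrite !mul0r.
  by rewrite ler_wpM2l // good.
have pot0 : -1 <= pot (cond P set0 z0).
  by rewrite /pot /potential; have := coll_ge0 p_ge0 (cond P set0 z0); lra.
have [|||S [z [hS m0 hpot hinf]]] := saturate (N := N) (S := set0) (z := z0) (lam := 64)
    p_ge0 pi_sum k_ge0 (ler0n _ _) (fun u v x => ler0n F _) unsat_dep HP d_gt0.
- by rewrite cards0; move: Nrt; clear; lia.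
- by rewrite mass0.
- by move: pot0; rewrite /pot; move: Nd; lra.
rewrite cards0 add0n in hS.
set Q := cond P S z in hpot hinf.
have St : (#|S| <= t)%N by move: hS Nrt; clear; lia.
have HQ : local_dist (t - #|S|) Q by apply: cond_local; rewrite ?gt_eqF.
have t1 : (1 < t - #|S|)%N by move: hS Nrt; clear; lia.
have rt : (r < t - #|S|)%N by move: hS Nrt; clear; lia.
have loss1 : loss k unsat Q <= 32^-1.
  have := coll_le1 p_ge0 pi_sum HQ (ltnW t1).
  by move: hpot pot0; rewrite /pot /potential; lra.
(* Otherwise doubling would keep the correlation of the long walk above what spreading allows;
   [small_corr] is the numerical contradiction. *)
have corr1 : corr Q (label_kernel k sat) < 32^-1.
  rewrite ltNge; apply/negP => h.
  have := @corr_walk_ge _ _ _ _ _ _ k_ge0 k_sym k_sum pi_sum sat_sym sat_uniq _ _ HQ r 64^-1 J.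
  have g1 : 64^-1 <= 1 :> F by rewrite invf_le1 // ler1n.
  have h2 : 2 * 64^-1 <= corr Q (label_kernel k sat) by apply: le_trans h; lra.
  move=> /(_ rt r_gt0 ltac:(by rewrite invr_gt0) g1 rg h2).
  apply/negP; rewrite -ltNge; apply: le_lt_trans small_corr.
  have := @corr_walk_le _ _ _ _ _ _ k_ge0 k_sym k_sum pi_sum sat_sym sat_uniq Q (2 ^ J).-1 s d s_gt0.
  move=> /(_ (fun v => ltW (hinf v)))/le_trans; apply.
  rewrite ler_pM2r ?invr_gt0 // lerD2r ler_pM2l //.
  have tau2 : 0 < tau / 2 by rewrite divr_gt0.
  have := walk_spread k_ge0 k_sym k_sum pi_sum b_gt0 tau2 sse (2 ^ J).-1 b_small.
  by rewrite prednK ?expn_gt0.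
have coll1 := @coll_ge_corr _ _ _ _ _ _ k_ge0 k_sym k_sum pi_sum sat_sym sat_uniq _ _ HQ t1.
rewrite -/(loss k unsat Q) in coll1.
pose Lb v := [arg max_(a > a0) prob Q v a]%O.
have LbP v a : prob Q v a <= prob Q v (Lb v).
  by rewrite /Lb; case: arg_maxP => // i _; apply.
have t0 : (0 < t - #|S|)%N by apply: ltnW.
pose er v := expect Q [set v] (fun x => (x v != Lb v)%:R).
have erE v : er v = 1 - prob Q v (Lb v).
  rewrite /er (@eq_expect _ _ _ _ _ _ (fun x => 1 - (x v == Lb v)%:R)).
    by rewrite expectB (expect_cst HQ) // cards1.
  by move=> x; case: eqP; rewrite /= ?subr0 ?subrr.
have dev : deviation pi Lb Q <= 16^-1.
  apply: (@le_trans _ _ (1 - coll pi Q)); last by lra.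
  rewrite -pi_sum /deviation /coll -sumrB; apply: ler_sum => v _.
  rewrite -[X in _ <= X - _]mulr1 -mulrBr ler_wpM2l ?p_ge0 // -/(er v) erE lerD2l lerN2.
  rewrite -[leRHS]mul1r -(sum_prob HQ v t0) mulr_suml; apply: ler_sum => a _.
  by rewrite expr2 ler_wpM2l ?(prob_ge0 HQ).
exists S, z, Lb; split=> //.
apply: (@le_trans _ _ (1 - (2 * deviation pi Lb Q + loss k unsat Q))); first by lra.
have -> : 2 * deviation pi Lb Q = \sum_u \sum_v (k u v * er u + k u v * er v).
  under eq_bigr do rewrite big_split.
  by rewrite big_split /= (sum_kernel_l k_sym k_sum) (sum_kernel_r k_sum) mulr2n mulrDl !mul1r.
rewrite -[X in X - _]kernel_total /loss -big_split -sumrB; apply: ler_sum => u _ /=.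
rewrite -big_split -sumrB; apply: ler_sum => v _ /=.
rewrite -!mulrDr -[X in X - _]mulr1 -mulrBr ler_wpM2l // lerBlDl.
rewrite -[leLHS](expect_cst HQ _ (card_pair u v t1)).
have -> : er u = expect Q [set u; v] (fun x => (x u != Lb u)%:R).
  symmetry; apply: (expect_sub HQ); rewrite ?subsetUl ?card_pair //.
  by apply: (@depends_at _ _ _ _ _ (fun c => (c != Lb u)%:R)); rewrite inE.
have -> : er v = expect Q [set u; v] (fun x => (x v != Lb v)%:R).
  symmetry; apply: (expect_sub HQ); rewrite ?subsetUr ?card_pair //.
  by apply: (@depends_at _ _ _ _ _ (fun c => (c != Lb v)%:R)); rewrite inE.
have -> : (sat u v (Lb u) (Lb v))%:R = expect Q [set u; v] (fun=> (sat u v (Lb u) (Lb v))%:R).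
  by rewrite (expect_cst HQ) ?card_pair.
rewrite -!expectD; apply: (expect_le HQ); first exact: card_pair.
move=> x; rewrite /unsat -!natrD ler1n.
by case: eqP => [->|_]; case: eqP => [->|_] //; case: (sat u v _ _).
Qed.

(** Padding to t - 1 vertices preserves only the deviation bound. By Markov the vertices whose label
    drops to probability at most 1/2 have mass at most 1/8, and discarding their edges costs 1/4. A
    label above 1/2 is the only most likely one, which makes it recognisable later. *)
Lemma decode_cluster : exists (S : {set V}) (z : {ffun V -> L}) (Lb : V -> L) (G : {set V}),
  [/\ #|S| = t.-1, 0 < mass P S z, (forall v, v \in G -> 1 / 2 < prob (cond P S z) v (Lb v)) &
      1 / 2 <= \sum_(u in G) \sum_(v in G) k u v * (sat u v (Lb u) (Lb v))%:R].
Proof.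
have [S1 [z1 [Lb [hS1 m1 dev1 sat1]]]] := cluster_labels.
have hlt : (#|S1| + (t.-1 - #|S1|) < t)%N by move: hS1 Nrt; clear; lia.
have [S [z [hS m0 dev]]] := pad pi Lb HP hlt tV m1.
set Q := cond P S z in dev.
have hS' : #|S| = t.-1 by rewrite hS; move: hS1 Nrt; clear; lia.
have St : (#|S| <= t)%N by rewrite hS' leq_pred.
have HQ : local_dist (t - #|S|) Q by apply: cond_local; rewrite ?gt_eqF.
have t0 : (0 < t - #|S|)%N by rewrite hS'; move: Nrt; clear; lia.
pose er v := expect Q [set v] (fun x => (x v != Lb v)%:R).
have erE v : er v = 1 - prob Q v (Lb v).
  rewrite /er (@eq_expect _ _ _ _ _ _ (fun x => 1 - (x v == Lb v)%:R)).
    by rewrite expectB (expect_cst HQ) // cards1.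
  by move=> x; case: eqP; rewrite /= ?subr0 ?subrr.
have er0 v : 0 <= er v by apply: (expect_ge0 HQ); rewrite ?cards1.
pose G := [set v | er v < 1 / 2].
exists S, z, Lb, G; split=> // [v|]; first by rewrite inE erE; lra.
have bad : \sum_v pi v * (v \notin G)%:R <= 1 / 8.
  apply: (@le_trans _ _ (2 * deviation pi Lb Q)); last by lra.
  rewrite /deviation mulr_sumr; apply: ler_sum => v _; rewrite mulrCA ler_wpM2l ?p_ge0 //.
  rewrite -/(er v) inE -leNgt; case: (leP (1 / 2) (er v)) => /= h; have := er0 v;
    rewrite ?mulr0n ?mulr1n; move: h; lra.
apply: (@le_trans _ _ (\sum_u \sum_v k u v * (sat u v (Lb u) (Lb v))%:R -
    (\sum_u \sum_v (k u v * (u \notin G)%:R + k u v * (v \notin G)%:R)))).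
  under [X in _ - X]eq_bigr do rewrite big_split.
  rewrite [X in _ - X]big_split /= (sum_kernel_l k_sym k_sum) (sum_kernel_r k_sum).
  by move: bad; set X := \sum_v pi v * _; move: sat1; lra.
rewrite -sumrB [leRHS]big_mkcond; apply: ler_sum => u _; rewrite -sumrB.
case: ifP => uG.
  rewrite [leRHS]big_mkcond; apply: ler_sum => v _; have := k_ge0 u v.
  by case: (v \in G); case: sat => /=; lra.
by apply: sumr_le0 => v _; have := k_ge0 u v; case: (v \in G); case: sat => /=; lra.
Qed.

End OneCluster.
Variables (W : V -> V -> F) (sat : V -> V -> L -> L -> bool) (B : nat).
Hypotheses (W_ge0 : forall u v, 0 <= W u v) (W_sym : forall u v, W u v = W v u).
Hypothesis W_total : \sum_u \sum_v W u v = 2.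
Hypotheses (sat_sym : forall u v a b, W u v != 0 -> sat u v a b = sat v u b a).
Hypotheses (sat_uniq : forall u v a, W u v != 0 ->
  exists b0, forall b, sat u v a b = (b == b0)).
Hypothesis W_obj : \sum_u \sum_v W u v *
  expect P [set u; v] (fun x => (~~ sat u v (x u) (x v))%:R) <= 256^-1.
Hypothesis tauB : tau ^+ B * 3 < #|V|%:R^-1.
Variable R : {set V}.

Let vol v := \sum_u W v u.
Hypothesis volR : \sum_(v in ~: R) vol v <= 1 / 2.

Let un u v := expect P [set u; v] (fun x => (~~ sat u v (x u) (x v))%:R).
Let w u v := W u v * ((u \in R) && (v \in R) && (un u v <= 64^-1))%:R.
(** The added 1 / #|V| bounds the measure of every vertex from below, so that the number of
    shrinkings is bounded whatever the weights are; it raises the total only from 2 to 3. *)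
Let m v := vol v + #|V|%:R^-1.

Let t2 : (2 < t)%N.
Proof. by move: Nrt; clear; lia. Qed.

Let V_gt0 : 0 < #|V|%:R :> F.
Proof. by rewrite ltr0n; apply: leq_trans tV; apply: ltn_trans t2. Qed.

Let vol_ge0 v : 0 <= vol v.
Proof. exact: sumr_ge0. Qed.

Let un_ge0 u v : 0 <= un u v.
Proof. by apply: (expect_ge0 HP) => //; apply: card_pair; apply: ltnW. Qed.

Let un_sym u v : W u v != 0 -> un u v = un v u.
Proof.
move=> W0; rewrite /un setUC; apply: eq_expect => x.
by rewrite sat_sym.
Qed.

Let w_ge0 u v : 0 <= w u v.
Proof. by rewrite mulr_ge0. Qed.

Let w_sym u v : w u v = w v u.
Proof.
rewrite /w W_sym; have [->|W0] := eqVneq (W v u) 0; first by rewrite !mul0r.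
by rewrite un_sym 1?W_sym // (andbC (u \in R)).
Qed.

Let w_le u v : w u v <= W u v.
Proof. by rewrite ler_piMr //; case: (_ && _). Qed.

(** Of the ordered total 2, pairs with a given end outside [R] take at most 1/2 for each of the two
    ends, and by Markov the pairs violated with probability above 1/64 take at most 64 / 256. *)
Lemma good_weight : 3 / 4 <= inner w R.
Proof.
pose bad u v : F := (64^-1 < un u v :> F)%R%:R.
have hb : \sum_u \sum_v W u v * bad u v <= 1 / 4.
  apply: (@le_trans _ _ (64 * \sum_u \sum_v W u v * un u v)); last first.
    have := W_obj; rewrite -/un; set X := \sum_u _; lra.
  rewrite mulr_sumr; apply: ler_sum => u _; rewrite mulr_sumr; apply: ler_sum => v _.
  rewrite mulrCA ler_wpM2l // /bad; case: ltP => h; last by rewrite mulr_ge0.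
  by have := h; rewrite mulr1n; lra.
have hR : \sum_u \sum_v W u v * (u \notin R)%:R <= 1 / 2.
  apply: le_trans volR; rewrite [leRHS]big_mkcond; apply: ler_sum => u _.
  rewrite -mulr_suml inE; case: (u \in R) => /=; first by rewrite mulr0.
  by rewrite mulr1.
have hR' : \sum_u \sum_v W u v * (v \notin R)%:R <= 1 / 2.
  rewrite exchange_big; apply: le_trans hR; apply: ler_sum => u _.
  by apply: ler_sum => v _; rewrite W_sym.
apply: (@le_trans _ _ (\sum_u \sum_v (W u v - (W u v * (u \notin R)%:R +
    (W u v * (v \notin R)%:R + W u v * bad u v))))).
  under eq_bigr do rewrite sumrB !big_split.
  rewrite sumrB !big_split /= W_total.
  by move: hb hR hR'; set X := \sum_u _; set Y := \sum_u _; set Z := \sum_u _; lra.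
rewrite /inner [leRHS]big_mkcond; apply: ler_sum => u _.
case: ifP => uR /=; last by apply: sumr_le0 => v _;
  rewrite mulr1 opprD addrA subrr sub0r oppr_le0 addr_ge0 // mulr_ge0.
rewrite [leRHS]big_mkcond; apply: ler_sum => v _; case: ifP => vR /=; last first.
  by rewrite mulr0 add0r mulr1 opprD addrA subrr sub0r oppr_le0 mulr_ge0.
rewrite /w uR vR /bad /= !mulr0 !add0r; case: leP => _; rewrite ?mulr0 ?mulr1 ?subr0 //.
by rewrite subrr.
Qed.

Lemma meas_R : meas m R <= 3.
Proof.
apply: (@le_trans _ _ (\sum_v m v)).
  rewrite /meas [leLHS]big_mkcond; apply: ler_sum => v _; case: ifP => // _.
  by rewrite addr_ge0 // invr_ge0 ltW.
rewrite big_split /= W_total sumr_const -[X in _ + X]mulr_natl divff ?gt_eqF //; lra.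
Qed.

(** Three losses: the density 1/4 shrinks by at most [b ^+ 2 / 4] in each of [B] rounds, to some c;
    half of the weight of the expanding set survives decoding; and passing to a densest subset
    halves once more, turning the average degree into a minimum degree. What is left is c / 4 at
    every vertex. *)
Lemma decode : exists (S : {set V}) (z : {ffun V -> L}) (Lb : V -> L) (U : {set V}),
  [/\ #|S| = t.-1, 0 < mass P S z, U != set0, U \subset R &
    forall v, v \in U -> 1 / 2 < prob (cond P S z) v (Lb v) /\
      (b ^+ 2 / 4) ^+ B / 16 * vol v <=
      \sum_(u in U) W v u * (sat v u (Lb v) (Lb u))%:R].
Proof.
pose th := b ^+ 2 / 4; have b2 : 0 < b ^+ 2 by rewrite exprn_gt0.
have th0 : 0 < th by rewrite divr_gt0.
have th1 : th <= 1 by rewrite /th; move: b_small; lra.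
have R0 : R != set0.
  by apply/negP => /eqP e; have := good_weight; rewrite e /inner big_set0; lra.
have m_ge v : #|V|%:R^-1 <= m v by rewrite lerDr.
have iV : 0 < #|V|%:R^-1 :> F by rewrite invr_gt0.
have c4 : 0 < 4^-1 :> F by rewrite invr_gt0.
have dens : 4^-1 * meas m R <= inner w R by have := good_weight; have := meas_R; lra.
have tB : tau ^+ B * meas m R < #|V|%:R^-1.
  by apply: le_lt_trans tauB; rewrite ler_wpM2l ?exprn_ge0 ?meas_R // ltW.
have [Y [c [[YR Y0 cge] [eY dY sY]]]] :=
  expanding_subset w_ge0 w_sym iV m_ge th0 th1 tau_gt0 c4 R0 dens tB.
have c0 : 0 < c by apply: lt_le_trans cge; rewrite mulr_gt0 ?exprn_gt0.
have m0 v : 0 < m v by apply: lt_le_trans (m_ge v).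
have mY0 : 0 < meas m Y.
  have [v vY] := set0Pn _ Y0; rewrite /meas (big_setD1 v vY) /=.
  by rewrite ltr_pwDl // sumr_ge0 // => u _; rewrite ltW.
set e := inner w Y in eY; have e0 : 0 < e by rewrite eY mulr_gt0.
pose k u v := w u v * ((u \in Y) && (v \in Y))%:R / e.
pose pi v := \sum_u k u v.
have k_ge0 u v : 0 <= k u v by rewrite divr_ge0 ?mulr_ge0 // ltW.
have k_sym u v : k u v = k v u by rewrite /k w_sym andbC.
have sumY (f : V -> V -> F) : \sum_u \sum_v f u v * ((u \in Y) && (v \in Y))%:R =
    \sum_(u in Y) \sum_(v in Y) f u v.
  rewrite [RHS]big_mkcond; apply: eq_bigr => u _; case: (u \in Y) => /=; last first.
    by apply: big1 => v _; rewrite mulr0.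
  rewrite [RHS]big_mkcond; apply: eq_bigr => v _.
  by case: (v \in Y); rewrite ?mulr1 ?mulr0.
have pi_sum : \sum_v pi v = 1.
  rewrite /pi exchange_big /=.
  under eq_bigr do rewrite -mulr_suml.
  by rewrite -mulr_suml sumY -/e divff ?gt_eqF.
have k0w u v : k u v != 0 -> w u v != 0 by apply: contraNneq => w0; rewrite /k w0 !mul0r.
have k0W u v : k u v != 0 -> W u v != 0.
  by move/k0w; apply: contraNneq => w0; rewrite /w w0 mul0r.
have piE v : v \in Y -> pi v = (\sum_(u in Y) w v u) / e.
  move=> vY; rewrite /pi -mulr_suml; congr (_ / _); rewrite [RHS]big_mkcond.
  by apply: eq_bigr => u _; rewrite vY andbT w_sym; case: (u \in Y); rewrite ?mulr1 ?mulr0.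
have pi_ge0 v : 0 <= pi v by apply: sumr_ge0.
have sse (Z : {set V}) : \sum_(v in Z) pi v <= tau / 2 ->
    \sum_(u in Z) \sum_(v in Z) k u v <= b ^+ 2 / 2 * \sum_(v in Z) pi v.
  move=> hZ; pose X := Z :&: Y; have XY : X \subset Y by apply: subsetIr.
  have piX : \sum_(v in X) pi v <= \sum_(v in Z) pi v.
    by rewrite [leRHS](big_setID Y) /= lerDl sumr_ge0.
  (* Degrees in the core are at least half the density, so [pi] controls [m] up to a factor 2. This
     explains [tau / 2] in the expansion hypothesis, and [b ^+ 2 / 4] in the density against
     [b ^+ 2 / 2] in the expansion. *)
  have mX : c * meas m X <= 2 * (e * \sum_(v in X) pi v).
    rewrite /meas !mulr_sumr; apply: ler_sum => v vX.
    have vY := subsetP XY v vX.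
    by rewrite piE // [e * _]mulrC divfK ?gt_eqF // dY.
  have measX : meas m X <= tau * meas m Y.
    rewrite -(ler_pM2l c0); apply: (le_trans mX).
    have := ler_wpM2l (ltW e0) (le_trans piX hZ); rewrite {2}eY.
    by set x := e * _; move=> H; lra.
  have -> : \sum_(u in Z) \sum_(v in Z) k u v = inner w X / e.
    rewrite /inner mulr_suml big_mkcond [RHS]big_mkcond; apply: eq_bigr => u _.
    rewrite inE; case: (u \in Z) => //=; case uY: (u \in Y); last first.
      by apply: big1 => v _; rewrite /k uY mulr0 mul0r.
    rewrite mulr_suml big_mkcond [RHS]big_mkcond; apply: eq_bigr => v _.
    rewrite inE /k uY; case: (v \in Z) => //=; case: (v \in Y); rewrite ?mulr1 //.
    by rewrite mulr0 mul0r.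
  rewrite ler_pdivrMr //; apply: (le_trans (sY X XY measX)).
  apply: (@le_trans _ _ (th * (2 * (e * \sum_(v in X) pi v)))).
    by rewrite -mulrA ler_wpM2l // ltW.
  have := ler_wpM2l (ltW (mulr_gt0 b2 e0)) piX; rewrite /th; lra.
have good u v : k u v != 0 -> expect P [set u; v] (fun x => (~~ sat u v (x u) (x v))%:R) <= 64^-1.
  move/k0w; rewrite /w; case: leP => //; rewrite andbF mulr0 eqxx //.
have [S [z [Lb [G [hS mS pG sG]]]]] := decode_cluster k_ge0 k_sym (fun v => erefl (pi v)) pi_sum
  (fun u v a b k0 => sat_sym a b (k0W u v k0)) (fun u v a k0 => sat_uniq a (k0W u v k0)) sse good.
pose ws u v := w u v * ((u \in Y) && (v \in Y))%:R * (sat u v (Lb u) (Lb v))%:R.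
have ws_ge0 u v : 0 <= ws u v by rewrite !mulr_ge0.
have ws_sym u v : ws u v = ws v u.
  rewrite /ws w_sym andbC; have [->|w0] := eqVneq (w v u) 0; first by rewrite !mul0r.
  rewrite (sat_sym (u := u)) //; apply: contra w0 => /eqP W0.
  by rewrite /w W_sym W0 mul0r.
pose GY := G :&: Y.
have sGY : 1 / 2 * e <= inner ws GY.
  apply: (@le_trans _ _ ((\sum_(u in G) \sum_(v in G) k u v * (sat u v (Lb u) (Lb v))%:R) * e)).
    by rewrite ler_wpM2r // ltW.
  rewrite /inner mulr_suml big_mkcond [leRHS]big_mkcond; apply: ler_sum => u _.
  rewrite inE; case: (u \in G) => //=; case uY: (u \in Y); last first.
    by rewrite big1 ?mul0r // => v _; rewrite /k uY mulr0 !mul0r.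
  rewrite mulr_suml big_mkcond [leRHS]big_mkcond; apply: ler_sum => v _.
  rewrite inE /k /ws uY; case: (v \in G) => //=; case: (v \in Y).
    by rewrite mulrAC divfK ?gt_eqF.
  by rewrite mulr0 !mul0r.
have GY0 : GY != set0.
  by apply/negP => /eqP e'; move: sGY; rewrite e' /inner big_set0; lra.
have dGY : c / 2 * meas m GY <= inner ws GY.
  apply: le_trans sGY; rewrite eY.
  have : meas m GY <= meas m Y.
    by rewrite /meas [leRHS](big_setID G) /= setIC lerDl sumr_ge0 // => v _; rewrite ltW.
  by move=> H; have := ler_wpM2l (ltW c0) H; lra.
have [U [c' [UG U0 cc' _ dU]]] := dense_core ws_ge0 ws_sym m0 GY0 dGY.
exists S, z, Lb, U; split=> //.
  by apply: subset_trans UG (subset_trans (subsetIr _ _) YR).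
move=> v vU; have := subsetP UG v vU; rewrite inE => /andP[vG vY].
split; first exact: pG.
have H1 : \sum_(u in U) ws v u <= \sum_(u in U) W v u * (sat v u (Lb v) (Lb u))%:R.
  apply: ler_sum => u _; rewrite ler_wpM2r // -[leRHS]mulr1 ler_pM //.
  by case: (_ && _).
have H2 := dU v vU.
have H3 : c / 2 * vol v <= c' * m v.
  rewrite ler_pM // ?divr_ge0 ?(ltW c0) //; rewrite lerDl ltW //.
have H4 : (b ^+ 2 / 4) ^+ B / 16 * vol v <= c / 4 * vol v.
  by rewrite ler_wpM2r // -/th; move: cge; lra.
by move: H1 H2 H3 H4; set x := \sum_(u in U) _; set y := \sum_(u in U) _; lra.
Qed.

End Decoding.

(** * Pseudodistributions as local distributions *)

Section PseudoDistributions.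
Variables (F : realFieldType) (n q t : nat) (mu : local_weights F n q).
Hypotheses (Hmu : is_pseudodist t mu) (tn : (t <= n)%N).
Variable d0 : 'I_q.
Implicit Types (S T U : {set 'I_n}) (x z : {ffun 'I_n -> 'I_q}).

Definition extend S (y : passign q S) : {ffun 'I_n -> 'I_q} :=
  [ffun i => if insub i is Some s then y s else d0].

Definition restrict S x : passign q S := [ffun s => x (val s)].

Definition superset T : {set 'I_n} :=
  if [pick S : {set 'I_n} | (#|S| == t) && (T \subset S)] is Some S' then S' else T.

(** The table of a set of size [t] containing [T], read on total assignments by filling in [d0]
    elsewhere. It depends on the superset picked, but its expectations of functions of [T] do
    not. *)
Definition local_of T x : F :=
  \sum_(y : passign q (superset T)) mu (S := superset T) y * (x == extend y)%:R.

Lemma extendE S (y : passign q S) (s : {i | i \in S}) : extend y (val s) = y s.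
Proof. by rewrite ffunE valK. Qed.

Lemma restrictK S : cancel (@extend S) (@restrict S).
Proof. by move=> y; apply/ffunP => s; rewrite ffunE extendE. Qed.

Lemma superset_exists T : (#|T| <= t)%N -> exists2 S : {set 'I_n}, #|S| = t & T \subset S.
Proof.
move=> hT; move: {2}(t - #|T|)%N (erefl (t - #|T|)%N) => k.
elim: k T hT => [|k IH] T hT hk; first by exists T => //; lia.
have [i iT] : exists i, i \notin T.
  have : (#|T| < #|'I_n|)%N by rewrite card_ord; lia.
  rewrite -cardsT => hlt; case: (pickP (fun s => s \notin T)) => [s|h]; first by exists s.
  move: hlt; suff -> : T = [set: 'I_n] by rewrite ltnn.
  by apply/setP => s; have := h s; rewrite inE => /negbT/negPn ->.
have cT : #|i |: T| = #|T|.+1 by rewrite cardsU1 iT.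
have [||S hS sS] := IH (i |: T); rewrite ?cT; [lia|lia|].
by exists S => //; apply: subset_trans sS; apply: subsetUr.
Qed.

Lemma supersetP T : (#|T| <= t)%N -> #|superset T| = t /\ T \subset superset T.
Proof.
rewrite /superset; case: pickP => [S /andP[/eqP hS sS] //|h] /superset_exists[S hS sS].
by have := h S; rewrite hS eqxx sS.
Qed.

Lemma expect_local_of T f :
  expect local_of T f = \sum_(y : passign q (superset T)) mu (S := superset T) y * f (extend y).
Proof.
rewrite /expect; under eq_bigr do rewrite mulr_suml.
rewrite exchange_big; apply: eq_bigr => y _.
rewrite (bigD1 (extend y)) //= eqxx mulr1 big1 ?addr0 // => x /negPf->.
by rewrite mulr0 mul0r.
Qed.

Lemma marginal_agree S U z :
  marginal (mu (S := S)) U z = \sum_(y : passign q S | agree (U :&: S) z (extend y)) mu y.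
Proof.
apply: eq_bigl => y; apply/forallP/agreeP => [h i|h s].
  rewrite inE => /andP[iU iS]; have := h (exist _ i iS); rewrite iU /= => /eqP <-.
  by rewrite -(extendE y (exist _ i iS)).
apply/implyP => sU; rewrite -h ?extendE //.
by rewrite inE sU; case: s {sU}.
Qed.

(** Assignments on [U] are represented by the total ones equal to [d0] outside [U], so that each is
    counted once. *)
Lemma sum_marginal S U f : U \subset S -> depends_on U f ->
  \sum_(y : passign q S) mu y * f (extend y) =
  \sum_(z : {ffun 'I_n -> 'I_q} | [forall i, (i \notin U) ==> (z i == d0)]) f z * marginal (mu (S := S)) U z.
Proof.
move=> US dU; under [RHS]eq_bigr do rewrite marginal_agree (setIidPl US) mulr_sumr big_mkcond.
rewrite [RHS]exchange_big; apply: eq_bigr => y _ /=.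
pose z0 : {ffun 'I_n -> 'I_q} := [ffun i => if i \in U then extend y i else d0].
have z0E i : i \in U -> z0 i = extend y i by move=> iU; rewrite [LHS]ffunE iU.
rewrite (bigD1 z0) /=; last by apply/forallP => i; rewrite ffunE; case: (i \in U) => /=.
rewrite big1 ?addr0 => [|z /andP[/forallP hz zz]]; last first.
  case: agreeP => // h; case/eqP: zz; apply/ffunP => i; rewrite ffunE.
  case: (boolP (i \in U)) => iU; first by rewrite h.
  by have := hz i; rewrite iU => /eqP.
rewrite (_ : agree _ _ _) => [|]; last by apply/agreeP => i iU; rewrite z0E.
by rewrite mulrC; congr (_ * _); apply: dU => i iU; rewrite z0E.
Qed.

Lemma local_of_dist : local_dist t local_of.
Proof.
have [mu0 mu1 muC] := Hmu; split=> [T x hT|T hT|T U f UT hT dU].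
- have [hS _] := supersetP hT.
  by apply: sumr_ge0 => y _; rewrite mulr_ge0 // mu0.
- have [hS _] := supersetP hT; rewrite -(mu1 _ hS).
  transitivity (expect local_of T (fun=> 1)); first by apply: eq_bigr => x _; rewrite mulr1.
  by rewrite expect_local_of; apply: eq_bigr => y _; rewrite mulr1.
- have hU : (#|U| <= t)%N by apply: leq_trans hT; apply: subset_leq_card.
  have [hS sS] := supersetP hT; have [hS' sS'] := supersetP hU.
  rewrite !expect_local_of !(sum_marginal (U := U)) //; last exact: subset_trans sS.
  apply: eq_bigr => z _; congr (_ * _); apply: muC => //.
  by rewrite subsetI sS' (subset_trans UT).
Qed.

Lemma marginal_local S U z : #|S| = t -> U \subset S ->
  marginal (mu (S := S)) U z = expect local_of U (fun x => (agree U z x)%:R).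
Proof.
move=> hS US; have [mu0 mu1 muC] := Hmu.
have hU : (#|U| <= t)%N by rewrite -hS; apply: subset_leq_card.
have [hS' sS'] := supersetP hU.
rewrite (muC S (superset U)) // ?subsetI ?US //.
rewrite expect_local_of marginal_agree (setIidPl sS') big_mkcond.
by apply: eq_bigr => y _; case: agree; rewrite ?mulr1 ?mulr0.
Qed.

Lemma mass_local T z : #|T| = t -> mass local_of T z = mu (restrict T z).
Proof.
move=> hT; rewrite /mass -(marginal_local z hT (subxx T)) marginal_agree setIid.
rewrite (bigD1 (restrict T z)) /=; last first.
  by apply/agreeP => i iT; rewrite -[i]/(val (exist (fun i => i \in T) i iT)) extendE ffunE.
rewrite big1 ?addr0 // => y /andP[/agreeP h /eqP[]]; apply/ffunP => s.
by rewrite ffunE -h ?extendE //; case: s.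
Qed.

End PseudoDistributions.

(** * Decoding an instance from the rows of the table *)

Section Instances.
Variables (F : realFieldType) (n q : nat) (I : instance F n q).

(** Symmetric and zero off the edges, so sums run over all ordered pairs and count each edge twice:
    the total weight is 2. *)
Definition edge_wt u v : F := if adj I u v then wt I u v else 0.
Definition vol v := \sum_u edge_wt v u.

Lemma edge_wt_ge0 u v : 0 <= edge_wt u v.
Proof. by rewrite /edge_wt; case: ifP => // h; apply: wt_ge0. Qed.

Lemma edge_wtC u v : edge_wt u v = edge_wt v u.
Proof. by rewrite /edge_wt adj_sym; case: ifP => // h; apply: wt_sym; rewrite adj_sym. Qed.

Lemma edge_wt_adj u v : edge_wt u v != 0 -> adj I u v.
Proof. by rewrite /edge_wt; case: ifP => //; rewrite eqxx. Qed.

Lemma sum_ordered (f : 'I_n -> 'I_n -> F) :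
  (forall i j, f i j = f j i) -> (forall i, f i i = 0) ->
  \sum_i \sum_j f i j = 2 * \sum_(i < n) \sum_(j < n | (i < j)%N) f i j.
Proof.
move=> fC f0.
transitivity (\sum_(i < n) \sum_(j < n | (i < j)%N) f i j +
              \sum_(i < n) \sum_(j < n | (j < i)%N) f i j).
  rewrite -big_split; apply: eq_bigr => i _ /=.
  rewrite (bigID (fun j : 'I_n => (i < j)%N)) /=; congr (_ + _).
  rewrite (bigD1 i) /= ?ltnn // f0 add0r; apply: eq_bigl => j.
  by rewrite -leqNgt ltn_neqAle andbC.
rewrite mulr2n mulrDl !mul1r; congr (_ + _).
rewrite (exchange_big_dep xpredT) //=; apply: eq_bigr => j _.
by apply: eq_bigr => i _; rewrite fC.
Qed.

Lemma sum_edges (f : 'I_n -> 'I_n -> F) : (forall i j, adj I i j -> f i j = f j i) ->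
  \sum_i \sum_j edge_wt i j * f i j =
  2 * \sum_(i < n) \sum_(j < n | (i < j)%N && adj I i j) wt I i j * f i j.
Proof.
move=> fC; rewrite (sum_ordered (f := fun i j => edge_wt i j * f i j)).
- congr (_ * _); apply: eq_bigr => i _; rewrite big_mkcondr; apply: eq_bigr => j _.
  by rewrite /edge_wt; case: ifP; rewrite ?mul0r.
- move=> i j; rewrite edge_wtC; have [->|/edge_wt_adj h] := eqVneq (edge_wt j i) 0.
    by rewrite !mul0r.
  by rewrite fC // adj_sym.
- by move=> i; rewrite /edge_wt (negPf (adj_irrefl I i)) mul0r.
Qed.

Lemma edge_wt_total : \sum_u \sum_v edge_wt u v = 2.
Proof.
have := @sum_edges (fun _ _ => 1) (fun _ _ _ => erefl).
under eq_bigr do under eq_bigr do rewrite mulr1.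
move=> ->; under eq_bigr do under eq_bigr do rewrite mulr1.
by rewrite wt_sum1 mulr1.
Qed.

Lemma value_ordered (x : {ffun 'I_n -> 'I_q}) :
  \sum_u \sum_v edge_wt u v * (cstr I u v (x u) (x v))%:R = 2 * value I x.
Proof. by rewrite sum_edges // => i j h; rewrite cstr_sym. Qed.

Hypothesis UG : unique_games I.

Lemma edge_sat_uniq u v a : edge_wt u v != 0 ->
  exists b0, forall b, cstr I u v a b = (b == b0).
Proof. by move/edge_wt_adj/UG => [s hs]; exists (s a) => b. Qed.

Lemma edge_sat_sym u v a b : edge_wt u v != 0 -> cstr I u v a b = cstr I v u b a.
Proof. by move/edge_wt_adj; apply: cstr_sym. Qed.

Section Objective.
Variables (t : nat) (m : pseudodist F n q t) (d0 : 'I_q).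
Hypotheses (t2 : (2 <= t)%N) (tn : (t <= n)%N).
Let P := local_of t (psd_fun m) d0.
Let HP : local_dist t P := local_of_dist (psd_axiom m) tn d0.

Lemma pair_prob_local i j a b : i != j ->
  pair_prob m i j a b = expect P [set i; j] (fun x => (x i == a)%:R * (x j == b)%:R).
Proof.
move=> ij; have c2 : (#|[set i; j]| <= t)%N by apply: card_pair.
rewrite /pair_prob; case: pickP => [S /andP[/eqP hS sS]|h].
  rewrite (marginal_local (psd_axiom m) tn d0) //; apply: eq_expect => x.
  rewrite -natrM mulnb; congr (nat_of_bool _)%:R; apply/agreeP/andP => [h|[/eqP xi /eqP xj] k].
    by rewrite !h ?inE ?eqxx ?orbT // !ffunE eqxx (eq_sym j i) (negPf ij) !eqxx.
  by rewrite !inE ffunE => /orP[/eqP->|/eqP->]; rewrite ?eqxx // (eq_sym j i) (negPf ij).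
have [S hS sS] := superset_exists tn c2.
by have := h S; rewrite hS eqxx sS.
Qed.

Lemma objective_local :
  \sum_u \sum_v edge_wt u v *
    expect P [set u; v] (fun x => (~~ cstr I u v (x u) (x v))%:R) =
  2 * (1 - sa_objective I m).
Proof.
rewrite (sum_edges (f := fun u v => expect P [set u; v] (fun x => (~~ cstr I u v (x u) (x v))%:R)));
  last first.
  by move=> i j h; rewrite setUC; apply: eq_expect => x; rewrite cstr_sym.
congr (_ * _); rewrite -[X in _ = X - _](wt_sum1 I) /sa_objective -sumrB; apply: eq_bigr => i _.
rewrite -sumrB; apply: eq_bigr => j /andP[ij h]; rewrite -[X in X - _]mulr1 -mulrBr; congr (_ * _).
have nij : i != j by rewrite -val_eqE /= neq_ltn ij.
have c2 : (#|[set i; j]| <= t)%N by apply: card_pair.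
transitivity (1 - expect P [set i; j] (fun x => (cstr I i j (x i) (x j))%:R)).
  rewrite -[X in _ = X - _](expect_cst HP 1 c2) -expectB; apply: eq_expect => x.
  by case: (cstr _ _ _ _ _); rewrite /= ?subr0 ?subrr.
congr (_ - _); symmetry.
under eq_bigr do under eq_bigr do rewrite pair_prob_local //.
under eq_bigr do rewrite -expect_sum.
rewrite -expect_sum; apply: eq_expect => x.
rewrite (bigD1 (x i)) //= [X in _ + X]big1 ?addr0 => [|a /negPf ax]; last first.
    by apply: big1 => b _; rewrite eq_sym ax mul0r.
rewrite big_mkcond (bigD1 (x j)) //= big1 ?addr0 => [|b /negPf bx]; last first.
    by rewrite eq_sym bx mulr0; case: ifP.
by rewrite !eqxx mulr1; case: cstr.
Qed.

End Objective.

(** For [v] outside a set [S] of t - 1 vertices this is the conditional probability of [a] given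
    [z], times the mass of [z]. Comparing entries for fixed [S], [z] and [v] thus compares
    conditional probabilities. *)
Definition row_prob t (m : pseudodist F n q t) (S : {set 'I_n}) (z : {ffun 'I_n -> 'I_q}) v a : F :=
  psd_fun m (v |: S) (restrict (v |: S) (set_at z v a)).

(* The walks in the proof have length [2 ^ J]; up to constants the parameters
   are powers of [h]. *)
Lemma decode_rows t (m : pseudodist F n q t) (B J : nat) (R : {set 'I_n}) :
  let h := (2 ^ (2 ^ J))%N in
  (0 < q <= h)%N -> (0 < B)%N -> (2 ^ (2 * B + 8) <= h)%N ->
  (h ^ 20 <= t <= n)%N -> (n <= h ^ B)%N ->
  1 - 512^-1 <= sa_objective I m -> \sum_(v in ~: R) vol v <= 1 / 2 ->
  exists (S : {set 'I_n}) (z : {ffun 'I_n -> 'I_q}) (Lb : 'I_n -> 'I_q) (U : {set 'I_n}),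
  [/\ #|S| = t.-1, U != set0, U \subset R &
    forall v, v \in U ->
      [/\ v \in S -> z v = Lb v,
          v \notin S -> 0 < row_prob m S z v (Lb v) /\
            forall a, a != Lb v -> row_prob m S z v a < row_prob m S z v (Lb v) &
          2^-1 ^+ (2 * B ^ 2 + 8 * B + 4) * vol v <=
          \sum_(u in U) edge_wt v u * (cstr I v u (Lb v) (Lb u))%:R]].
Proof.
move=> h /andP[q0 qh] B0 hB /andP[ht tn] nh obj volR.
pose d0 := Ordinal q0; pose P := local_of t (psd_fun m) d0.
have HP : local_dist t P := local_of_dist (psd_axiom m) tn d0.
have h0 : (0 < h)%N by rewrite expn_gt0.
have hF : 0 < h%:R :> F by rewrite ltr0n.
have hge : 2 ^+ (2 * B + 8) <= h%:R :> F by rewrite -natrX ler_nat.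
have h256 : (256 <= h)%N by apply: leq_trans hB; rewrite (@leq_exp2l 2 8) //; lia.
have hF256 : 256 <= h%:R :> F by rewrite (ler_nat F 256).
have h1 : 1 <= h%:R :> F by apply: le_trans hF256; rewrite ler1n.
have e8 : (2 * B + 8 = (2 * B + 6) + 2)%N by rewrite -addnA.
(* Chosen so that 32 b^2 = 2^-(2 B + 1): over 2^J steps the second moment contracts by h^-(2 B + 1),
   which beats n <= h^B. *)
pose b : F := 2^-1 ^+ (B + 3).
have b0 : 0 < b by rewrite exprn_gt0 // invr_gt0.
have bE : b ^+ 2 = 2^-1 ^+ (2 * B + 6) by rewrite /b -exprM; congr (_ ^+ _); lia.
have Hb : 32 * b ^+ 2 = 2^-1 ^+ (2 * B + 1).
  rewrite bE (_ : 2 * B + 6 = (2 * B + 1) + 5)%N; last by lia.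
  by rewrite exprD; set x := _ ^+ (_ + 1); field.
have hx k : 2^-1 ^+ (k * 2 ^ J) = h%:R ^- k :> F.
  by rewrite mulnC exprM exprVn -natrX exprVn.
have Hx0 k : 0 < h%:R ^+ k :> F by rewrite exprn_gt0.
have Hx1 k : 1 <= h%:R ^+ k :> F by rewrite exprn_ege1.
(* [tau] brings the measure below 1 / n after B shrinkings. [d] requires 4 h^18 conditionings, which
   fit below h^20 <= t. [s] keeps both terms of the Cauchy-Schwarz bound at most 64^-(2^J) =
   h^-6. *)
pose tau : F := h%:R ^- 2; pose s : F := (2 * h%:R ^+ 9)^-1; pose d : F := h%:R ^- 18.
have tau0 : 0 < tau by rewrite invr_gt0.
have s0 : 0 < s by rewrite invr_gt0 mulr_gt0.
have dp : 0 < d by rewrite invr_gt0.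
have b_small : 32 * b ^+ 2 <= 1 by rewrite Hb exprn_ile1 ?invr_ge0 // invf_le1 ?ler1n.
have Nd : 2 < (4 * h ^ 18)%:R * d.
  by rewrite natrM natrX /d mulfK ?gt_eqF // ltr_nat.
have r0 : (0 < h ^ 6)%N by rewrite expn_gt0 h0.
have Nrt : (4 * h ^ 18 + h ^ 6 + 2 < t)%N.
  apply: leq_trans ht; rewrite (expnD h 18 2).
  have : (h ^ 6 <= h ^ 18)%N by rewrite leq_pexp2l.
  have : (8 <= h ^ 2)%N by apply: (@leq_trans (h ^ 1));
    [rewrite expn1 (leq_trans _ h256) | rewrite leq_pexp2l].
  have : (0 < h ^ 18)%N by rewrite expn_gt0 h0.
  by move: (h ^ 18)%N (h ^ 6)%N (h ^ 2)%N => x y z; clear; nia.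
have g64 : 64^-1 ^+ (2 ^ J) = h%:R ^- 6 :> F.
  rewrite -hx exprM; congr (_ ^+ _); by rewrite exprVn; congr (_^-1); ring.
have rg : 1 <= (h ^ 6)%:R * 64^-1 ^+ (2 ^ J) :> F by rewrite g64 natrX mulfV ?gt_eqF.
have n0 : (0 < n)%N by apply: leq_trans tn; apply: leq_trans ht; rewrite expn_gt0 h0.
have nF : 0 < n%:R :> F by rewrite ltr0n.
have nH : n%:R <= h%:R ^+ B :> F by rewrite -natrX ler_nat.
have tauB : tau ^+ B * 3 < #|'I_n|%:R^-1.
  rewrite card_ord /tau exprVn -exprM mulrC ltr_pdivrMr // mulrC ltr_pdivlMr //.
  apply: (@le_lt_trans _ _ (3 * h%:R ^+ B)); first by rewrite ler_pM2l.
  rewrite mul2n -addnn exprD ltr_pM2r //; apply: lt_le_trans (_ : 256 <= _).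
    by rewrite ltr_nat.
  by apply: le_trans hF256 _; rewrite -[leLHS]expr1 ler_weXn2l.
have small : (s * (2 / (b ^+ 2 * (tau / 2)) + (32 * b ^+ 2) ^+ (2 ^ J) * #|'I_n|%:R) +
   #|'I_q|%:R ^+ 2 * d / s) / 2 < 2 * 64^-1 ^+ (2 ^ J).
  have hb : (2^-1 ^+ (2 * B + 1)) ^+ (2 ^ J) = h%:R ^- (2 * B + 1) :> F by rewrite -exprM hx.
  rewrite !card_ord g64 Hb hb.
  have T : 2 / (b ^+ 2 * (tau / 2)) <= h%:R ^+ 3.
    have -> : 2 / (b ^+ 2 * (tau / 2)) = 2 ^+ (2 * B + 8) * h%:R ^+ 2.
      rewrite bE e8.
      rewrite exprVn (exprD 2 (2 * B + 6) 2) /tau; field.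
      by rewrite !gt_eqF // exprn_gt0.
    by rewrite [leRHS]exprS ler_pM2r.
  have Y : h%:R ^- (2 * B + 1) * n%:R <= h%:R ^+ 3 :> F.
    apply: le_trans (Hx1 3); rewrite mulrC ler_pdivrMr // mul1r.
    by apply: le_trans nH _; rewrite ler_weXn2l // mul2n -addnn -addnA leq_addr.
  have Q : q%:R ^+ 2 <= h%:R ^+ 2 :> F by rewrite ler_pXn2r ?nnegrE ?ler0n // ler_nat.
  have Z : q%:R ^+ 2 * d / s <= h%:R ^- 6.
    apply: (@le_trans _ _ (h%:R ^+ 2 * d / s)).
      by apply: ler_wpM2r; [rewrite invr_ge0 ltW | apply: ler_wpM2r; [apply: ltW | ]].
    have -> : h%:R ^+ 2 * d / s = 2 / h%:R * h%:R ^- 6.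
      by rewrite /d /s; field; rewrite gt_eqF.
    rewrite -[leRHS]mul1r ler_pM2r ?invr_gt0 // ler_pdivrMr // mul1r.
    by apply: le_trans hF256; rewrite ler_nat.
  have S' : s * (h%:R ^+ 3 + h%:R ^+ 3) = h%:R ^- 6 by rewrite /s; field; rewrite gt_eqF.
  have := ler_wpM2l (ltW s0) (lerD T Y); rewrite S' => W.
  have H6 : 0 < h%:R ^- 6 :> F by rewrite invr_gt0.
  by move: W Z H6; set x := s * _; set y := _ * d / s; set z := _ ^- 6; lra.
have tV : (t <= #|'I_n|)%N by rewrite card_ord.
have [|S [z [Lb [U [hS mS U0 UR hU]]]]] := decode d0 HP tV b0 b_small tau0 s0 dp Nd r0 Nrt rg small
  edge_wt_ge0 edge_wtC edge_wt_total edge_sat_sym edge_sat_uniq _ tauB volR.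
  rewrite objective_local //; last by move: Nrt; clear; lia.
  by move: obj; lra.
exists S, z, Lb, U; split=> // v vU; have [pv cv] := hU v vU.
have t0 : (0 < t)%N by move: Nrt; clear; lia.
have HQ : local_dist (t - #|S|) (cond P S z).
  by apply: cond_local; rewrite ?gt_eqF // hS leq_pred.
have tS : (0 < t - #|S|)%N by rewrite hS; move: t0; clear; lia.
split=> [vS|vS|].
- apply: (prob_cond_agree (t := t) (P := P) (S := S)) => //.
  + by rewrite (setUidPr _) ?sub1set // hS leq_pred.
  + by apply: lt_trans pv.
- have row c : row_prob m S z v c = prob (cond P S z) v c * mass P S z.
    have cS : #|v |: S| = t by rewrite cardsU1 vS hS add1n prednK.
    rewrite /prob expect_cond -/(mass P S z) divfK ?gt_eqF //.
    by rewrite -mass_set_at ?(negPf vS) // mass_local //; apply: psd_axiom.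
  split=> [|a av]; first by rewrite row mulr_gt0 //; apply: lt_trans pv.
  rewrite !row ltr_pM2r //; apply: (lt_trans _ pv).
  have := sum_prob HQ v tS; rewrite (bigD1 a) //= (bigD1 (Lb v)) 1?eq_sym //=.
  have : 0 <= \sum_(i < q | (i != a) && (i != Lb v)) prob (cond P S z) v i.
    by apply: sumr_ge0 => c _; apply: (prob_ge0 HQ).
  by move: pv; set x := \sum_(_ < _ | _) _; lra.
- apply: le_trans cv; rewrite ler_wpM2r ?sumr_ge0 // => [u _|]; first exact: edge_wt_ge0.
  have -> : 2^-1 ^+ (2 * B ^ 2 + 8 * B + 4) = (2^-1 ^+ (2 * B + 8)) ^+ B * 2^-1 ^+ 4 :> F.
    by rewrite -exprM -exprD mulnDl -mulnA mulnn.
  rewrite bE e8.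
  rewrite (exprD _ (2 * B + 6) 2).
  have -> : 2^-1 ^+ 2 = 4^-1 :> F by field.
  by have -> : 2^-1 ^+ 4 = 16^-1 :> F by field.
Qed.

End Instances.

(** * A loop language compiled to the random access machine *)

Section LoopLanguage.
Local Open Scope nat_scope.

(* A bounded-loop language.  Variable 1 holds a bit length: products truncate
   their first factor to that length, so that evaluation time is bounded
   without knowing the sizes of the factors. *)
Inductive aexp :=
| Var of nat
| Cst of nat
| Add of aexp & aexp
| Sub of aexp & aexp
| Mul of aexp & aexp
| Arr of nat & aexp
| Inp of aexp.

Inductive stmt :=
| Skip
| Asg of nat & aexp
| Put of nat & aexp & aexp
| Out of aexp
| Sq of stmt & stmt
| Ite of aexp & stmt & stmt
| For of nat & nat & stmt.

Record lstate := LState { var : nat -> nat; arr : nat -> nat -> nat; out : seq nat }.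

Definition set_var x v st := LState (upd (var st) x v) (arr st) (out st).
Definition set_arr k i v st :=
  LState (var st) (fun k' => if k' == k then upd (arr st k) i v else arr st k') (out st).
Definition emit v st := LState (var st) (arr st) (rcons (out st) v).

Variable inp : seq nat.

Fixpoint eval e st :=
  match e with
  | Var x => var st x
  | Cst c => c
  | Add e1 e2 => eval e1 st + eval e2 st
  | Sub e1 e2 => eval e1 st - eval e2 st
  | Mul e1 e2 => (eval e1 st %% 2 ^ var st 1) * eval e2 st
  | Arr k e => arr st k (eval e st)
  | Inp e => nth 0 inp (eval e st)
  end.

Fixpoint run s st :=
  match s with
  | Skip => st
  | Asg x e => set_var x (eval e st) st
  | Put k e1 e2 => set_arr k (eval e1 st) (eval e2 st) st
  | Out e => emit (eval e st) st
  | Sq s1 s2 => run s2 (run s1 st)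
  | Ite e s1 s2 => if eval e st != 0 then run s1 st else run s2 st
  | For x y s => iteri (var st y) (fun i st' => run s (set_var x i st')) st
  end.

Definition reserved x := x < 3.

Fixpoint wf_exp e :=
  match e with
  | Var _ | Cst _ => true
  | Add e1 e2 | Sub e1 e2 | Mul e1 e2 => wf_exp e1 && wf_exp e2
  | Arr k e => (k < 8) && wf_exp e
  | Inp e => wf_exp e
  end.

(** Loop bounds are reserved variables, which no statement may assign, so the number of rounds of
    every loop is fixed by the input. Eight arrays are interleaved in memory, hence the bound on
    array indices. *)
Fixpoint wf_stmt s :=
  match s with
  | Skip => true
  | Asg x e => ~~ reserved x && wf_exp e
  | Put k e1 e2 => [&& k < 8, wf_exp e1 & wf_exp e2]
  | Out e => wf_exp e
  | Sq s1 s2 => wf_stmt s1 && wf_stmt s2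
  | Ite e s1 s2 => [&& wf_exp e, wf_stmt s1 & wf_stmt s2]
  | For x y s => [&& ~~ reserved x, reserved y & wf_stmt s]
  end.

Lemma run_reserved s st x : wf_stmt s -> reserved x -> var (run s st) x = var st x.
Proof.
move=> + rx; elim: s st => [|y e|k e1 e2|e|s1 IH1 s2 IH2|e s1 IH1 s2 IH2|y w s IH] st //=.
- by case/andP=> ry _; rewrite /upd; case: eqP ry => // <-; rewrite rx.
- by case/andP=> w1 w2; rewrite IH2 // IH1.
- by case/and3P=> _ w1 w2; case: ifP => _; [apply: IH1 | apply: IH2].
- case/and3P=> ry _ ws; elim: (var st w) => [|i IHi] //=.
  by rewrite IH //= /upd; case: eqP ry => // <-; rewrite rx.
Qed.

(* Variables live at addresses 4x, temporaries at 4d + 1, array cells at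
   4(8i + k) + 2, and address 3 always holds 0. *)
Definition tmp d := 4 * d + 1.

Definition index_code k d : program :=
  Seq (Do (IAdd (tmp d) (tmp d) (tmp d)))
  (Seq (Do (IAdd (tmp d) (tmp d) (tmp d)))
  (Seq (Do (IAdd (tmp d) (tmp d) (tmp d)))
  (Seq (Do (IConst (tmp d.+1) k))
  (Seq (Do (IAdd (tmp d) (tmp d) (tmp d.+1)))
  (Seq (Do (IAdd (tmp d) (tmp d) (tmp d)))
  (Seq (Do (IAdd (tmp d) (tmp d) (tmp d)))
  (Seq (Do (IConst (tmp d.+1) 2))
       (Do (IAdd (tmp d) (tmp d) (tmp d.+1)))))))))).

(** One round of binary multiplication. Parity is obtained as x - 2 * (x / 2), and adding address 3,
    which holds 0, copies a register. *)
Definition mul_body d : program :=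
  Seq (Do (IHalf (tmp d.+4) (tmp d)))
  (Seq (Do (IAdd (tmp d.+4.+1) (tmp d.+4) (tmp d.+4)))
  (Seq (Do (ISub (tmp d.+4.+1) (tmp d) (tmp d.+4.+1)))
  (Seq (If (tmp d.+4.+1) (Do (IAdd (tmp d.+2) (tmp d.+2) (tmp d.+1)))
                         (Do (IConst (tmp d.+4.+1) 0)))
  (Seq (Do (IAdd (tmp d) (tmp d.+4) 3))
  (Seq (Do (IAdd (tmp d.+1) (tmp d.+1) (tmp d.+1)))
  (Seq (Do (IConst (tmp d.+4.+1) 1))
       (Do (ISub (tmp d.+3) (tmp d.+3) (tmp d.+4.+1))))))))).

(** There are as many rounds as the bit length held in variable 1, at address 4; this is why only
    that many low bits of the first factor count. *)
Definition mul_code d : program :=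
  Seq (Do (IConst (tmp d.+2) 0))
  (Seq (Do (IAdd (tmp d.+3) 4 3))
  (Seq (While (tmp d.+3) (mul_body d))
       (Do (IAdd (tmp d) (tmp d.+2) 3)))).

Fixpoint comp_exp e d : program :=
  match e with
  | Var x => Do (IAdd (tmp d) (4 * x) 3)
  | Cst c => Do (IConst (tmp d) c)
  | Add e1 e2 =>
      Seq (comp_exp e1 d) (Seq (comp_exp e2 d.+1) (Do (IAdd (tmp d) (tmp d) (tmp d.+1))))
  | Sub e1 e2 =>
      Seq (comp_exp e1 d) (Seq (comp_exp e2 d.+1) (Do (ISub (tmp d) (tmp d) (tmp d.+1))))
  | Mul e1 e2 => Seq (comp_exp e1 d) (Seq (comp_exp e2 d.+1) (mul_code d))
  | Arr k e => Seq (comp_exp e d) (Seq (index_code k d) (Do (ILoad (tmp d) (tmp d))))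
  | Inp e => Seq (comp_exp e d) (Do (IRead (tmp d) (tmp d)))
  end.

Definition for_body (x d : nat) (p : program) : program :=
  Seq (Do (IAdd (4 * x) (tmp d.+1) 3))
  (Seq p
  (Seq (Do (IConst (tmp d.+2) 1))
  (Seq (Do (IAdd (tmp d.+1) (tmp d.+1) (tmp d.+2)))
       (Do (ISub (tmp d) (tmp d) (tmp d.+2)))))).

Fixpoint comp_stmt s d : program :=
  match s with
  | Skip => Do (IConst (tmp d) 0)
  | Asg x e => Seq (comp_exp e d) (Do (IAdd (4 * x) (tmp d) 3))
  | Put k e1 e2 =>
      Seq (comp_exp e1 d) (Seq (index_code k d)
        (Seq (comp_exp e2 d.+1) (Do (IStore (tmp d) (tmp d.+1)))))
  | Out e => Seq (comp_exp e d) (Do (IWrite (tmp d)))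
  | Sq s1 s2 => Seq (comp_stmt s1 d) (comp_stmt s2 d)
  | Ite e s1 s2 => Seq (comp_exp e d) (If (tmp d) (comp_stmt s1 d) (comp_stmt s2 d))
  | For x y s =>
      Seq (Do (IAdd (tmp d) (4 * y) 3)) (Seq (Do (IConst (tmp d.+1) 0))
        (While (tmp d) (for_body x d (comp_stmt s d.+2))))
  end.

(* Time bounds, when the reserved variables are at most [Z]. *)
Fixpoint exp_time e Z :=
  match e with
  | Var _ | Cst _ => 1
  | Add e1 e2 | Sub e1 e2 => exp_time e1 Z + exp_time e2 Z + 1
  | Mul e1 e2 => exp_time e1 Z + exp_time e2 Z + (11 * Z + 4)
  | Arr _ e => exp_time e Z + 10
  | Inp e => exp_time e Z + 1
  end.

Fixpoint stmt_time s Z :=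
  match s with
  | Skip => 1
  | Asg _ e | Out e => exp_time e Z + 1
  | Put _ e1 e2 => exp_time e1 Z + exp_time e2 Z + 10
  | Sq s1 s2 => stmt_time s1 Z + stmt_time s2 Z
  | Ite e s1 s2 => exp_time e Z + (stmt_time s1 Z + stmt_time s2 Z + 1)
  | For _ _ s => Z * (stmt_time s Z + 5) + 3
  end.

Definition runs p m o T (Q : (nat -> nat) -> Prop) o' :=
  exists T' m', [/\ exec inp p (m, o) T' (m', o'), T' <= T & Q m'].

Lemma runs_do c m o (Q : (nat -> nat) -> Prop) m' o' :
  step inp (m, o) c = (m', o') -> Q m' -> runs (Do c) m o 1 Q o'.
Proof. by move=> e q; exists 1, m'; rewrite -e; split=> //; apply: exec_do. Qed.

Lemma runs_seq p1 p2 m o o1 o2 T1 T2 Q1 (Q : (nat -> nat) -> Prop) :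
  runs p1 m o T1 Q1 o1 -> (forall m1, Q1 m1 -> runs p2 m1 o1 T2 Q o2) ->
  runs (Seq p1 p2) m o (T1 + T2) Q o2.
Proof.
case=> [t1 [m1 [h1 h2 h3]]] /(_ m1 h3)[t2 [m2 [k1 k2 k3]]].
by exists (t1 + t2), m2; split=> //; [apply: exec_seq h1 k1 | rewrite leq_add].
Qed.

Lemma runs_seq_do c p m o m1 o1 o2 T (Q : (nat -> nat) -> Prop) :
  step inp (m, o) c = (m1, o1) -> runs p m1 o1 T Q o2 ->
  runs (Seq (Do c) p) m o T.+1 Q o2.
Proof.
move=> e h; rewrite -add1n.
by apply: (runs_seq (Q1 := fun m => m = m1) (o1 := o1)) => [|_ ->] //; apply: (runs_do e).
Qed.

Lemma runs_weaken p m o T T' (Q Q' : (nat -> nat) -> Prop) o' : T <= T' ->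
  (forall m, Q m -> Q' m) -> runs p m o T Q o' -> runs p m o T' Q' o'.
Proof.
move=> tt qq [t [m1 [h1 h2 h3]]]; exists t, m1; split=> //; last exact: qq.
exact: leq_trans tt.
Qed.

Lemma runs_if r p1 p2 m o T1 T2 (Q : (nat -> nat) -> Prop) o' :
  (m r != 0 -> runs p1 m o T1 Q o') -> (m r = 0 -> runs p2 m o T2 Q o') ->
  runs (If r p1 p2) m o (T1 + T2 + 1) Q o'.
Proof.
move=> h1 h2; case: (eqVneq (m r) 0) => [e|e].
  have [t [m1 [k1 k2 k3]]] := h2 e; exists t.+1, m1; split=> //; last by lia.
  exact: exec_if_false.
have [t [m1 [k1 k2 k3]]] := h1 e; exists t.+1, m1; split=> //; last by lia.
exact: exec_if_true.
Qed.

Lemma runs_while r p k (I : nat -> (nat -> nat) -> Prop) (o : nat -> seq nat) m T :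
  (forall i m, I i m -> m r = k - i) ->
  (forall i m, i < k -> I i m -> runs p m (o i) T (I i.+1) (o i.+1)) ->
  I 0 m -> runs (While r p) m (o 0) (k * T.+1 + 1) (I k) (o k).
Proof.
move=> hr hp; suff H j i m' : i + j = k -> I i m' ->
    runs (While r p) m' (o i) (j * T.+1 + 1) (I k) (o k) by move=> h0; apply: H.
elim: j i m' => [|j IH] i m' ij Ii.
  rewrite addn0 in ij; rewrite -ij; exists 1, m'; split=> //.
  by apply: exec_while_false; rewrite /= (hr _ _ Ii) ij subnn.
have ik : i < k by lia.
have [t1 [m1 [h1 h2 h3]]] := hp i m' ik Ii.
have [|t2 [m2 [k1 k2 k3]]] := IH i.+1 m1 _ h3; first by lia.
exists (t1 + t2).+1, m2; split=> //.
  by apply: exec_while_true h1 k1; rewrite /= (hr _ _ Ii); lia.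
by rewrite mulSn; lia.
Qed.

Lemma upd_eq m r v k : k = r -> upd m r v k = v.
Proof. by move=> ->; rewrite /upd eqxx. Qed.

Lemma upd_ne m r v k : k <> r -> upd m r v k = m k.
Proof. by rewrite /upd => /eqP/negPf->. Qed.

Ltac look := repeat match goal with |- context [upd ?m ?r ?v ?k] =>
  first [rewrite (@upd_eq m r v k); [|rewrite /tmp; clear; lia]
        |rewrite (@upd_ne m r v k); [|rewrite /tmp; first [clear; lia | lia]]] end.

(** Compiled expressions write only temporaries, the addresses equal to 1 modulo 4, and among them
    only those of depth at least [d]. *)
Definition keep d (m m' : nat -> nat) := forall a, (a %% 4 != 1) || (a < 4 * d) -> m' a = m a.

Lemma index_runs k d m o : runs (index_code k d) m o 9
  (fun m' => keep d m m' /\ m' (tmp d) = 4 * (8 * m (tmp d) + k) + 2) o.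
Proof.
rewrite /index_code.
do 8!(apply: runs_seq_do; first reflexivity).
apply: runs_do; first reflexivity.
split; first by move=> a ha; look.
by look; lia.
Qed.

Lemma mul_runs d m o : m 3 = 0 -> runs (mul_code d) m o (11 * m 4 + 4)
  (fun m' => keep d m m' /\
     m' (tmp d) = (m (tmp d) %% 2 ^ m 4) * m (tmp d.+1)) o.
Proof.
move=> m3; pose x := m (tmp d); pose y := m (tmp d.+1); pose k := m 4.
pose I i m' := [/\ keep d m m', m' (tmp d) = x %/ 2 ^ i, m' (tmp d.+1) = y * 2 ^ i,
  m' (tmp d.+2) = (x %% 2 ^ i) * y & m' (tmp d.+3) = k - i].
rewrite (_ : 11 * m 4 + 4 = (k * 10.+1 + 1 + 1).+2); last by rewrite /k; lia.
do 2!(apply: runs_seq_do; first reflexivity).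
apply: (runs_seq (Q1 := I k)); last first.
  move=> m' [h1 h2 h3 h4 h5]; apply: runs_do; first reflexivity.
  split; first by move=> a ha; look; apply: h1.
  look; rewrite h4 (h1 3) ?m3 ?addn0 //.
apply: (runs_while (I := I) (o := fun=> o)) => [i m' [] //|i m' ik [h1 h2 h3 h4 h5]|]; last first.
  split; first by move=> a ha; look.
  - by look; rewrite expn0 divn1.
  - by look; rewrite expn0 muln1.
  - by look; rewrite expn0 modn1.
  - by look; rewrite m3 addn0 subn0.
have m'3 : m' 3 = 0 by rewrite h1.
have hodd : x %/ 2 ^ i = odd (x %/ 2 ^ i) + (x %/ 2 ^ i)./2 * 2.
  by rewrite muln2 odd_double_half.
have hmod : x %% 2 ^ i.+1 = odd (x %/ 2 ^ i) * 2 ^ i + x %% 2 ^ i.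
  have e1 := divn_eq x (2 ^ i); have e2 := divn_eq x (2 ^ i.+1).
  have e3 : x %/ 2 ^ i.+1 = (x %/ 2 ^ i)./2 by rewrite expnSr divnMA divn2.
  have e4 : x %/ 2 ^ i * 2 ^ i = odd (x %/ 2 ^ i) * 2 ^ i + (x %/ 2 ^ i)./2 * 2 ^ i.+1.
    by rewrite {1}hodd mulnDl expnS mulnA.
  by rewrite e3 in e2; lia.
do 3!(apply: runs_seq_do; first reflexivity).
rewrite (_ : 7 = (1 + 1 + 1) + 4) //; apply: (runs_seq (Q1 := fun m1 =>
    [/\ keep d m m1, m1 (tmp d.+4) = (x %/ 2 ^ i)./2, m1 (tmp d.+1) = y * 2 ^ i,
      m1 (tmp d.+2) = (x %% 2 ^ i.+1) * y & m1 (tmp d.+3) = k - i])).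
  apply: runs_if => [|].
    look; rewrite h2 => odd1; apply: runs_do; first reflexivity.
    split; first by move=> a ha; look; apply: h1.
    - by look; rewrite ?h2.
    - by look; rewrite h3.
    - look; rewrite h3 h4 hmod; move: odd1; rewrite {1}hodd.
      by case: (odd _); rewrite ?mul1n ?mul0n; [lia | rewrite add0n muln2 addnn subnn].
    - by look; rewrite h5.
  look; rewrite h2 => odd1; apply: runs_do; first reflexivity.
  split; first by move=> a ha; look; apply: h1.
  - by look; rewrite ?h2.
  - by look; rewrite h3.
  - look; rewrite h4 hmod; move: odd1; rewrite {1}hodd.
    by case: (odd _); rewrite ?mul0n ?add0n //; lia.
  - by look; rewrite h5.
move=> m1 [k1 k2 k3 k4 k5].
have m13 : m1 3 = 0 by rewrite k1.
do 3!(apply: runs_seq_do; first reflexivity).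
apply: runs_do; first reflexivity.
split; first by move=> a ha; look; apply: k1.
- by look; rewrite k2 m13 addn0 expnSr divnMA divn2.
- by look; rewrite k3 expnS; lia.
- by look.
- by look; rewrite k5; lia.
Qed.

Definition rep (m : nat -> nat) st :=
  [/\ m 3 = 0, forall x, m (4 * x) = var st x &
      forall k i, k < 8 -> m (4 * (8 * i + k) + 2) = arr st k i].

Lemma rep_keep d m m' st : keep d m m' -> rep m st -> rep m' st.
Proof.
move=> hk [h1 h2 h3]; split=> [|x|k i k8]; rewrite hk ?h1 ?h2 ?h3 //; apply/orP; left; lia.
Qed.

Lemma keep_trans d m1 m2 m3 : keep d m1 m2 -> keep d.+1 m2 m3 -> keep d m1 m3.
Proof. by move=> h1 h2 a ha; rewrite h2 ?h1 //; move: ha; clear; lia. Qed.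

Lemma keep_trans0 d m1 m2 m3 : keep d m1 m2 -> keep d m2 m3 -> keep d m1 m3.
Proof. by move=> h1 h2 a ha; rewrite h2 ?h1. Qed.

(** Only products take a time that depends on the state, through the bit length in variable 1; hence
    a bound on that variable alone. *)
Lemma exp_runs e d m st o Z : wf_exp e -> rep m st -> var st 1 <= Z ->
  runs (comp_exp e d) m o (exp_time e Z)
    (fun m' => keep d m m' /\ m' (tmp d) = eval e st) o.
Proof.
move=> + + hZ; elim: e d m => [x|c|e1 IH1 e2 IH2|e1 IH1 e2 IH2|e1 IH1 e2 IH2|k e IH|e IH] d m /=.
- move=> _ [h1 h2 h3]; apply: runs_do; first reflexivity.
  by split=> [a ha|]; look; rewrite // h2 h1 addn0.
- by move=> _ _; apply: runs_do; first reflexivity; split=> [a ha|]; look.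
- case/andP=> w1 w2 hr; rewrite -addnA; apply: (runs_seq (IH1 d m w1 hr)) => m1 [k1 e1E].
  apply: (runs_seq (IH2 d.+1 m1 w2 (rep_keep k1 hr))) => m2 [k2 e2E].
  apply: runs_do; first reflexivity.
  split=> [a ha|]; look; first exact: (keep_trans k1 k2).
  by rewrite e2E k2 ?e1E // /tmp; clear; lia.
- case/andP=> w1 w2 hr; rewrite -addnA; apply: (runs_seq (IH1 d m w1 hr)) => m1 [k1 e1E].
  apply: (runs_seq (IH2 d.+1 m1 w2 (rep_keep k1 hr))) => m2 [k2 e2E].
  apply: runs_do; first reflexivity.
  split=> [a ha|]; look; first exact: (keep_trans k1 k2).
  by rewrite e2E k2 ?e1E // /tmp; clear; lia.
- case/andP=> w1 w2 hr; rewrite -addnA; apply: (runs_seq (IH1 d m w1 hr)) => m1 [k1 e1E].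
  apply: (runs_seq (IH2 d.+1 m1 w2 (rep_keep k1 hr))) => m2 [k2 e2E].
  have [m23 m2v _] := rep_keep (keep_trans k1 k2) hr.
  have m24 : m2 4 = var st 1 by rewrite -(m2v 1).
  apply: (runs_weaken _ _ (mul_runs d o m23)) => [|m3 [k3 e3E]].
    by rewrite m24 leq_add2r leq_mul2l.
  split; first exact: (keep_trans0 (keep_trans k1 k2) k3).
  by rewrite e3E m24 e2E k2 ?e1E // /tmp; clear; lia.
- case/andP=> k8 w hr; apply: (runs_seq (IH d m w hr)) => m1 [k1 eE].
  rewrite -[10]/(9 + 1); apply: (runs_seq (index_runs k d m1 o)) => m2 [k2 iE].
  apply: runs_do; first reflexivity.
  have [_ _ h3] := rep_keep (keep_trans0 k1 k2) hr.
  split=> [a ha|]; look; first exact: (keep_trans0 k1 k2).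
  by rewrite iE eE h3.
- move=> w hr; apply: (runs_seq (IH d m w hr)) => m1 [k1 eE].
  apply: runs_do; first reflexivity.
  by split=> [a ha|]; look; [exact: k1 | rewrite eE].
Qed.

Definition low d (m m' : nat -> nat) := forall e, e < d -> m' (tmp e) = m (tmp e).

Lemma keep_low d m m' : keep d m m' -> low d m m'.
Proof. by move=> hk e he; apply: hk; rewrite /tmp; move: he; clear; lia. Qed.

Lemma stmt_runs s d m st Z : wf_stmt s -> rep m st ->
  (forall x, reserved x -> var st x <= Z) ->
  runs (comp_stmt s d) m (out st) (stmt_time s Z)
    (fun m' => rep m' (run s st) /\ low d m m') (out (run s st)).
Proof.
elim: s d m st => [|x e|k e1 e2|e|s1 IH1 s2 IH2|e s1 IH1 s2 IH2|x y s IH] d m st /=.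
- move=> _ hr _; apply: runs_do; first reflexivity.
  have hk : keep d m (upd m (tmp d) 0) by move=> a ha; look.
  by split; [apply: (rep_keep hk hr) | apply: (keep_low hk)].
- case/andP=> rx w hr hZ; apply: (runs_seq (exp_runs d (out st) w hr (hZ 1 isT))) => m1 [k1 eE].
  have [h1 h2 h3] := rep_keep k1 hr.
  apply: runs_do; first reflexivity; split; last first.
    by move=> f hf; look; apply: keep_low hf.
  split=> [|x'|k i k8] /=; look; rewrite ?h3 //.
  rewrite h1 eE addn0 /upd; case: (x' =P x) => [->|ne]; first by rewrite eqxx.
  by case: eqP => [|_]; [lia | rewrite -h2].
- case/and3P=> k8 w1 w2 hr hZ; rewrite -addnA.
  apply: (@runs_weaken _ _ _ (exp_time e1 Z + (9 + (exp_time e2 Z + 1))) _ _ _ _ _ (fun _ h => h)).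
    by rewrite leq_add2l; lia.
  apply: (runs_seq (exp_runs d (out st) w1 hr (hZ 1 isT))) => m1 [k1 e1E].
  apply: (runs_seq (index_runs k d m1 (out st))) => m2 [k2 iE].
  have hr2 := rep_keep (keep_trans0 k1 k2) hr.
  apply: (runs_seq (exp_runs d.+1 (out st) w2 hr2 (hZ 1 isT))) => m3 [k3 e2E].
  have [h1 h2 h3] := rep_keep k3 hr2.
  have aE : m3 (tmp d) = 4 * (8 * eval e1 st + k) + 2.
    by rewrite k3 ?iE ?e1E // /tmp; clear; lia.
  apply: runs_do; first reflexivity; split; last first.
    move=> f hf; rewrite /= aE; look.
    by apply: (keep_low (keep_trans (keep_trans0 k1 k2) k3)).
  split=> [|x'|k' i k'8] /=; rewrite aE e2E; look; rewrite ?h1 ?h2 //.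
  rewrite /upd; case: (k' =P k) => [->|kk].
    case: (i =P eval e1 st) => [->|ie]; first by rewrite eqxx.
    by case: eqP => [|_]; [lia | apply: h3].
  by case: eqP => [|_]; [lia | apply: h3].
- move=> w hr hZ; apply: (runs_seq (exp_runs d (out st) w hr (hZ 1 isT))) => m1 [k1 eE].
  apply: runs_do; first by rewrite /= eE.
  by split; [apply: (rep_keep k1 hr) | apply: (keep_low k1)].
- case/andP=> w1 w2 hr hZ; apply: (runs_seq (IH1 d m st w1 hr hZ)) => m1 [hr1 lo1].
  apply: (runs_weaken (leqnn _) _ (IH2 d m1 _ w2 hr1 _)) => [m2 [hr2 lo2]|x rx].
    by split=> // e he; rewrite lo2 // lo1.
  by rewrite run_reserved // hZ.
- case/and3P=> w w1 w2 hr hZ; apply: (runs_seq (exp_runs d (out st) w hr (hZ 1 isT))) => m1 [k1 eE].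
  have hr1 := rep_keep k1 hr; have lo1 := keep_low k1.
  have comb m2 st' : rep m2 st' /\ low d m1 m2 -> rep m2 st' /\ low d m m2.
    by case=> hr2 lo2; split=> // f hf; rewrite lo2 // lo1.
  apply: runs_if; rewrite eE => c0.
    by rewrite c0; apply: runs_weaken (leqnn _) _ (IH1 d m1 st w1 hr1 hZ) => m2; apply: comb.
  by rewrite c0 eqxx /=; apply: runs_weaken (leqnn _) _ (IH2 d m1 st w2 hr1 hZ) => m2; apply: comb.
- case/and3P=> rx ry ws hr hZ; have [h1 h2 h3] := hr.
  set k := var st y; pose stt i := iteri i (fun i st' => run s (set_var x i st')) st.
  have sttr i z : reserved z -> var (stt i) z = var st z.
    move=> rz; elim: i => [|i IHi] //=; rewrite run_reserved //= /upd.
    by case: eqP rx => // <-; rewrite rz.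
  pose I i m' := [/\ rep m' (stt i), low d m m', m' (tmp d) = k - i & m' (tmp d.+1) = i].
  apply: (@runs_weaken _ _ _ (k * (stmt_time s Z + 4).+1 + 1).+2 _ (I k) _ _).
  - by have := leq_mul (hZ y ry) (leqnn (stmt_time s Z + 5)); rewrite -/k; lia.
  - by move=> m' [].
  do 2!(apply: runs_seq_do; first reflexivity).
  apply: (runs_while (I := I) (o := fun i => out (stt i))) => [i m' []//|i m' ik [g1 g2 g3 g4]|];
    last first.
    split; last by look.
    - by split=> [|z|z i z8]; look; rewrite ?h1 ?h2 ?h3.
    - by move=> f hf; look.
    - by look; rewrite h2 h1 addn0 subn0.
  have [r1 r2 r3] := g1.
  rewrite [stmt_time s Z + 4]addnS; apply: runs_seq_do; first reflexivity.
  apply: (runs_seq (IH d.+2 _ (set_var x i (stt i)) ws _ _)) => [|z rz|m1 [q1 q2]].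
  + split=> [|z|z j z8] /=; look; rewrite ?r3 //.
    rewrite g4 r1 addn0 /upd; case: (z =P x) => [->|ne]; first by rewrite eqxx.
    by case: eqP => [|_]; [lia | rewrite -r2].
  + rewrite /= /upd; case: eqP rx => [<-|_ _]; first by rewrite rz.
    by rewrite sttr // hZ.
  have [p1 p2 p3] := q1.
  do 2!(apply: runs_seq_do; first reflexivity).
  apply: runs_do; first reflexivity.
  have d0 : m1 (tmp d) = k - i by rewrite q2 //; look.
  have d1 : m1 (tmp d.+1) = i by rewrite q2 //; look.
  split.
  + by split=> [|z|z j z8]; look; rewrite ?p1 ?p2 ?p3.
  + move=> f hf; look; rewrite q2 ?ltnS 1?ltnW //; last by rewrite ltnW.
    by look; apply: g2.
  + by look; rewrite d0; lia.
  + by look; rewrite d1; lia.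
Qed.


(** The number of halvings that reach 0, hence 0 at 0, unlike the length used in [bitsize]. *)
Definition nbits x := if x == 0 then 0 else (trunc_log 2 x).+1.
Definition total_bits := \sum_(x <- inp) nbits x.

Lemma nbits_half x : x != 0 -> nbits x = (nbits x./2).+1.
Proof.
rewrite /nbits => x0; rewrite (negPf x0); congr _.+1.
case: (ltngtP x 1) => [|x1|->]; [by lia| |by rewrite trunc_log1].
rewrite trunc_log2S // ifF //; apply/negbTE; rewrite -lt0n half_gt0 //.
Qed.

Lemma nbits_ltn x : x < 2 ^ nbits x.
Proof. by rewrite /nbits; case: eqP => [->|_] //; apply: trunc_log_ltn. Qed.

(** This is what makes products exact: a first factor read from the input is never truncated. *)
Lemma input_lt i : nth 0 inp i < 2 ^ total_bits.
Proof.
case: (ltnP i (size inp)) => hi; last by rewrite nth_default // expn_gt0.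
apply: leq_trans (nbits_ltn _) _; rewrite leq_exp2l // /total_bits.
by rewrite (big_nth 0) big_mkord (bigD1 (Ordinal hi)) //= leq_addr.
Qed.

Lemma total_bits_le : total_bits <= bitsize inp.
Proof. by apply: leq_sum => x _; rewrite /nbits; case: eqP. Qed.

Lemma size_le_bitsize : size inp <= bitsize inp.
Proof. by rewrite -sum1_size; apply: leq_sum => x _. Qed.

(** Addresses 4 and 8, those of variables 1 and 2, receive the bit length and the first input
    number; variable 0 is the input length, already in place. The scratch registers 1, 5, 9 and 13
    are temporaries, so their final contents do not matter. *)
Definition prologue : program :=
  Seq (Do (IConst 13 1)) (Seq (Do (IAdd 5 0 3))
  (Seq (While 5
     (Seq (Do (IRead 9 1))
     (Seq (While 9 (Seq (Do (IAdd 4 4 13)) (Do (IHalf 9 9))))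
     (Seq (Do (IAdd 1 1 13)) (Do (ISub 5 5 13))))))
  (Seq (Do (IConst 9 0)) (Do (IRead 8 9))))).

Definition start : lstate :=
  LState (fun x => nth 0 [:: size inp; total_bits; nth 0 inp 0] x) (fun _ _ => 0) [::].

Lemma bits_loop_runs m o : m 13 = 1 ->
  runs (While 9 (Seq (Do (IAdd 4 4 13)) (Do (IHalf 9 9)))) m o (3 * nbits (m 9) + 1)
    (fun m' => m' 4 = m 4 + nbits (m 9) /\ forall a, a != 4 -> a != 9 -> m' a = m a) o.
Proof.
move: {2}(nbits (m 9)) (erefl (nbits (m 9))) => k; elim: k m => [|k IH] m hk m13.
  have m9 : m 9 = 0 by move: hk; rewrite /nbits; case: eqP.
  exists 1, m; rewrite m9; split=> //; last by rewrite addn0.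
  exact: exec_while_false.
have m9 : m 9 != 0 by move: hk; rewrite /nbits; case: eqP.
pose m1 := upd (upd m 4 (m 4 + m 13)) 9 (m 9)./2.
have h9 : m1 9 = (m 9)./2 by [].
have hb := nbits_half m9.
have [||T [m' [e1 e2 [e3 e4]]]] := IH m1; rewrite ?h9 //; first by lia.
exists (1 + 1 + T).+1, m'; split.
- apply: (exec_while_true (s2 := (m1, o))) e1 => //.
  by apply: (exec_seq (s2 := (upd m 4 (m 4 + m 13), o))); apply: exec_do.
- by rewrite h9 in e2; lia.
split=> [|a a4 a9].
  by rewrite e3 h9 hb [m1 4]/(m 4 + m 13) m13; lia.
by rewrite e4 // /m1 !upd_ne //; apply/eqP.
Qed.

Lemma prologue_runs :
  runs prologue (upd (fun=> 0) 0 (size inp)) [::]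
    (size inp * (3 * total_bits + 5) + 5) (fun m => rep m start) [::].
Proof.
pose bits i := \sum_(j < i) nbits (nth 0 inp j).
have bitsS i : bits i.+1 = bits i + nbits (nth 0 inp i) by rewrite /bits big_ord_recr.
have bitsN : bits (size inp) = total_bits by rewrite /bits /total_bits (big_nth 0) big_mkord.
pose I i (m : nat -> nat) := [/\ m 13 = 1, m 5 = size inp - i, m 1 = i, m 4 = bits i &
  forall a, a \notin [:: 1; 4; 5; 9; 13] -> m a = upd (fun=> 0) 0 (size inp) a].
rewrite (_ : _ + 5 = ((size inp * (3 * total_bits + 4).+1 + 1) + 2).+2); last by lia.
do 2!(apply: runs_seq_do; first reflexivity).
apply: (runs_seq (Q1 := I (size inp)) (o1 := [::])) => [|m [h1 h2 h3 h4 h5]]; last first.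
  apply: runs_seq_do; first reflexivity.
  apply: runs_do; first reflexivity.
  split=> [|x|k i k8].
  - by rewrite upd_ne // upd_ne // h5.
  - case: x => [|[|[|x]]].
    + by rewrite upd_ne // upd_ne // h5.
    + by rewrite upd_ne // upd_ne // h4 bitsN.
    + by rewrite upd_eq // upd_eq.
    rewrite !upd_ne; [|lia|lia]; rewrite h5; last by rewrite !inE; lia.
    by rewrite upd_ne /= ?nth_nil //; lia.
  - rewrite !upd_ne; [|lia|lia]; rewrite h5; last by rewrite !inE; lia.
    by rewrite upd_ne //; lia.
apply: (runs_while (I := I) (o := fun=> [::])) => [i m []//|i m iN [h1 h2 h3 h4 h5]|]; last first.
  split=> //; [by rewrite /= addn0 subn0 | by rewrite /bits big_ord0 |].
  move=> a; rewrite !inE !negb_or => /and5P[a1 a4 a5 a9 a13].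
  by rewrite upd_ne; [rewrite upd_ne //; apply/eqP | apply/eqP].
have nb : nbits (nth 0 inp i) <= total_bits.
  by rewrite -bitsN /bits (bigD1 (Ordinal iN)) //= leq_addr.
apply: (@runs_weaken _ _ _ ((3 * nbits (nth 0 inp i) + 1 + 2).+1) _ (I i.+1) _ _ _ (fun _ h => h)).
  by lia.
apply: runs_seq_do; first reflexivity.
set m0 := upd _ _ _; have m09 : m0 9 = nth 0 inp i by rewrite /m0 upd_eq //= h3.
rewrite -m09; apply: (runs_seq (bits_loop_runs _ _)) => [//|m1 [e1 e2]].
apply: runs_seq_do; first reflexivity.
apply: runs_do; first reflexivity.
have m14 : m1 4 = bits i.+1 by rewrite e1 m09 bitsS -h4.
have m113 : m1 13 = 1 by rewrite e2.
have m11 : m1 1 = i by rewrite e2.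
have m15 : m1 5 = size inp - i by rewrite e2.
split.
- by rewrite !upd_ne.
- by rewrite upd_eq // !upd_ne // m15 m113; lia.
- by rewrite upd_ne // upd_eq // m11 m113 addn1.
- by rewrite !upd_ne.
- move=> a ha; have := ha; rewrite !inE !negb_or => /and5P[a1 a4 a5 a9 a13].
  rewrite upd_ne; last exact/eqP.
  rewrite upd_ne; last exact/eqP.
  by rewrite e2 // /m0 upd_ne ?h5 //; apply/eqP.
Qed.

Definition compile s := Seq prologue (comp_stmt s 0).

Lemma compile_computes s Z : wf_stmt s -> bitsize inp <= Z -> nth 0 inp 0 <= Z ->
  exists T, computes_in (compile s) inp T (out (run s start)) /\
    T <= Z * (3 * Z + 5) + 5 + stmt_time s Z.
Proof.
move=> ws hZ h0.
have h m : rep m start ->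
    runs (comp_stmt s 0) m [::] (stmt_time s Z) (fun=> True) (out (run s start)).
  move=> hm; apply: (runs_weaken (leqnn _) _ (stmt_runs 0 ws hm _)) => // x.
  case: x => [|[|[|]]] //= _; first exact: leq_trans size_le_bitsize hZ.
  exact: leq_trans total_bits_le hZ.
have [T [m [e1 e2 _]]] := runs_seq prologue_runs h.
exists T; split; first by exists m.
apply: leq_trans e2 _; rewrite leq_add2r leq_add2r leq_mul //.
  exact: leq_trans size_le_bitsize hZ.
by rewrite leq_add2r leq_mul2l (leq_trans total_bits_le hZ).
Qed.

End LoopLanguage.

(** * Polynomial time bounds *)

Section PolynomialTime.
Local Open Scope nat_scope.

Definition poly_bounded (f : nat -> nat) := exists k, forall Z, f Z <= k * Z.+1 ^ k.

Lemma poly_cst c : poly_bounded (fun=> c).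
Proof. by exists c => Z; rewrite leq_pmulr // expn_gt0. Qed.

Lemma poly_id : poly_bounded id.
Proof. by exists 1 => Z; rewrite mul1n expn1. Qed.

Lemma poly_add f g : poly_bounded f -> poly_bounded g -> poly_bounded (fun Z => f Z + g Z).
Proof.
move=> [k hk] [l hl]; exists (k + l) => Z; rewrite mulnDl leq_add //.
  by apply: leq_trans (hk Z) _; rewrite leq_mul2l leq_pexp2l ?leq_addr ?orbT.
by apply: leq_trans (hl Z) _; rewrite leq_mul2l leq_pexp2l ?leq_addl ?orbT.
Qed.

Lemma poly_mul f g : poly_bounded f -> poly_bounded g -> poly_bounded (fun Z => f Z * g Z).
Proof.
move=> [k hk] [l hl]; exists (k + l + k * l) => Z.
apply: leq_trans (leq_mul (hk Z) (hl Z)) _; rewrite mulnACA -expnD leq_mul ?leq_addl //.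
by rewrite leq_pexp2l // leq_addr.
Qed.

Lemma exp_time_poly e : poly_bounded (exp_time e).
Proof.
by elim: e => [x|c|e1 IH1 e2 IH2|e1 IH1 e2 IH2|e1 IH1 e2 IH2|k e IH|e IH] /=;
  repeat first [exact: poly_cst | exact: poly_id | assumption | apply: poly_add | apply: poly_mul].
Qed.

Lemma stmt_time_poly s : poly_bounded (stmt_time s).
Proof.
have H := exp_time_poly.
by elim: s => [|x e|k e1 e2|e|s1 IH1 s2 IH2|e s1 IH1 s2 IH2|x y s IH] /=;
  repeat first [exact: poly_cst | exact: poly_id | exact: H | assumption | apply: poly_add | apply: poly_mul].
Qed.

(** Loop bounds are the input length, the bit length and the first input number; once the last is
    bounded by the input size, nested loops take polynomial time. *)
Lemma compile_polytime (D : seq nat -> Prop) s : wf_stmt s ->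
  (forall inp, D inp -> nth 0 inp 0 <= bitsize inp) -> polytime_on D (compile s).
Proof.
move=> ws hD.
have [k hk] : poly_bounded (fun Z => Z * (3 * Z + 5) + 5 + stmt_time s Z).
  have H := stmt_time_poly s.
  by repeat first [exact: poly_cst | exact: poly_id | exact: H | apply: poly_add | apply: poly_mul].
exists k => inp /hD h0.
have [T [h1 h2]] := compile_computes ws (leqnn _) h0.
by exists T, (out (run inp s (start inp))); split=> //; apply: leq_trans h2 (hk _).
Qed.

End PolynomialTime.

(** * The rounding program *)

Section ProgramFrames.
Local Open Scope nat_scope.
Variable inp : seq nat.

Fixpoint modv s : seq nat :=
  match s with
  | Skip | Put _ _ _ | Out _ => [::]
  | Asg x _ => [:: x]
  | Sq s1 s2 | Ite _ s1 s2 => modv s1 ++ modv s2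
  | For x _ s => x :: modv s
  end.

Fixpoint moda s : seq nat :=
  match s with
  | Skip | Asg _ _ | Out _ => [::]
  | Put k _ _ => [:: k]
  | Sq s1 s2 | Ite _ s1 s2 => moda s1 ++ moda s2
  | For _ _ s => moda s
  end.

Fixpoint quiet s : bool :=
  match s with
  | Skip | Asg _ _ | Put _ _ _ => true
  | Out _ => false
  | Sq s1 s2 | Ite _ s1 s2 => quiet s1 && quiet s2
  | For _ _ s => quiet s
  end.

Definition frame (xs ks : seq nat) st st' :=
  (forall x, x \notin xs -> var st' x = var st x) /\
  (forall k, k \notin ks -> arr st' k = arr st k).

Lemma run_frame s st : frame (modv s) (moda s) st (run inp s st).
Proof.
elim: s st => [|y e|k e1 e2|e|s1 IH1 s2 IH2|e s1 IH1 s2 IH2|y w s IH] st //=.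
- by split=> // x; rewrite inE => /negPf h; rewrite /= /upd h.
- by split=> // k'; rewrite inE => /negPf h; rewrite /= h.
- have [v1 a1] := IH1 st; have [v2 a2] := IH2 (run inp s1 st).
  by split=> [x|k]; rewrite mem_cat negb_or => /andP[h1 h2]; rewrite ?v2 ?v1 ?a2 ?a1.
- have [v1 a1] := IH1 st; have [v2 a2] := IH2 st.
  by split=> [x|k]; rewrite mem_cat negb_or => /andP[h1 h2]; case: ifP => _;
    rewrite ?v2 ?v1 ?a2 ?a1.
- elim: (var st w) => [|i [v1 a1]] //=.
  have [v2 a2] := IH (set_var y i (iteri i (fun i st' => run inp s (set_var y i st')) st)).
  split=> [x|k] h; last by rewrite a2 //= a1.
  by move: (h); rewrite inE negb_or => /andP[xy xs]; rewrite v2 //= /upd (negPf xy) v1.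
Qed.

Lemma run_quiet s st : quiet s -> out (run inp s st) = out st.
Proof.
elim: s st => [|y e|k e1 e2|e|s1 IH1 s2 IH2|e s1 IH1 s2 IH2|y w s IH] st //=.
- by case/andP=> q1 q2; rewrite IH2 // IH1.
- by case/andP=> q1 q2; case: ifP => _; [apply: IH1 | apply: IH2].
- by move=> q; elim: (var st w) => [|i IHi] //=; rewrite IH.
Qed.

Lemma run_Sq s1 s2 st : run inp (Sq s1 s2) st = run inp s2 (run inp s1 st).
Proof. by []. Qed.

Lemma run_Ite e s1 s2 st : run inp (Ite e s1 s2) st =
  if eval inp e st != 0 then run inp s1 st else run inp s2 st.
Proof. by []. Qed.

Lemma run_Asg x e st : run inp (Asg x e) st = set_var x (eval inp e st) st.
Proof. by []. Qed.

Lemma arr_Put k e1 e2 st k' i : arr (run inp (Put k e1 e2) st) k' i =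
  if (k' == k) && (i == eval inp e1 st) then eval inp e2 st else arr st k' i.
Proof. by rewrite /= /upd; case: (eqVneq k' k) => [->|]. Qed.

Lemma var_Put k e1 e2 st x : var (run inp (Put k e1 e2) st) x = var st x.
Proof. by []. Qed.

Lemma eval_Var x st : eval inp (Var x) st = var st x.
Proof. by []. Qed.

Lemma eval_Add e1 e2 st : eval inp (Add e1 e2) st = eval inp e1 st + eval inp e2 st.
Proof. by []. Qed.

Lemma eval_Sub e1 e2 st : eval inp (Sub e1 e2) st = eval inp e1 st - eval inp e2 st.
Proof. by []. Qed.

(** The step also receives the frame of the rounds done so far, so invariants need not mention what
    the body never touches. *)
Lemma for_ind x y s st (I : nat -> lstate -> Prop) : I 0 st ->
  (forall i st', i < var st y -> frame (x :: modv s) (moda s) st st' ->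
     I i st' -> I i.+1 (run inp s (set_var x i st'))) ->
  I (var st y) (run inp (For x y s) st).
Proof.
move=> I0 IS /=; suff H k : k <= var st y ->
    frame (x :: modv s) (moda s) st (iteri k (fun i st' => run inp s (set_var x i st')) st) /\
    I k (iteri k (fun i st' => run inp s (set_var x i st')) st) by case: (H _ (leqnn _)).
elim: k => [|k IH] hk; first by split.
have [[v1 a1] h] := IH (ltnW hk); set st' := iteri k _ st in v1 a1 h *.
have F : frame (x :: modv s) (moda s) st st' by split.
split; last exact: IS.
have [v2 a2] := run_frame s (set_var x k st').
split=> [z|j] hz; last by rewrite /= a2 //= a1.
by move: (hz); rewrite inE negb_or => /andP[xy xs]; rewrite /= v2 //= /upd (negPf xy) v1.
Qed.

End ProgramFrames.

(** * The program and the invariants of its loops *)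

Section RoundingProgram.
Local Open Scope nat_scope.

(* Variables: 0 input length, 1 bit length, 2 n, 3 q, 4 block size of the
   instance, 5 start and 6 stride of the table of the pseudodistribution, 7 and
   8 row pointers, 9 the vertex dropped from the row, 10 and 11 vertices, 14 row
   compatible, 15 and 16 its additional vertex and label, 18 and 19 its
   probability, 20 to 22 satisfied weight, weight, common denominator, 23
   pointer into the instance.
   Arrays: 0 frozen labels plus one, 1 decoded labels plus one, 2 and 3 the
   largest probability found so far, 4 candidate set, 5 seeds plus one. *)

Definition load_loop : stmt :=
  For 10 2 (Sq (Put 5 (Var 10) (Inp (Add (Var 7) (Var 10))))
           (Sq (Put 1 (Var 10) (Arr 5 (Var 10)))
           (Sq (Put 2 (Var 10) (Cst 0)) (Put 3 (Var 10) (Cst 1))))).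

Definition load_seeds : stmt :=
  Sq load_loop (Sq (Put 5 (Var 9) (Cst 0)) (Put 1 (Var 9) (Cst 0))).

(** Inequality is tested by the sum of the two truncated differences. The last labelled vertex
    outside the seeds is recorded; a row of the table compatible with the seeds has at most one. *)
Definition scan_loop : stmt :=
  For 10 2 (Sq (Asg 17 (Inp (Add (Var 8) (Var 10))))
    (Ite (Arr 5 (Var 10))
      (Ite (Add (Sub (Var 17) (Arr 5 (Var 10))) (Sub (Arr 5 (Var 10)) (Var 17)))
        (Asg 14 (Cst 0)) Skip)
      (Ite (Var 17) (Sq (Asg 15 (Var 10)) (Asg 16 (Var 17))) Skip))).

Definition scan_row : stmt :=
  Sq (Asg 14 (Cst 1)) (Sq (Asg 15 (Cst 0)) (Sq (Asg 16 (Cst 0)) scan_loop)).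

(** Probabilities are compared by cross-multiplication, the first factor of each product being an
    input number so that nothing is truncated. *)
Definition update_best : stmt :=
  Ite (Var 14) (Ite (Var 16)
    (Sq (Asg 18 (Inp (Add (Var 8) (Var 2))))
    (Sq (Asg 19 (Inp (Add (Var 8) (Add (Var 2) (Cst 1)))))
        (Ite (Sub (Mul (Var 18) (Arr 3 (Var 15))) (Mul (Var 19) (Arr 2 (Var 15))))
          (Sq (Put 1 (Var 15) (Var 16))
          (Sq (Put 2 (Var 15) (Var 18)) (Put 3 (Var 15) (Var 19))))
          Skip))) Skip) Skip.

(** The input length serves as a bound on the number of rows; the test skips pointers beyond the end
    of the table. *)
Definition decode_loop : stmt :=
  For 13 0 (Sq (Ite (Sub (Var 0) (Var 8)) (Sq scan_row update_best) Skip)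
               (Asg 8 (Add (Var 8) (Var 6)))).

Definition decode_labels : stmt := Sq (Asg 8 (Var 5)) decode_loop.

Definition init_core : stmt :=
  For 10 2 (Ite (Arr 0 (Var 10)) (Put 4 (Var 10) (Cst 0)) (Put 4 (Var 10) (Arr 1 (Var 10)))).

(** Variables 20 and 21 are numerators over the common denominator 22, the unreduced product of the
    denominators met so far. *)
Definition add_weight : stmt :=
  Sq (Asg 25 (Inp (Add (Var 23) (Cst 1))))
  (Sq (Asg 26 (Inp (Add (Var 23) (Cst 2))))
  (Sq (Asg 27 (Inp (Add (Add (Var 23) (Cst 3))
     (Add (Mul (Var 3) (Sub (Arr 1 (Var 10)) (Cst 1))) (Sub (Arr 1 (Var 11)) (Cst 1))))))
  (Sq (Asg 21 (Add (Mul (Var 26) (Var 21)) (Mul (Var 25) (Var 22))))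
  (Sq (Asg 20 (Mul (Var 26) (Var 20)))
  (Sq (Ite (Arr 4 (Var 11)) (Ite (Var 27) (Asg 20 (Add (Var 20) (Mul (Var 25) (Var 22)))) Skip) Skip)
  (Sq (Asg 22 (Mul (Var 26) (Var 22)))
      (Asg 23 (Add (Var 23) (Var 4))))))))).

(** The constant 2^M is the first factor of a product and escapes truncation because 2^M <= n, where
    n is an input number. *)
Definition test_vertex M : stmt :=
  Sq (Asg 20 (Cst 0)) (Sq (Asg 21 (Cst 0)) (Sq (Asg 22 (Cst 1))
  (Sq (Asg 23 (Add (Cst 2) (Mul (Var 2) (Mul (Var 10) (Var 4)))))
  (Sq (For 11 2 add_weight) (Sq (Asg 20 (Mul (Cst (2 ^ M)) (Var 20)))
  (Ite (Sub (Var 21) (Var 20)) (Put 4 (Var 10) (Cst 0)) Skip)))))).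

Definition peel M : stmt :=
  For 24 2 (For 10 2 (Ite (Arr 4 (Var 10)) (test_vertex M) Skip)).

Definition freeze : stmt :=
  For 10 2 (Ite (Arr 4 (Var 10)) (Put 0 (Var 10) (Arr 1 (Var 10))) Skip).

Definition try_row M : stmt :=
  Sq load_seeds (Sq decode_labels (Sq init_core (Sq (peel M) freeze))).

Definition header : stmt :=
  Sq (Asg 3 (Inp (Cst 1))) (Sq (Asg 4 (Add (Cst 3) (Mul (Var 3) (Var 3))))
  (Sq (Asg 5 (Add (Cst 2) (Mul (Var 2) (Mul (Var 2) (Var 4)))))
      (Asg 6 (Add (Var 2) (Cst 2))))).

Definition rounding M : stmt :=
  Sq header (Sq (Asg 7 (Var 5))
  (Sq (For 12 0 (Sq (Ite (Sub (Var 0) (Var 7)) (For 9 2 (try_row M)) Skip)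
                    (Asg 7 (Add (Var 7) (Var 6)))))
      (For 10 2 (Out (Sub (Arr 0 (Var 10)) (Cst 1)))))).

Lemma rounding_wf M : wf_stmt (rounding M).
Proof. by []. Qed.

Variables (inp : seq nat) (n q M : nat).
Hypotheses (inp_n : nth 0 inp 0 = n) (inp_q : nth 0 inp 1 = q).
Hypothesis M_small : 2 ^ M <= n.

Let blk := 3 + q * q.
Let base := 2 + n * (n * blk).
Let stp := n + 2.

Definition consts st := forall x, x < 7 ->
  var st x = nth 0 [:: size inp; total_bits inp; n; q; blk; base; stp] x.

Lemma frame_consts xs ks st st' : all (leq 7) xs -> frame xs ks st st' ->
  consts st -> consts st'.
Proof.
move=> /allP h [hv _] hc x x7; rewrite hv ?hc //.
by apply/negP => /h; rewrite leqNgt x7.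
Qed.

Lemma set_consts x v st : 7 <= x -> consts st -> consts (set_var x v st).
Proof. by move=> x7 hc y y7; rewrite /= /upd ifN ?hc //; apply/eqP; lia. Qed.

Lemma mul_input i m : (nth 0 inp i %% 2 ^ total_bits inp) * m = nth 0 inp i * m.
Proof. by rewrite modn_small // input_lt. Qed.

Lemma mul_small x m : x <= n -> (x %% 2 ^ total_bits inp) * m = x * m.
Proof.
by move=> xn; rewrite modn_small //; apply: leq_ltn_trans xn _; rewrite -inp_n input_lt.
Qed.

Lemma header_run : let st := run inp header (start inp) in
  consts st /\ forall k i, arr st k i = 0.
Proof.
split; last by [].
case=> [|[|[|[|[|[|[|x]]]]]]] // _; rewrite /= /upd /=; try rewrite !(mul_input, inp_q, inp_n) //.
by rewrite mul_small.
Qed.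

Section Decoding.

Implicit Types sd : nat -> nat.

Definition row_at j i := nth 0 inp (base + j * stp + i).
Definition is_row j := base + j * stp < size inp.

(** Row [j] prolongs the partial assignment [sd] by the vertex [v]. Labels are shifted by one, 0
    meaning unassigned. *)
Definition extends sd j v l :=
  [/\ forall w, w < n -> sd w != 0 -> row_at j w = sd w,
      v < n, sd v = 0, l != 0 & row_at j v = l].

Definition seeds j z v := if v == z then 0 else row_at j v.

Lemma load_seeds_run st j : consts st -> var st 7 = base + j * stp -> var st 9 < n ->
  let st' := run inp load_seeds st in
  forall v, v < n -> [/\ arr st' 5 v = seeds j (var st 9) v, arr st' 1 v = seeds j (var st 9) v,
     arr st' 2 v = 0 & arr st' 3 v = 1].
Proof.
move=> hc h7 h9; rewrite /load_seeds.
have [fv fa] := run_frame inp load_loop st; set f := run inp load_loop st in fv fa.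
have H : forall v, v < n -> [/\ arr f 5 v = row_at j v, arr f 1 v = row_at j v,
    arr f 2 v = 0 & arr f 3 v = 1].
  rewrite -(hc 2 isT : var st 2 = n).
  apply: (for_ind (inp := inp) (x := 10) (y := 2) (I := fun i st' => forall v, v < i ->
    [/\ arr st' 5 v = row_at j v, arr st' 1 v = row_at j v, arr st' 2 v = 0 & arr st' 3 v = 1])).
    by [].
  move=> i st' _ [gv ga] IH v; rewrite ltnS leq_eqVlt /= /upd /= gv // h7 => /orP[/eqP->|vi].
    by rewrite eqxx.
  by rewrite (ltn_eqF vi); apply: IH.
move=> v vn; have [e1 e2 e3 e4] := H v vn.
rewrite /= -/f /upd /= fv // /seeds; case: eqP => // _.
Qed.

Lemma scan_run st j sd : consts st -> var st 8 = base + j * stp ->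
  (forall v, v < n -> arr st 5 v = sd v) ->
  let st' := run inp scan_row st in
  (var st' 14 != 0) && (var st' 16 != 0) = false /\ (forall v l, ~ extends sd j v l) \/
  (var st' 14 != 0) && (var st' 16 != 0) /\ extends sd j (var st' 15) (var st' 16).
Proof.
move=> hc h8 hs; rewrite /scan_row; cbv zeta; rewrite [run _ _ _]/=.
set st0 := set_var 16 0 _.
pose I i st' := [/\ forall w, w < i -> w < n -> var st' 14 != 0 -> sd w != 0 -> row_at j w = sd w,
  var st' 14 = 0 -> exists w, [/\ w < n, sd w != 0 & row_at j w != sd w],
  var st' 16 = 0 -> forall w, w < i -> w < n -> sd w = 0 -> row_at j w = 0 &
  var st' 16 != 0 -> [/\ var st' 15 < n, sd (var st' 15) = 0 & row_at j (var st' 15) = var st' 16]].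
have : I n (run inp scan_loop st0).
  rewrite -(hc 2 isT : var st0 2 = n); apply: (for_ind (I := I)); first by split.
  move=> i st' iN [gv ga] [I1 I2 I3 I4].
  have iN' : i < n by rewrite -(hc 2 isT : var st 2 = n).
  have e5 : arr st' 5 i = sd i by rewrite ga //= hs.
  have e8 : var st' 8 = base + j * stp by rewrite gv.
  rewrite /= /upd /= e5 e8 -/(row_at j i).
  case: (eqVneq (sd i) 0) => [s0|s0] /=.
    case: (eqVneq (row_at j i) 0) => [r0|r0] /=.
      rewrite /I /= /upd /=; split=> //=.
      - move=> w; rewrite ltnS leq_eqVlt => /orP[/eqP->|wi] wn; last exact: I1.
        by rewrite s0.
      - move=> z w; rewrite ltnS leq_eqVlt => /orP[/eqP->|wi] wn //.
        exact: I3.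
    rewrite /I /= /upd /=; split=> //=.
    - move=> w; rewrite ltnS leq_eqVlt => /orP[/eqP->|wi] wn; last exact: I1.
      by rewrite s0.
    - by move=> z; move: r0; rewrite z.
  case: (eqVneq (row_at j i - sd i + (sd i - row_at j i)) 0) => [d0|d0] /=.
    have rs : row_at j i = sd i by lia.
    rewrite /I /= /upd /=; split=> //=.
    - move=> w; rewrite ltnS leq_eqVlt => /orP[/eqP->|wi] wn //.
      exact: I1.
    - move=> z w; rewrite ltnS leq_eqVlt => /orP[/eqP->|wi] wn sw; last exact: I3.
      by rewrite sw in s0.
  rewrite /I /= /upd /=; split=> //=.
  - by move=> _; exists i; split=> //; apply/eqP; lia.
  - move=> z w; rewrite ltnS leq_eqVlt => /orP[/eqP->|wi] wn sw; last exact: I3.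
    by rewrite sw in s0.
set f := run inp scan_loop st0; case=> I1 I2 I3 I4.
case: (eqVneq (var f 14) 0) => [e|e] /=.
  left; split=> // v l [h1 _ _ _ _]; have [w [wn sw rw]] := I2 e.
  by move: rw; rewrite h1 ?eqxx.
case: (eqVneq (var f 16) 0) => [e'|e'] /=.
  left; split=> // v l [_ vn sv l0 rv]; move: l0; rewrite -rv.
  by rewrite I3.
right; split=> //; have [h1 h2 h3] := I4 e'; split=> // w wn.
exact: I1.
Qed.

Definition row_num j := row_at j n.
Definition row_den j := row_at j n.+1.

(** The fraction stored at a vertex dominates every compatible row already read and, unless still
    the initial 0, is attained by a row with the stored label. A positive row strictly above all
    those with another label must therefore win. *)
Lemma decode_run st sd : consts st ->
  (forall v, v < n -> [/\ arr st 5 v = sd v, arr st 1 v = sd v, arr st 2 v = 0 & arr st 3 v = 1]) ->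
  (forall j, is_row j -> row_den j != 0) ->
  (forall j v v' l l', is_row j -> extends sd j v l -> extends sd j v' l' -> v = v') ->
  let st' := run inp decode_labels st in
  forall v, v < n ->
   [/\ sd v != 0 -> arr st' 1 v = sd v,
       arr st' 1 v != sd v -> exists2 j, is_row j & extends sd j v (arr st' 1 v) &
       forall j l, is_row j -> extends sd j v l -> row_num j != 0 ->
         (forall j' l', is_row j' -> extends sd j' v l' -> l' != l ->
            row_num j' * row_den j < row_num j * row_den j') ->
         arr st' 1 v = l].
Proof.
move=> hc hs hden huniq; cbv zeta; rewrite /decode_labels run_Sq run_Asg.
set st0 := set_var 8 _ st.
have hc0 : consts st0 by apply: set_consts.
have e80 : var st0 8 = base by rewrite /= /upd /= (hc 5).
pose I i st' := [/\ var st' 8 = base + i * stp,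
  forall v, v < n -> 0 < arr st' 3 v,
  forall v, v < n -> sd v != 0 -> arr st' 1 v = sd v,
  forall v, v < n -> arr st' 2 v = 0 /\ arr st' 1 v = sd v \/
    exists j, [/\ is_row j, extends sd j v (arr st' 1 v), arr st' 2 v = row_num j &
      arr st' 3 v = row_den j] &
  forall v j l, j < i -> is_row j -> extends sd j v l ->
    row_num j * arr st' 3 v <= arr st' 2 v * row_den j].
have : I (size inp) (run inp decode_loop st0).
  rewrite -(hc0 0 isT : var st0 0 = size inp).
  apply: (for_ind (I := I)).
    split=> // [|v vn|v vn _|v vn]; first by rewrite e80 mul0n addn0.
    - by rewrite /=; have [_ _ _ ->] := hs v vn.
    - by rewrite /=; have [_ -> _ _] := hs v vn.
    - by rewrite /=; have [_ -> -> _] := hs v vn; left.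
  move=> i st1 iN F [I1 I2 I3 I4 I5].
  have hc1 : consts st1 by apply: frame_consts F hc0.
  have e5 v : v < n -> arr st1 5 v = sd v.
    by move=> vn; have [_ ga] := F; rewrite ga //=; have [-> _ _ _] := hs v vn.
  set st2 := set_var 13 i st1.
  have hc2 : consts st2 by apply: set_consts.
  rewrite run_Sq run_Ite eval_Sub !eval_Var.
  have -> : var st2 0 = size inp by rewrite hc2.
  have -> : var st2 8 = base + i * stp by [].
  set st3 := (if _ then _ else _).
  suff [J1 J2 J3 J4 J5] : [/\ var st3 8 = base + i * stp /\ var st3 6 = stp,
      forall v, v < n -> 0 < arr st3 3 v,
      forall v, v < n -> sd v != 0 -> arr st3 1 v = sd v,
      forall v, v < n -> arr st3 2 v = 0 /\ arr st3 1 v = sd v \/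
        exists j, [/\ is_row j, extends sd j v (arr st3 1 v), arr st3 2 v = row_num j &
          arr st3 3 v = row_den j] &
      forall v j l, j < i.+1 -> is_row j -> extends sd j v l ->
        row_num j * arr st3 3 v <= arr st3 2 v * row_den j].
    rewrite run_Asg eval_Add !eval_Var J1.1 J1.2.
    split=> //; have -> : var (set_var 8 (base + i * stp + stp) st3) 8 = base + i * stp + stp by [].
    by rewrite mulSn; lia.
  rewrite /st3.
  have e6 : var st2 6 = stp by rewrite hc2.
  case: (boolP (is_row i)) => ri; last first.
    rewrite (_ : size inp - (base + i * stp) = 0); last by move: ri; rewrite /is_row; lia.
    rewrite eqxx /=; split=> // v j l; rewrite ltnS leq_eqVlt => /orP[/eqP->|ji].
      by rewrite (negPf ri).
    exact: I5.
  rewrite (_ : _ != 0); last by move: ri; rewrite /is_row; lia.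
  rewrite run_Sq; cbv iota.
  have F4 := run_frame inp scan_row st2.
  have := @scan_run st2 i sd hc2 I1 e5; set st4 := run inp scan_row st2 in F4 *.
  have [gv4 ga4] := F4.
  have hc4 : consts st4 by apply: frame_consts F4 hc2.
  have e84 : var st4 8 = base + i * stp by rewrite gv4.
  case=> [[fl nex]|[/andP[f1 f2] ex]].
    have -> : run inp update_best st4 = st4.
      rewrite /update_best !run_Ite !eval_Var.
      by case: (var st4 14 != 0) fl => //= ->.
    have g4 k v : arr st4 k v = arr st1 k v by rewrite ga4.
    split.
    - by rewrite e84 gv4 // e6.
    - by move=> v vn; rewrite g4; apply: I2.
    - by move=> v vn; rewrite g4; apply: I3.
    - by move=> v vn; rewrite !g4; apply: I4.
    - move=> v j l; rewrite !g4 ltnS leq_eqVlt => /orP[/eqP->|ji]; last exact: I5.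
      by move=> _ /nex.
  have [x1 x2 x3 x4 x5] := ex.
  set v0 := var st4 15 in x1 x2 x3 x4 x5 ex *; set l0 := var st4 16 in x4 x5 ex f2 *.
  have F5 := run_frame inp update_best st4.
  have : forall st5, st5 = run inp update_best st4 ->
      var st5 8 = base + i * stp /\ var st5 6 = stp /\
      ((0 < row_num i * arr st1 3 v0 - row_den i * arr st1 2 v0 /\
        forall k v, arr st5 k v = if v == v0 then
          (if k == 1 then l0 else if k == 2 then row_num i else if k == 3 then row_den i
           else arr st1 k v) else arr st1 k v) \/
       (row_num i * arr st1 3 v0 - row_den i * arr st1 2 v0 = 0 /\
        forall k v, arr st5 k v = arr st1 k v)).
    move=> st5 e5'; split; first by rewrite e5' F5.1.
    split; first by rewrite e5' F5.1 // gv4.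
    move: e5'; rewrite /update_best !run_Ite.
    rewrite !eval_Var f1 -/l0 f2.
    rewrite !run_Sq !run_Asg.
    set s6 := set_var 19 _ _.
    have w18 : var s6 18 = row_num i.
      by rewrite /s6 /= /upd /= e84 hc4 // /row_num /row_at; congr nth; lia.
    have w19 : var s6 19 = row_den i.
      rewrite /s6 /= /upd /= e84 hc4 // /row_den /row_at; congr nth.
      by change (base + i * stp + (n + 1) = base + i * stp + n.+1); rewrite addn1.
    have w15 : var s6 15 = v0 by [].
    have w16 : var s6 16 = l0 by [].
    have w1 : var s6 1 = total_bits inp by rewrite /s6 /= /upd /= hc4.
    have wa k v : arr s6 k v = arr st1 k v by rewrite [LHS]/= ga4.
    move: s6 w18 w19 w15 w16 w1 wa => s6 w18 w19 w15 w16 w1 wa.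
    rewrite run_Ite.
    have -> : eval inp (Sub (Mul (Var 18) (Arr 3 (Var 15))) (Mul (Var 19) (Arr 2 (Var 15)))) s6 =
        row_num i * arr st1 3 v0 - row_den i * arr st1 2 v0.
      by rewrite /= w18 w19 w15 w1 !mul_input !wa.
    rewrite -lt0n; case: ltnP => cmp -> ; [left|right].
      split=> [|k v]; first by [].

      rewrite !run_Sq !(arr_Put, var_Put, eval_Var) w15 w16 w18 w19 wa.
      case: (eqVneq v v0) => _; rewrite ?andbT ?andbF //.
      by case: (eqVneq k 3) => [->|_] //; case: (eqVneq k 2) => [->|_].
    by split; [lia | move=> k v; rewrite wa].
  move=> /(_ _ erefl) [h8 [h6 hupd]].
  have den0 : 0 < row_den i by rewrite lt0n; apply: hden.
  case: hupd => [[cmp g5]|[cmp g5]].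
    split=> //.
    - by move=> v vn; rewrite g5 /=; case: eqP => _ //; apply: I2.
    - move=> v vn sv; rewrite g5 /=; case: eqP => [e|_]; last exact: I3.
      by move: sv; rewrite e x3.
    - move=> v vn; rewrite !g5 /=; case: eqP => [->|_]; last exact: I4.
      by right; exists i.
    - move=> v j l; rewrite !g5 /= ltnS leq_eqVlt => /orP[/eqP->|ji] rj ej.
        have -> : v = v0 by apply: huniq ri ej ex.
        by rewrite eqxx.
      have := I5 v j l ji rj ej; case: eqP => [->|_] // h.
      have := I2 v0 x2; move: h cmp den0; clear.
      move: (row_num j) (row_den j) (row_num i) (row_den i) (arr st1 2 v0) (arr st1 3 v0).
      (* Transitivity of cross-multiplied comparisons: the new fraction beats the stored one, which
         dominated row [j]. *)
      move=> nj dj ni di BN BD h1 h2 h3 h4.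
      have h5 : di * BN < ni * BD by lia.
      rewrite -(leq_pmul2r h4).
      have -> : nj * di * BD = nj * BD * di by ring.
      apply: leq_trans (_ : BN * dj * di <= _); first by rewrite leq_pmul2r.
      have -> : ni * dj * BD = dj * (ni * BD) by ring.
      have -> : BN * dj * di = dj * (di * BN) by ring.
      by rewrite leq_mul2l (ltnW h5) orbT.
  split=> //.
  - by move=> v vn; rewrite g5; apply: I2.
  - by move=> v vn; rewrite g5; apply: I3.
  - by move=> v vn; rewrite !g5; apply: I4.
  - move=> v j l; rewrite !g5 ltnS leq_eqVlt => /orP[/eqP->|ji] rj ej; last exact: I5 ej.
    have -> : v = v0 by apply: huniq ri ej ex.
    by rewrite -subn_eq0 [X in _ - X]mulnC cmp.
set f := run inp decode_loop st0; case=> I1 I2 I3 I4 I5 v vn.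
have rowN j : is_row j -> j < size inp.
  by rewrite /is_row => h; apply: leq_trans h; rewrite /stp; nia.
split; first exact: I3.
  by move=> nv; case: (I4 v vn) => [[_ /eqP]|[j [? ? ? ?]]]; [rewrite (negPf nv) | exists j].
move=> j l rj ej nj hmax; have h5 := I5 v j l (rowN j rj) rj ej; have h2 := I2 v vn.
case: (I4 v vn) => [[e2 _]|[j' [rj' ej' e2 e3]]].
  by move: h5; rewrite e2 mul0n leqn0 muln_eq0 (negPf nj) /= => /eqP h5; rewrite h5 in h2.
apply/eqP; apply: contraT => nl; have := hmax j' _ rj' ej' nl.
by move: h5; rewrite e2 e3; lia.
Qed.

Definition wnum v u := nth 0 inp (2 + (v * n + u) * blk + 1).
Definition wden v u := nth 0 inp (2 + (v * n + u) * blk + 2).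
Definition satisfied v u a b := nth 0 inp (2 + (v * n + u) * blk + 3 + (q * a + b)) != 0.
Definition weight v u : rat := ((wnum v u)%:R / (wden v u)%:R)%R.
Definition weight_to (U : pred nat) (X : nat -> nat) v : rat :=
  (\sum_(u < n | U u && satisfied v u (X v - 1) (X u - 1)) weight v u)%R.

Definition good (U : pred nat) X v :=
  (\sum_(u < n) weight v u <= (2 ^+ M) * weight_to U X v)%R.

Lemma weight_ge0 v u : (0 <= weight v u)%R.
Proof. by rewrite divr_ge0 ?ler0n. Qed.

(** A larger supporting set only adds satisfied weight as long as the old labels are kept. Both
    peeling and freezing rest on this. *)
Lemma good_mono (U U' : pred nat) X X' v : v < n -> U v ->
  (forall u, u < n -> U u -> U' u /\ X' u = X u) -> good U X v -> good U' X' v.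
Proof.
move=> vn Uv h g; apply: le_trans g _; rewrite ler_wpM2l ?exprn_ge0 //.
rewrite /weight_to [X in (X <= _)%R]big_mkcond [X in (_ <= X)%R]big_mkcond.
apply: ler_sum => u _; case: (boolP (U u)) => Uu /=; last by case: ifP => // _; rewrite weight_ge0.
by have [-> ->] := h u (ltn_ord u) Uu; have [_ ->] := h v vn Uv.
Qed.

Hypothesis wden_neq0 : forall v u, v < n -> u < n -> wden v u != 0.

Lemma test_vertex_run st : consts st -> var st 10 < n ->
  forall w, arr (run inp (test_vertex M) st) 4 w =
    if (w == var st 10) && ~~ good (fun u => arr st 4 u != 0) (arr st 1) (var st 10) then 0
    else arr st 4 w.
Proof.
move=> hc; set v := var st 10 => vn w.
set U : pred nat := fun u => arr st 4 u != 0; set X := arr st 1.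
rewrite /test_vertex 4!run_Sq !run_Asg.
set st0 := set_var 23 _ _.
have hc0 : consts st0 by do 4! apply: set_consts => //.
have v10 : var st0 10 = v by [].
have e23 : var st0 23 = 2 + v * n * blk.
  have -> : var st0 23 = 2 + (var st 2 %% 2 ^ var st 1) * ((v %% 2 ^ var st 1) * var st 4) by [].
  by rewrite !hc //= !mul_small ?(ltnW vn) // mulnCA mulnA.
have a0 k i : arr st0 k i = arr st k i by [].
have [e20 e21 e22] : [/\ var st0 20 = 0, var st0 21 = 0 & var st0 22 = 1] by [].
move: st0 hc0 v10 e23 a0 e20 e21 e22 => st0 hc0 v10 e23 a0 e20 e21 e22.
pose I i st' := [/\ var st' 23 = 2 + (v * n + i) * blk, 0 < var st' 22,
  ((var st' 21)%:R = (var st' 22)%:R * \sum_(0 <= u < i) weight v u :> rat)%R &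
  ((var st' 20)%:R = (var st' 22)%:R *
     \sum_(0 <= u < i) (if U u && satisfied v u (X v - 1) (X u - 1) then weight v u else 0)
     :> rat)%R].
have : I n (run inp (For 11 2 add_weight) st0).
  rewrite -(hc0 2 isT : var st0 2 = n); apply: for_ind.
    by split; rewrite ?e23 ?addn0 ?e22 ?e21 ?e20 // !big_nil mulr0.
  move=> i st1; rewrite (hc0 2 isT : var st0 2 = n) => iN F [I1 I2 I3 I4].
  have hc1 : consts st1 by apply: frame_consts F hc0.
  have [gv ga] := F.
  have w10 : var st1 10 = v by rewrite gv.
  have wa k u : k \in [:: 1; 4] -> arr st1 k u = arr st k u.
    by move=> k14; rewrite ga // a0.
  have d0 := wden_neq0 vn iN.
  rewrite /add_weight !run_Sq !run_Asg.
  set s1 := set_var 20 _ _.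
  have [h25 h26 h27 h20 h21] : [/\ var s1 25 = wnum v i, var s1 26 = wden v i,
      (var s1 27 != 0) = satisfied v i (X v - 1) (X i - 1),
      var s1 20 = wden v i * var st1 20 &
      var s1 21 = wden v i * var st1 21 + wnum v i * var st1 22].
    have e4 : var st1 23 + 1 = 2 + (v * n + i) * blk + 1 by rewrite I1.
    have e5 : var st1 23 + 2 = 2 + (v * n + i) * blk + 2 by rewrite I1.
    have w1 : var st1 1 = total_bits inp by rewrite hc1.
    have w3 : var st1 3 = nth 0 inp 1 by rewrite hc1 // inp_q.
    rewrite /s1 /= /upd /= e4 e5 -/(wnum v i) -/(wden v i) w1 w3 !mul_input.
    split=> //.
    by rewrite /satisfied w10 !wa // -/X inp_q I1.
  have h22 : var s1 22 = var st1 22 by [].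
  have h23 : var s1 23 = var st1 23 by [].
  have h11 : var s1 11 = i by [].
  have h1 : var s1 1 = total_bits inp by apply: (hc1 1 isT).
  have h4 : var s1 4 = blk by apply: (hc1 4 isT).
  have ha k u : k \in [:: 1; 4] -> arr s1 k u = arr st k u by apply: wa.
  move: s1 h25 h26 h27 h20 h21 h22 h23 h11 h1 h4 ha => s1 h25 h26 h27 h20 h21 h22 h23 h11 h1 h4 ha.
  rewrite !run_Ite !eval_Var.
  have -> : eval inp (Arr 4 (Var 11)) s1 = arr st 4 i by rewrite /= h11 ha.
  rewrite -/(U i) h27.
  set s2 := (if U i then _ else _).
  have [k20 k21 k22 k23 [k26 k4 k1]] : [/\ var s2 20 = wden v i * var st1 20 +
        (U i && satisfied v i (X v - 1) (X i - 1)) * (wnum v i * var st1 22),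
      var s2 21 = wden v i * var st1 21 + wnum v i * var st1 22, var s2 22 = var st1 22,
      var s2 23 = var st1 23 & [/\ var s2 26 = wden v i, var s2 4 = blk & var s2 1 = total_bits inp]].
    rewrite /s2; case: (U i); last by rewrite /= h20 h21 h22 h23 h26 h4 h1 mul0n addn0.
    case: (satisfied v i _ _); last by rewrite /= h20 h21 h22 h23 h26 h4 h1 mul0n addn0.
    by rewrite run_Asg /= /upd /= h1 h20 h21 h22 h23 h25 h26 h4 mul_input mul1n.
  move: s2 k20 k21 k22 k23 k26 k4 k1 => s2 k20 k21 k22 k23 k26 k4 k1.
  have dr : ((wden v i)%:R != 0 :> rat)%R by rewrite pnatr_eq0.
  have wE : ((wnum v i)%:R = (wden v i)%:R * weight v i :> rat)%R.
    by rewrite /weight mulrC divfK.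
  split.
  - by rewrite /= /upd /= k23 k4 I1 addnS mulSn; ring.
  - by rewrite /= /upd /= k1 k26 k22 mul_input muln_gt0 I2 lt0n d0.
  - rewrite /= /upd /= k1 k21 k26 k22 mul_input big_nat_recr //=.
    by rewrite natrD !natrM I3 wE; ring.
  - rewrite /= /upd /= k1 k20 k26 k22 mul_input big_nat_recr //=.
    by rewrite natrD !natrM I4 wE; case: (U i && _); rewrite /=; ring.
rewrite 2!run_Sq; set s1 := run inp (For 11 2 add_weight) st0; case=> _ I2 I3 I4.
have [gv ga] := run_frame inp (For 11 2 add_weight) st0.
have v10' : var s1 10 = v by rewrite gv.
have v1 : var s1 1 = total_bits inp by rewrite gv // (hc0 1 isT).
have ha w' : arr s1 4 w' = arr st 4 w' by rewrite ga // a0.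
have g : good U X v = (var s1 21 <= 2 ^ M * var s1 20).
  rewrite -(ler_nat rat) natrM natrX I3 I4 !big_mkord -big_mkcond mulrCA ler_pM2l ?ltr0n //.
move: s1 I2 v10' v1 ha g {I3 I4 gv ga} => s1 I2 v10' v1 ha g.
rewrite run_Asg run_Ite.
set s2 := set_var 20 _ s1.
have -> : eval inp (Sub (Var 21) (Var 20)) s2 = var s1 21 - 2 ^ M * var s1 20.
  by rewrite /s2 /= /upd /= v1 mul_small.
have e4 : forall w', arr s2 4 w' = arr st 4 w' by [].
rewrite subn_eq0 -g; case: (good U X v); first by rewrite andbF.
rewrite arr_Put eqxx !andTb eval_Var.
have -> : var s2 10 = v by [].
by rewrite andbT; case: ifP => // _; rewrite e4.
Qed.

Definition alive st : pred nat := fun v => arr st 4 v != 0.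

Definition closed_in (U : pred nat) X (W : pred nat) :=
  (forall v, v < n -> W v -> U v) /\ (forall v, v < n -> W v -> good W X v).

Definition pass : stmt := For 10 2 (Ite (Arr 4 (Var 10)) (test_vertex M) Skip).

Lemma pass_run st : consts st -> let st' := run inp pass st in
  [/\ forall v, alive st' v -> alive st v,
      forall W, closed_in (alive st) (arr st 1) W -> forall v, v < n -> W v -> alive st' v &
      (forall v, alive st' v = alive st v) /\
        (forall v, v < n -> alive st v -> good (alive st) (arr st 1) v) \/
      (exists v, [/\ v < n, alive st v & ~~ alive st' v])].
Proof.
move=> hc; cbv zeta.
pose I i st' := [/\ forall v, alive st' v -> alive st v,
      forall W, closed_in (alive st) (arr st 1) W -> forall v, v < n -> W v -> alive st' v &
      (forall v, alive st' v = alive st v) /\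
        (forall v, v < i -> alive st v -> good (alive st) (arr st 1) v) \/
      (exists v, [/\ v < n, alive st v & ~~ alive st' v])].
suff: I n (run inp pass st) by [].
rewrite -(hc 2 isT : var st 2 = n); apply: (for_ind (I := I)).
  by split=> // [W [hW _] //|]; left.
move=> i st1; rewrite (hc 2 isT : var st 2 = n) => iN F [I1 I2 I3].
have hc1 : consts st1 by apply: frame_consts F hc.
have [gv ga] := F.
set st2 := set_var 10 i st1.
have hc2 : consts st2 by apply: set_consts.
have hX : arr st2 1 = arr st 1 by rewrite -ga.
rewrite run_Ite; have -> : eval inp (Arr 4 (Var 10)) st2 = arr st1 4 i by [].
rewrite -/(alive st1 i); case: (boolP (alive st1 i)) => ai; last first.
  split=> //; case: I3 => [[h1 h2]|]; [left|by right].
  by split=> // v; rewrite ltnS leq_eqVlt => /orP[/eqP->|]; [rewrite -h1 (negPf ai) | apply: h2].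
have ht v : alive (run inp (test_vertex M) st2) v =
    alive st1 v && ~~ ((v == i) && ~~ good (alive st1) (arr st 1) i).
  rewrite /alive test_vertex_run // (_ : var st2 10 = i) // hX -/(alive st2) -/(alive st1).
  by case: (_ && _); rewrite ?andbT ?andbF.
split.
- by move=> v; rewrite ht => /andP[h _]; apply: I1.
- move=> W cW v vn Wv; rewrite ht (I2 W) //=; apply/andP => -[/eqP vi /negP[]].
  rewrite -vi; apply: good_mono vn Wv _ (cW.2 v vn Wv) => u un Wu.
  by split=> //; apply: I2 cW u un Wu.
- case: (boolP (good (alive st1) (arr st 1) i)) => g; last first.
    right; exists i; split=> //; first exact: I1.
    by rewrite ht eqxx g andbF.
  case: I3 => [[h1 h2]|[v [vn h1 h2]]]; [left|right; exists v]; last first.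
    by split=> //; rewrite ht negb_and h2.
  split=> v; first by rewrite ht g andbF andbT h1.
  rewrite ltnS leq_eqVlt => /orP[/eqP->|]; last exact: h2.
  by move=> a; apply: good_mono iN ai _ g => u un; rewrite h1.
Qed.

(** A pass that leaves some candidate bad has removed a vertex, so [n] passes reach a fixed point. A
    set that supports itself never loses a vertex, by monotonicity. *)
Lemma peel_run st : consts st -> let st' := run inp (peel M) st in
  [/\ forall v, alive st' v -> alive st v,
      forall v, v < n -> alive st' v -> good (alive st') (arr st 1) v &
      forall W, closed_in (alive st) (arr st 1) W -> forall v, v < n -> W v -> alive st' v].
Proof.
move=> hc; cbv zeta; pose X := arr st 1.
pose ok (U : pred nat) := forall v, v < n -> U v -> good U X v.
pose I i st' := [/\ forall v, alive st' v -> alive st v,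
  forall W, closed_in (alive st) X W -> forall v, v < n -> W v -> alive st' v &
  ok (alive st') \/ \sum_(v < n) (alive st' v : nat) + i <= n].
have : I n (run inp (peel M) st).
  rewrite -(hc 2 isT : var st 2 = n); apply: (for_ind (I := I)).
    split=> // [W [hW _] //|]; right; rewrite addn0.
    by apply: leq_trans (leq_sum _ (fun i _ => leq_b1 _)) _; rewrite sum_nat_const card_ord muln1.
  move=> i st1; rewrite (hc 2 isT : var st 2 = n) => iN F [I1 I2 I3].
  have hc1 : consts st1 by apply: frame_consts F hc.
  set st2 := set_var 24 i st1; rewrite -/pass.
  have hc2 : consts st2 by apply: set_consts.
  have hX : arr st2 1 = X by rewrite /X -F.2.
  have := pass_run hc2; rewrite hX -/(alive st2) (_ : alive st2 = alive st1) //.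
  set st3 := run inp pass st2; case=> P1 P2 P3.
  split.
  - by move=> v /P1 /I1.
  - by move=> W cW; apply: P2; split; [apply: I2 | apply: cW.2].
  - case: P3 => [[h1 h2]|[v [vn h1 h2]]].
      left=> v vn; rewrite h1 => a; apply: good_mono (vn) (a) _ (h2 v vn a) => u un.
      by rewrite h1.
    case: I3 => [g|]; first by move: h2; rewrite (P2 (alive st1)).
    move=> le; right; apply: leq_trans le; rewrite addnS -addSn leq_add2r.
    rewrite (bigD1 (Ordinal vn)) //= [X in _ < X](bigD1 (Ordinal vn)) //= h1 (negPf h2) add0n.
    by rewrite ltnS leq_sum // => u _; move: (P1 u); case: (alive st3 u) => // ->.
set f := run inp (peel M) st; case=> I1 I2 [g|c]; split=> // v vn a.
move: c; rewrite (bigD1 (Ordinal vn)) //= a; lia.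
Qed.

Lemma init_core_run st : consts st -> forall v, v < n ->
  arr (run inp init_core st) 4 v = if arr st 0 v != 0 then 0 else arr st 1 v.
Proof.
move=> hc; rewrite -(hc 2 isT : var st 2 = n) /init_core.
apply: (for_ind (I := fun i st' => forall v, v < i ->
  arr st' 4 v = if arr st 0 v != 0 then 0 else arr st 1 v)) => // i st1 iN [gv ga] IH v.
set st2 := set_var 10 i st1; rewrite run_Ite.
have -> : eval inp (Arr 0 (Var 10)) st2 = arr st 0 i by rewrite /= ga.
rewrite ltnS leq_eqVlt => /orP[/eqP->|vi].
  by case: ifP => h; rewrite arr_Put eqxx //= /upd /= eqxx // -ga.
have e : arr st2 4 v = arr st1 4 v by [].
case: ifP => _; rewrite arr_Put eval_Var (_ : var st2 10 = i) // (ltn_eqF vi) andbF e; exact: IH.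
Qed.

Lemma freeze_run st : consts st -> forall v, v < n ->
  arr (run inp freeze st) 0 v = if alive st v then arr st 1 v else arr st 0 v.
Proof.
move=> hc; rewrite -(hc 2 isT : var st 2 = n) /freeze.
pose I i st' := forall v, arr st' 0 v = if (v < i) && alive st v then arr st 1 v else arr st 0 v.
suff: I (var st 2) (run inp freeze st) by move=> h v vn; rewrite h vn.
apply: (for_ind (I := I)) => // i st1 iN [gv ga] IH v.
set st2 := set_var 10 i st1; rewrite run_Ite.
have -> : eval inp (Arr 4 (Var 10)) st2 = arr st 4 i by rewrite /= ga.
rewrite -/(alive st i) ltnS.
have e k : arr st2 k = arr st1 k by [].
case: (boolP (alive st i)) => a.
  rewrite arr_Put eval_Var (_ : var st2 10 = i) // IH (leq_eqVlt v i).
  case: (eqVneq v i) => [->|_] //.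
  by rewrite a; exact: (congr1 (fun f => f i) (ga 1 isT)).
by rewrite e IH (leq_eqVlt v i); case: (eqVneq v i) => [->|_] //=; rewrite (negPf a) andbF.
Qed.

Hypothesis row_den_neq0 : forall j, is_row j -> row_den j != 0.
Hypothesis row_unique : forall j0 z j v v' l l', is_row j0 -> z < n -> is_row j ->
  extends (seeds j0 z) j v l -> extends (seeds j0 z) j v' l' -> v = v'.
Hypothesis row_le : forall j v, is_row j -> v < n -> row_at j v <= q.

(** What the program is bound to decode in whatever order it meets the rows: a seed is kept, and
    elsewhere ties between labels are excluded. *)
Definition forced sd v l := sd v != 0 /\ l = sd v \/
  exists2 j, is_row j & [/\ extends sd j v l, row_num j != 0 &
    forall j' l', is_row j' -> extends sd j' v l' -> l' != l ->
      row_num j' * row_den j < row_num j * row_den j'].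

Definition frozen_ok L := forall v, v < n ->
  L v <= q /\ (L v != 0 -> good (fun u => L u != 0) L v).

(* Otherwise the set [W] would have survived the peeling and been frozen. *)
Definition stuck (L : nat -> nat) j z := forall (W : pred nat) l,
  (forall v, v < n -> W v -> L v = 0 /\ forced (seeds j z) v (l v)) ->
  (forall v, v < n -> W v -> good W l v) -> forall v, v < n -> ~~ W v.

(** Newly frozen vertices support one another and older ones keep their labels, so [good_mono]
    preserves [frozen_ok]. A self-supporting set [W] of forced labels would survive the peeling and
    be frozen, against the assumption that its vertices are still at 0. *)
Lemma try_row_run st j : consts st -> is_row j -> var st 7 = base + j * stp -> var st 9 < n ->
  frozen_ok (arr st 0) -> let st' := run inp (try_row M) st in
  [/\ frozen_ok (arr st' 0), stuck (arr st' 0) j (var st 9) &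
      forall v, v < n -> arr st 0 v != 0 -> arr st' 0 v = arr st 0 v].
Proof.
move=> hc rj h7; set z := var st 9 => zn fok; cbv zeta; rewrite /try_row !run_Sq.
have F1 := run_frame inp load_seeds st; have S1 := load_seeds_run hc h7 zn.
set st1 := run inp load_seeds st in F1 S1 *.
have hc1 : consts st1 by apply: frame_consts F1 hc.
have F2 := run_frame inp decode_labels st1.
have S2 := @decode_run st1 (seeds j z) hc1 S1 row_den_neq0
   (fun j v v' l l' => @row_unique _ z j v v' l l' rj zn).
set st2 := run inp decode_labels st1 in F2 S2 *.
have hc2 : consts st2 by apply: frame_consts F2 hc1.
have F3 := run_frame inp init_core st2; have S3 := init_core_run hc2.
set st3 := run inp init_core st2 in F3 S3 *.
have hc3 : consts st3 by apply: frame_consts F3 hc2.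
have F4 := run_frame inp (peel M) st3; have S4 := peel_run hc3.
set st4 := run inp (peel M) st3 in F4 S4 *.
have hc4 : consts st4 by apply: frame_consts F4 hc3.
have S5 := freeze_run hc4; set st5 := run inp freeze st4 in S5 *.
have a02 : arr st2 0 = arr st 0 by rewrite (F2.2 0 isT) (F1.2 0 isT).
have a04 : arr st4 0 = arr st 0 by rewrite (F4.2 0 isT) (F3.2 0 isT).
have a13 : arr st3 1 = arr st2 1 by rewrite (F3.2 1 isT).
have a14 : arr st4 1 = arr st2 1 by rewrite (F4.2 1 isT).
move: S2 S3 S4 S5; rewrite a02 a04 a13 a14.
set L := arr st 0 in fok *; set X := arr st2 1; set L' := arr st5 0.
move=> S2 S3 [S4 S4' S4''] S5.
have aX v : v < n -> alive st3 v = (L v == 0) && (X v != 0).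
  by move=> vn; rewrite /alive S3 //; case: (L v == 0).
have a4 v : v < n -> alive st4 v -> L v = 0 /\ X v != 0.
  by move=> vn /S4; rewrite aX // => /andP[/eqP].
have oldL v : v < n -> L v != 0 -> L' v = L v.
  move=> vn Lv; rewrite S5 //; case: ifP => // /(a4 _ vn)[e _].
  by rewrite e in Lv.
split=> //.
- move=> v vn; split.
    rewrite S5 //; case: ifP => _; last by case: (fok v vn).
    case: (eqVneq (X v) (seeds j z v)) => [->|/eqP/eqP nX].
      by rewrite /seeds; case: ifP => // _; apply: row_le.
    have [_ /(_ nX)[j' rj' [_ _ _ _ e]] _] := S2 v vn.
    by rewrite -/(X v) in e *; rewrite -e; apply: row_le.
  rewrite S5 //; case: ifP => [av _|av Lv].
    apply: (good_mono vn av) (S4' v vn av) => u un au.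
    by rewrite S5 // au; have [_ ->] := a4 u un au.
  have [_ /(_ Lv)] := fok v vn; apply: good_mono => // u un Lu.
  by rewrite oldL.
- move=> W l hW gW v vn; apply/negP => Wv.
  have hX u : u < n -> W u -> X u = l u /\ X u != 0.
    move=> un Wu; have [_ fl] := hW u un Wu; have [X1 _ X2] := S2 u un.
    have e : X u = l u.
      case: fl => [[s0 ->]|[j' rj' [ex nz mx]]]; first exact: X1.
      exact: X2 ex nz mx.
    split=> //; rewrite e; case: fl => [[s0 ->] //|[j' rj' [[_ _ _ l0 _] _ _]]] //.
  have LW u : u < n -> W u -> L u = 0.
    move=> un Wu; case: (eqVneq (L u) 0) => // Lu; have [e _] := hW u un Wu.
    by have eL := oldL u un Lu; rewrite -eL e in Lu.
  have aW : alive st4 v.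
    apply: S4'' vn Wv; split=> u un Wu.
      by rewrite aX // LW //; case: (hX u un Wu) => _ ->.
    apply: good_mono (un) (Wu) _ (gW u un Wu) => w wn Ww; split=> //.
    by case: (hX w wn Ww).
  have [e _] := hW v vn Wv; have [_ X0] := hX v vn Wv.
  by move: e; rewrite S5 // aW => e; rewrite e in X0.
Qed.

(** Freezing more vertices leaves fewer candidates [W], so no row has to be tried again. *)
Lemma stuck_mono L L' j z : (forall v, v < n -> L v != 0 -> L' v = L v) ->
  stuck L j z -> stuck L' j z.
Proof.
move=> h s W l hW gW v vn; apply: s gW v vn => u un Wu.
have [e f] := hW u un Wu; split=> //; case: (eqVneq (L u) 0) => // Lu.
by have eL := h u un Lu; rewrite -eL e in Lu.
Qed.

Lemma rounding_run : exists L, [/\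
  out (run inp (rounding M) (start inp)) = [seq L v - 1 | v <- iota 0 n],
  frozen_ok L & forall j z, is_row j -> z < n -> stuck L j z].
Proof.
have [hc0 a0] := header_run; rewrite /rounding !run_Sq run_Asg.
have o0 : out (run inp header (start inp)) = [::] by rewrite run_quiet.
set st0 := run inp header (start inp) in hc0 a0 o0 *.
set st1 := set_var 7 _ st0.
have hc1 : consts st1 by apply: set_consts.
have e7 : var st1 7 = base by apply: (hc0 5 isT).
pose I i st' := [/\ var st' 7 = base + i * stp, frozen_ok (arr st' 0) &
  forall j z, j < i -> is_row j -> z < n -> stuck (arr st' 0) j z].
set main := For 12 0 _.
have : I (size inp) (run inp main st1).
  rewrite -(hc1 0 isT : var st1 0 = size inp); apply: (for_ind (I := I)).
    split=> //; first by rewrite e7 mul0n addn0.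
  move=> i st2 iN F [I1 I2 I3].
  have hc2 : consts st2 by apply: frame_consts F hc1.
  set st3 := set_var 12 i st2.
  have hc3 : consts st3 by apply: set_consts.
  rewrite run_Sq run_Ite run_Asg eval_Add eval_Sub !eval_Var.
  have -> : var st3 0 = size inp by rewrite hc3.
  have -> : var st3 7 = base + i * stp by [].
  set st4 := (if _ then _ else _).
  suff [J1 J2 J3 J4] : [/\ var st4 7 = base + i * stp, var st4 6 = stp, frozen_ok (arr st4 0) &
      forall j z, j < i.+1 -> is_row j -> z < n -> stuck (arr st4 0) j z].
    rewrite J1 J2; split=> //.
    have -> : var (set_var 7 (base + i * stp + stp) st4) 7 = base + i * stp + stp by [].
    by rewrite mulSn; lia.
  rewrite /st4.
  have e6 : var st3 6 = stp by rewrite hc3.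
  case: (boolP (is_row i)) => ri; last first.
    rewrite (_ : size inp - (base + i * stp) = 0); last by move: ri; rewrite /is_row; lia.
    rewrite eqxx /=; split=> // j z; rewrite ltnS leq_eqVlt => /orP[/eqP->|ji].
      by rewrite (negPf ri).
    exact: I3.
  rewrite (_ : _ != 0); last by move: ri; rewrite /is_row; lia.
  cbv iota.
  pose I' k st' := [/\ frozen_ok (arr st' 0), forall z, z < k -> stuck (arr st' 0) i z &
    forall v, v < n -> arr st2 0 v != 0 -> arr st' 0 v = arr st2 0 v].
  have : I' n (run inp (For 9 2 (try_row M)) st3).
    rewrite -(hc3 2 isT : var st3 2 = n); apply: (for_ind (I := I')); first by split.
    move=> k st5; rewrite (hc3 2 isT : var st3 2 = n) => kn F' [K1 K2 K3].
    set st6 := set_var 9 k st5.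
    have hc6 : consts st6 by apply: set_consts => //; apply: frame_consts F' hc3.
    have e76 : var st6 7 = base + i * stp by rewrite -I1; exact: (F'.1 7 isT).
    have [T1 T2 T3] := @try_row_run st6 i hc6 ri e76 kn K1.
    split=> //.
    - move=> z; rewrite ltnS leq_eqVlt => /orP[/eqP->|zk] //.
      exact: stuck_mono T3 (K2 z zk).
    - move=> v vn Lv; have e : arr st6 0 v = arr st2 0 v := K3 v vn Lv.
      by rewrite T3 // e.
  have [gv _] := run_frame inp (For 9 2 (try_row M)) st3.
  set f := run inp (For 9 2 (try_row M)) st3 in gv *; case=> K1 K2 K3.
  split=> //; [by rewrite gv|by rewrite gv|].
  move=> j z; rewrite ltnS leq_eqVlt => /orP[/eqP->|ji] rj zn; first exact: K2.
  exact: stuck_mono K3 (I3 j z ji rj zn).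
have om : out (run inp main st1) = [::] by rewrite run_quiet.
have [mv _] := run_frame inp main st1.
set f := run inp main st1 in om mv *; case=> I1 I2 I3.
exists (arr f 0); split=> //; last first.
  by move=> j z rj zn; apply: I3 => //; move: rj; rewrite /is_row /stp; nia.
have f2 : var f 2 = n by rewrite mv // (hc1 2 isT).
rewrite -f2.
apply: (for_ind (I := fun i st' => out st' = [seq arr f 0 v - 1 | v <- iota 0 i])) => // i st' _ F IH.
have -> : run inp (Out (Sub (Arr 0 (Var 10)) (Cst 1))) (set_var 10 i st') =
  emit (arr st' 0 i - 1) (set_var 10 i st') by [].
have -> : iota 0 i.+1 = iota 0 i ++ [:: i] by rewrite -addn1 iotaD.
by rewrite map_cat -IH /= (F.2 0 isT) cats1.
Qed.

End Decoding.
End RoundingProgram.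

(** * Correctness of the rounding program *)

Section Blocks.
Local Open Scope nat_scope.
Variable T : Type.
Implicit Types (ss : seq (seq T)) (k : nat).

Lemma size_flatten_const ss k : all (fun s => size s == k) ss -> size (flatten ss) = size ss * k.
Proof. by elim: ss => //= s ss IH /andP[/eqP e /IH h]; rewrite size_cat e h mulSn. Qed.

Lemma nth_flatten_const x0 ss k j i : all (fun s => size s == k) ss -> i < k ->
  nth x0 (flatten ss) (j * k + i) = nth x0 (nth [::] ss j) i.
Proof.
move=> + ik; elim: ss j => [|s ss IH] [|j] /=; rewrite ?nth_nil //.
  by move=> /andP[/eqP e _]; rewrite mul0n add0n nth_cat e ik.
move=> /andP[/eqP e h]; rewrite nth_cat e mulSn ifN; last by lia.
by rewrite -(IH j h); congr nth; lia.
Qed.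

Lemma flatten_flatten (sss : seq (seq (seq T))) : flatten (map flatten sss) = flatten (flatten sss).
Proof. by elim: sss => //= ss sss ->; rewrite flatten_cat. Qed.

End Blocks.

Lemma nth_allpairs_ord (T : Type) (x0 : T) a b (f : 'I_a * 'I_b -> T) (i : 'I_a) (j : 'I_b) :
  nth x0 [seq f p | p <- [seq (i, j) | i <- enum 'I_a, j <- enum 'I_b]] (i * b + j) = f (i, j).
Proof.
have h : all (fun s => size s == b) [seq [seq (i, j) | j <- enum 'I_b] | i <- enum 'I_a].
  by apply/allP => s /mapP[k _ ->]; rewrite size_map size_enum_ord.
have sz : size (enum 'I_a) = a by rewrite size_enum_ord.
rewrite (nth_map (i, j)); last first.
  rewrite (size_flatten_const h) size_map sz.
  by apply: leq_trans (_ : i.+1 * b <= _)%N;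
    rewrite ?leq_mul2r ?ltn_ord ?orbT // mulSn addnC ltn_add2r.
congr f; rewrite (nth_flatten_const _ _ h) // (nth_map i) ?sz // (nth_map j) ?size_enum_ord //.
by rewrite !nth_ord_enum.
Qed.

Lemma rat_lt_absz (x y : rat) : 0 <= x -> x < y ->
  (`|numq x| * `|denq y| < `|numq y| * `|denq x|)%N.
Proof.
move=> x0 xy; have y0 := le_trans x0 (ltW xy).
have E (w : rat) : 0 <= w -> w = `|numq w|%:R / `|denq w|%:R.
  by move=> w0; rewrite !natr_absz !ger0_norm ?numq_ge0 // divq_num_den.
have d0 (w : rat) : 0 < `|denq w|%:R :> rat by rewrite ltr0n absz_gt0 denq_eq0.
move: xy; rewrite [in X in X -> _](E x) // [in X in X -> _](E y) // ltr_pdivrMr //.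
by rewrite mulrAC ltr_pdivlMr // -!natrM ltr_nat.
Qed.

(** * Unions of self-supporting sets *)

Section Rounding.
Variables (F : realFieldType) (n q : nat) (I : instance F n q) (c : F).
Hypothesis c0 : 0 <= c.

Definition self_supporting (U : {set 'I_n}) (x : 'I_n -> 'I_q) := forall v, v \in U ->
  c * vol I v <= \sum_(u in U) edge_wt I v u * (cstr I v u (x v) (x u))%:R.

(** The ordered satisfied weight is twice the value, and the set alone contributes c / 2 to it. *)
Lemma value_self_supporting U (x : {ffun 'I_n -> 'I_q}) : self_supporting U x ->
  1 / 2 <= \sum_(v in U) vol I v -> c / 4 <= value I x.
Proof.
move=> h hU; have : c * (1 / 2) <= 2 * value I x; last by lra.
apply: le_trans (ler_wpM2l c0 hU) _; rewrite mulr_sumr -value_ordered.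
have t0 u v : 0 <= edge_wt I u v * (cstr I u v (x u) (x v))%:R.
  by rewrite mulr_ge0 ?edge_wt_ge0.
apply: le_trans (ler_sum _ h) _; rewrite [leRHS](bigID (mem U)) /=.
apply: ler_wpDr; first by rewrite sumr_ge0 // => u _; rewrite sumr_ge0.
by apply: ler_sum => v _; rewrite [leRHS](bigID (mem U)) /= lerDl sumr_ge0.
Qed.

(** The existence statement over the reals, where no program runs. Self-supporting sets are joined,
    disjointly and without relabelling, until they hold volume 1/2; the induction on size ends
    because no set has more than n vertices. *)
Lemma greedy_value : (0 < q)%N ->
  (forall R : {set 'I_n}, \sum_(v in ~: R) vol I v <= 1 / 2 ->
     exists (U : {set 'I_n}) x, [/\ U != finset.set0, U \subset R & self_supporting U x]) ->
  exists x, c / 4 <= value I x.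
Proof.
move=> q0 H.
have main k : (exists x, c / 4 <= value I x) \/
    exists (U : {set 'I_n}) (x : {ffun 'I_n -> 'I_q}), (k <= #|U|)%N /\ self_supporting U x.
  elim: k => [|k [|[U [x [kU sU]]]]]; [right|by left|].
    exists finset.set0, [ffun=> Ordinal q0]; split=> // v; first by rewrite inE.
  case: (leP (1 / 2) (\sum_(v in U) vol I v)) => hU.
    by left; exists x; apply: value_self_supporting sU hU.
  have [|U' [x' [U'0 U'U sU']]] := H (~: U); first by rewrite setCK ltW.
  right; exists (U :|: U'), [ffun v => if v \in U then x v else x' v]; split.
    have d : [disjoint U & U'] by rewrite -setI_eq0 -subset0 -(setICr U) setIS.
    rewrite cardsU (disjoint_setI0 d) cards0 subn0 -addn1 leq_add //.
    by rewrite card_gt0.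
  have t0 u v a b : 0 <= edge_wt I u v * (cstr I u v a b)%:R.
    by rewrite mulr_ge0 ?edge_wt_ge0.
  move=> v; rewrite inE ffunE; case: (boolP (v \in U)) => /= vU vU'.
    apply: le_trans (sU v vU) _; rewrite [leRHS](bigID (mem U)) /=.
    rewrite [X in _ <= X + _](eq_bigl (mem U)) => [|u]; last first.
      rewrite !inE; change (((u \in U) || (u \in U')) && (u \in U) = (u \in U)).
      by case: (u \in U); rewrite ?andbF.
    rewrite -[leLHS]addr0 lerD ?sumr_ge0 // ler_sum // => u uU.
    by rewrite ffunE uU.
  apply: le_trans (sU' v vU') _; rewrite [leRHS](bigID (mem U')) /=.
  rewrite [X in _ <= X + _](eq_bigl (mem U')) => [|u]; last first.
    rewrite !inE; change (((u \in U) || (u \in U')) && (u \in U') = (u \in U')).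
    by case: (u \in U'); rewrite ?orbT ?andbF.
  rewrite -[leLHS]addr0 lerD ?sumr_ge0 // ler_sum // => u uU'.
  by rewrite ffunE; have := subsetP U'U u uU'; rewrite inE => /negPf->.
have [//|[U [x [+ _]]]] := main n.+1.
by have := max_card (mem U); rewrite card_ord ltnNge => ->.
Qed.

End Rounding.

(** * What the program reads in an encoded input *)

Section Encoding.
Variables (n q t : nat) (I : instance rat n q) (m : pseudodist rat n q t).
Let inp := enc_input I m.

Let entry (p : 'I_n * 'I_n) : seq nat :=
  (adj I p.1 p.2 : nat) ::
  enc_rat (if adj I p.1 p.2 then wt I p.1 p.2 else 0) ++
  [seq (adj I p.1 p.2 && cstr I p.1 p.2 ab.1 ab.2 : nat)
     | ab <- [seq (a, b) | a <- enum 'I_q, b <- enum 'I_q]].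

Let entries := [seq entry p | p <- [seq (i, j) | i <- enum 'I_n, j <- enum 'I_n]].

Let row (V : {set 'I_n}) (y : passign q V) : seq nat := enc_passign y ++ enc_rat (psd_fun m V y).

Let rows := flatten [seq [seq row y | y <- enum {: passign q V}]
                       | V : {set 'I_n} <- enum {set 'I_n} & #|V| == t].

Let inpE : inp = [:: n, q & flatten entries] ++ flatten rows.
Proof.
rewrite /inp /enc_input /enc_instance /enc_pseudodist /rows -flatten_flatten -map_comp.
by congr (_ ++ flatten _).
Qed.

Let entries_size : all (fun s => size s == 3 + q * q)%N entries.
Proof.
apply/allP => s /mapP[p _ ->].
by rewrite /entry /= size_map size_allpairs !size_enum_ord.
Qed.

Let size_entries : size entries = (n * n)%N.
Proof. by rewrite size_map size_allpairs !size_enum_ord. Qed.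

Let size_head : size [:: n, q & flatten entries] = (2 + n * (n * (3 + q * q)))%N.
Proof. by rewrite /= (size_flatten_const entries_size) size_entries -mulnA. Qed.

Let rows_size : all (fun s => size s == n + 2)%N rows.
Proof.
apply/allP => s /flattenP[ss /mapP[V _ ->] /mapP[y _ ->]].
by rewrite size_cat size_map size_enum_ord.
Qed.

Lemma input_n : nth 0%N inp 0 = n. Proof. by []. Qed.
Lemma input_q : nth 0%N inp 1 = q. Proof. by []. Qed.

Lemma input_entry (v u : 'I_n) i : (i < 3 + q * q)%N ->
  nth 0%N inp (2 + (v * n + u) * (3 + q * q) + i) = nth 0%N (entry (v, u)) i.
Proof.
move=> ib; rewrite inpE nth_cat size_head.
have -> : (2 + (v * n + u) * (3 + q * q) + i < 2 + n * (n * (3 + q * q)))%N.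
  have := ltn_ord v; have := ltn_ord u; move: ib; move: (3 + q * q)%N => b ib un vn.
  rewrite -addnA ltn_add2l mulnA.
  apply: (@leq_trans ((v * n + u).+1 * b)); first by rewrite mulSn addnC ltn_add2r.
  rewrite leq_mul2r; apply/orP; right; apply: (@leq_trans (v.+1 * n));
    last by rewrite leq_mul2r vn orbT.
  by rewrite mulSn addnC ltn_add2r.
change (nth 0%N (flatten entries) ((v * n + u) * (3 + q * q) + i) = nth 0%N (entry (v, u)) i).
rewrite (nth_flatten_const _ _ entries_size) //.
rewrite -[nth [::] entries _]/(nth [::] [seq entry p | p <- _] _).
by rewrite nth_allpairs_ord.
Qed.

Lemma input_wden v u : (v < n)%N -> (u < n)%N -> wden inp n q v u != 0%N.
Proof.
move=> vn un; rewrite /wden (@input_entry (Ordinal vn) (Ordinal un) 2) //=.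
by rewrite absz_eq0 denq_eq0.
Qed.

Lemma input_weight (v u : 'I_n) : weight inp n q v u = edge_wt I v u.
Proof.
rewrite /weight /wnum /wden !input_entry //= /edge_wt.
set w := (if _ then _ else _).
have w0 : 0 <= w by rewrite /w; case: ifP => // a; apply: wt_ge0.
rewrite natr_absz ger0_norm ?numq_ge0 // natr_absz ger0_norm ?denq_ge0 //.
by rewrite divq_num_den.
Qed.

Lemma input_satisfied (v u : 'I_n) (a b : 'I_q) :
  satisfied inp n q v u a b = adj I v u && cstr I v u a b.
Proof.
rewrite /satisfied -addnA input_entry; last first.
  rewrite ltn_add2l; apply: (@leq_trans (a.+1 * q)); last by rewrite leq_mul2r ltn_ord orbT.
  by rewrite mulSn addnC mulnC ltn_add2r.
rewrite add3n /= mulnC nth_allpairs_ord /=; by case: (_ && _).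
Qed.

Lemma input_size_ge : (n <= size inp)%N.
Proof.
rewrite inpE size_cat size_head; apply: leq_trans (leq_addr _ _).
by move: (q * q)%N => b; clear; nia.
Qed.

Let size_inp : size inp = (2 + n * (n * (3 + q * q)) + size rows * (n + 2))%N.
Proof. by rewrite inpE size_cat size_head (size_flatten_const rows_size). Qed.

Let is_rowE j : is_row inp n q j = (j < size rows)%N.
Proof. by rewrite /is_row size_inp ltn_add2l ltn_mul2r addn2. Qed.

Let row_atE j i : (i < n + 2)%N -> row_at inp n q j i = nth 0%N (nth [::] rows j) i.
Proof.
move=> ilt; rewrite /row_at inpE nth_cat size_head -addnA ltnNge leq_addr /= addKn.
by rewrite (nth_flatten_const _ _ rows_size).
Qed.

Definition row_of j (V : {set 'I_n}) (x : {ffun 'I_n -> 'I_q}) :=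
  [/\ forall v : 'I_n, row_at inp n q j v = if v \in V then (x v).+1 else 0%N,
      row_num inp n q j = `|numq (psd_fun m V (restrict V x))|%N &
      row_den inp n q j = `|denq (psd_fun m V (restrict V x))|%N].

Let row_of_nth j (V : {set 'I_n}) (x : {ffun 'I_n -> 'I_q}) : nth [::] rows j = row (restrict V x) -> row_of j V x.
Proof.
move=> e; split=> [v||].
- rewrite row_atE; last by rewrite addn2 !ltnS; apply: ltnW; apply: leqW.
  rewrite e nth_cat size_map size_enum_ord ltn_ord (nth_map v) ?size_enum_ord // nth_ord_enum.
  by case: insubP => [s vV es|/negPf->] //; rewrite vV ffunE es.
- by rewrite /row_num row_atE ?addn2 // e nth_cat size_map size_enum_ord ltnn subnn.
- rewrite /row_den row_atE ?addn2 // e nth_cat size_map size_enum_ord ltnNge leqnSn /=.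
  by rewrite subSn // subnn.
Qed.

Lemma row_exists (V : {set 'I_n}) (x : {ffun 'I_n -> 'I_q}) : #|V| = t -> exists2 j, is_row inp n q j & row_of j V x.
Proof.
move=> cV; have h : row (restrict V x) \in rows.
  apply/flattenP; exists [seq row y | y <- enum {: passign q V}].
    by apply/mapP; exists V; rewrite // mem_filter cV eqxx mem_enum.
  by apply/mapP; exists (restrict V x); rewrite ?mem_enum.
exists (index (row (restrict V x)) rows); first by rewrite is_rowE index_mem.
by apply: row_of_nth; rewrite nth_index.
Qed.

Lemma row_ofP (d0 : 'I_q) j : is_row inp n q j -> exists (V : {set 'I_n}) x, #|V| = t /\ row_of j V x.
Proof.
rewrite is_rowE => jr.
have /flattenP[ss /mapP[V + ->] /mapP[y _ e]] := mem_nth [::] jr.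
rewrite mem_filter => /andP[/eqP cV _]; exists V, (extend d0 y); split=> //.
by apply: row_of_nth; rewrite e restrictK.
Qed.

Lemma input_good M (U : pred nat) (X : nat -> nat) (x : 'I_n -> 'I_q) (v : 'I_n) : U v ->
  (forall u : 'I_n, U u -> (X u - 1 = x u)%N) ->
  good inp n q M U X v = (2^-1 ^+ M * vol I v <=
    \sum_(u in [set u : 'I_n | U u]) edge_wt I v u * (cstr I v u (x v) (x u))%:R).
Proof.
move=> Uv hX; have p0 : 0 < 2 ^+ M :> rat by rewrite exprn_gt0.
rewrite /good exprVn ler_pdivrMl //; congr (_ <= _ * _).
  by apply: eq_bigr => u _; rewrite input_weight.
rewrite /weight_to big_mkcond [RHS]big_mkcond; apply: eq_bigr => u _; rewrite inE.
case: (boolP (U u)) => //= Uu; rewrite !hX // input_satisfied input_weight /edge_wt.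
by case: (adj I v u); case: (cstr _ _ _ _ _); rewrite /= ?mulr1 ?mulr0 ?mul0r.
Qed.

Section Extensions.
Variables (q0 : (0 < q)%N) (t0 : (0 < t)%N).
Let d0 := Ordinal q0.

Lemma seeds_row j (V : {set 'I_n}) (x : {ffun 'I_n -> 'I_q}) (z w : 'I_n) : row_of j V x ->
  seeds inp n q j z w = if w \in V :\ z then (x w).+1 else 0%N.
Proof. by case=> h _ _; rewrite /seeds h in_setD1 -val_eqE; case: eqP. Qed.

(* A row extending [S] by [v] is indexed by [v |: S]: both have [t] elements. *)
Lemma extends_row (S : {set 'I_n}) (z x : {ffun 'I_n -> 'I_q}) (sd : nat -> nat) j (V : {set 'I_n}) (v : 'I_n) l :
  (t <= #|S|.+1)%N -> #|V| = t -> row_of j V x ->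
  (forall w : 'I_n, sd w = if w \in S then (z w).+1 else 0%N) ->
  extends inp n q sd j v l ->
  [/\ v \notin S, V = v |: S, l = (x v).+1 & forall w, w \in S -> x w = z w].
Proof.
move=> tS cV [hr _ _] hs [h1 _ sv l0 rv].
have vS : v \notin S by move: sv; rewrite hs; case: ifP.
have vV : v \in V by move: rv l0; rewrite hr; case: ifP => // _ <-.
have SV w : w \in S -> w \in V /\ x w = z w.
  move=> wS; have := h1 w (ltn_ord w); rewrite hs wS hr => /(_ isT).
  by case: ifP => // _ [/val_inj].
have sub : v |: S \subset V by apply/subsetP => w /setU1P[->|/SV[]].
split=> //; last by move=> w /SV[].
- apply/esym/eqP; rewrite eqEcard sub cV cardsU1 vS add1n tS //.
- by rewrite -rv hr vV.
Qed.

Lemma input_row_unique j0 z j v v' l l' : is_row inp n q j0 -> (z < n)%N -> is_row inp n q j ->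
  extends inp n q (seeds inp n q j0 z) j v l ->
  extends inp n q (seeds inp n q j0 z) j v' l' -> v = v'.
Proof.
move=> /(row_ofP d0)[V0 [x0 [c0 r0]]] zn /(row_ofP d0)[V [x [cV r]]] e e'.
have [_ vn _ _ _] := e; have [_ vn' _ _ _] := e'.
have hs w := seeds_row (Ordinal zn) w r0.
have tS : (t <= #|V0 :\ Ordinal zn|.+1)%N.
  by rewrite -c0 (cardsD1 (Ordinal zn) V0) -add1n leq_add2r leq_b1.
have [vS VE _ _] := @extends_row _ x0 x _ j V (Ordinal vn) l tS cV r hs e.
have [vS' VE' _ _] := @extends_row _ x0 x _ j V (Ordinal vn') l' tS cV r hs e'.
have : Ordinal vn \in Ordinal vn' |: (V0 :\ Ordinal zn) by rewrite -VE' VE setU11.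
by rewrite in_setU1 (negPf vS) orbF => /eqP[].
Qed.

Lemma input_row_den j : is_row inp n q j -> row_den inp n q j != 0%N.
Proof. by move=> /(row_ofP d0)[V [x [_ [_ _ ->]]]]; rewrite absz_eq0 denq_eq0. Qed.

Lemma input_row_le j v : is_row inp n q j -> (v < n)%N -> (row_at inp n q j v <= q)%N.
Proof.
move=> /(row_ofP d0)[V [x [_ [h _ _]]]] vn; rewrite (h (Ordinal vn)).
by case: ifP => // _; apply: ltn_ord.
Qed.

Lemma rounding_correct M : (t <= n)%N -> (2 ^ M <= n)%N ->
  exists2 x : {ffun 'I_n -> 'I_q},
    out (run inp (rounding M) (start inp)) = enc_assignment x &
  (forall R : {set 'I_n}, \sum_(v in ~: R) vol I v <= 1 / 2 ->
    exists (S : {set 'I_n}) (z : {ffun 'I_n -> 'I_q}) (Lb : 'I_n -> 'I_q) (U : {set 'I_n}),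
    [/\ #|S| = t.-1, U != finset.set0, U \subset R &
      forall v, v \in U ->
      [/\ v \in S -> z v = Lb v,
          v \notin S -> 0 < row_prob m S z v (Lb v) /\
            forall a, a != Lb v -> row_prob m S z v a < row_prob m S z v (Lb v) &
          2^-1 ^+ M * vol I v <=
          \sum_(u in U) edge_wt I v u * (cstr I v u (Lb v) (Lb u))%:R]]) ->
  2^-1 ^+ M / 4 <= value I x.
Proof.
move=> tn Mn.
have [L [outE ok stk]] := rounding_run input_n input_q Mn input_wden input_row_den
  input_row_unique input_row_le.
have Lq (v : 'I_n) : (L v - 1 < q)%N by have [] := ok v (ltn_ord v); move: q0; clear; lia.
pose x : {ffun 'I_n -> 'I_q} := [ffun v => Ordinal (Lq v)].
exists x.
  rewrite outE /enc_assignment -val_enum_ord -map_comp; apply: eq_map => v.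
  by rewrite ffunE.
move=> H; have c0 : 0 <= 2^-1 ^+ M :> rat by rewrite exprn_ge0 // invr_ge0.
pose A := [set v : 'I_n | L v != 0%N].
have sA : self_supporting I (2^-1 ^+ M) A x.
  move=> v; rewrite inE => Lv; have [_ /(_ Lv)] := ok v (ltn_ord v).
  by rewrite (@input_good M _ L x) // => u _; rewrite ffunE.
case: (leP (1 / 2) (\sum_(v in A) vol I v)) => hA; first exact: value_self_supporting sA hA.
have [|S [z [Lb [U [cS U0 UA hU]]]]] := H (~: A); first by rewrite setCK ltW.
(* Any vertex outside [S] completes it to a row; dropping that vertex again leaves exactly the
   labels of [z] on [S] as seeds. *)
have [w wS] : exists w, w \notin S.
  apply/existsP; rewrite -negb_forall; apply/negP => /forallP h.
  have : (n <= #|S|)%N by rewrite -[n in (n <= _)%N]card_ord; apply/subset_leq_card/subsetP.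
  by rewrite cS; move: tn t0; clear; lia.
have cV v : v \notin S -> #|v |: S| = t by move=> vS; rewrite cardsU1 vS cS add1n prednK.
have tS : (t <= #|S|.+1)%N by rewrite cS leqSpred.
have [j0 rj0 hj0] := row_exists z (cV w wS).
have hs (v : 'I_n) : seeds inp n q j0 w v = if v \in S then (z v).+1 else 0%N.
  by rewrite (seeds_row w v hj0) setU1K.
pose W : pred nat := fun k => if insub k is Some v then (v : 'I_n) \in U else false.
have WE (v : 'I_n) : W v = (v \in U) by rewrite /W valK.
pose l k := if insub k is Some v then (Lb v).+1 else 0%N.
have lE (v : 'I_n) : l v = (Lb v).+1 by rewrite /l valK.
case/set0Pn: U0 => v0 v0U; have := stk j0 w rj0 (ltn_ord w) W l _ _ v0 (ltn_ord v0).
rewrite WE v0U => hstk; suff: false by []; apply: hstk => k kn.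
  rewrite -[k]/(nat_of_ord (Ordinal kn)); move: (Ordinal kn) => {k kn} v; rewrite WE lE => vU.
  split; first by have := subsetP UA v vU; rewrite !inE negbK => /eqP.
  have [h1 h2 _] := hU v vU; case: (boolP (v \in S)) => vS.
    by left; rewrite hs vS (h1 vS).
  right; have [p0 pmax] := h2 vS.
  have [j rj hj] := row_exists (set_at z v (Lb v)) (cV v vS).
  exists j => //; have [r1 r2 r3] := hj; split.
  - split=> //.
    + move=> u un; rewrite -[u]/(nat_of_ord (Ordinal un)); move: (Ordinal un) => {u un} u.
      rewrite hs; case: ifP => // uS _; rewrite r1 in_setU1 uS orbT ffunE.
      by case: eqP => // e; rewrite -e uS in vS.
    + by rewrite hs (negPf vS).
    + by rewrite r1 setU11 ffunE eqxx.
  - by rewrite r2 absz_eq0 numq_eq0 gt_eqF.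
  - move=> j' l' rj' ex' nl; have [V' [x' [cV' hj']]] := row_ofP d0 rj'.
    have [_ VE lE' xz] := extends_row tS cV' hj' hs ex'.
    have [_ r2' r3'] := hj'; rewrite r2 r3 r2' r3'; subst V'.
    have -> : restrict (v |: S) x' = restrict (v |: S) (set_at z v (x' v)).
      apply/ffunP => -[u uV]; rewrite !ffunE /=; case: eqP => [->|/eqP nu] //.
      by apply: xz; move: uV; rewrite in_setU1 (negPf nu).
    have a : x' v != Lb v by apply: contra nl => /eqP e; rewrite lE' e.
    apply: rat_lt_absz; last exact: pmax.
    by have [h _ _] := psd_axiom m; apply: h; apply: cV.
rewrite -[k]/(nat_of_ord (Ordinal kn)); move: (Ordinal kn) => {k kn} v; rewrite WE => vU.
rewrite (@input_good M _ l Lb) ?WE //; last by move=> u _; rewrite lE subn1.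
have [_ _] := hU v vU; rewrite (eq_bigl [in [set u : 'I_n | W u]]) // => u.
by rewrite !inE WE.
Qed.

End Extensions.

End Encoding.

(** * Degrees, scales and the final constants *)

Lemma degree_bounds (R : realType) (alpha : R) n q : (1 < n)%N ->
  (1 < sa_degree alpha n q <= n)%N.
Proof. by move=> n2; rewrite /sa_degree geq_minl leq_min n2 leq_max leqnn. Qed.

(** For q >= 2 the factor 2 ln q is at least 1, so unless the degree is clipped to n, t + 1 exceeds
    n^a. As t >= 2 this gives n^a <= t^2, and K >= 2 / a suffices. *)
Lemma degree_pow (R : realType) (alpha : R) n q K : 0 < alpha -> (1 < q)%N -> (1 < n)%N ->
  2 / Num.min alpha 1 <= K%:R -> (n <= sa_degree alpha n q ^ K)%N.
Proof.
move=> a0 q2 n2; set a := Num.min alpha 1 => hK.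
have a_gt0 : 0 < a by rewrite lt_min a0 ltr01.
have K1 : (0 < K)%N by rewrite -(ltr_nat R); apply: lt_le_trans hK; rewrite divr_gt0.
have n1 : 1 <= n%:R :> R by rewrite ler1n ltnW.
have ln2 : 2^-1 <= ln (2 : R).
  have := @le_ln1Dx R (- 2^-1); have -> : 1 + - 2^-1 = 2^-1 :> R by field.
  by rewrite lnV ?posrE //; lra.
have lnq : 1 <= 2 * ln (q%:R : R).
  have : ln (2 : R) <= ln q%:R by rewrite ler_ln ?posrE ?ltr0n ?ler_nat //; apply: ltnW.
  by lra.
rewrite /sa_degree; set u := Num.truncn _.
have u_gt : n%:R `^ a < u.+1%:R.
  have h : n%:R `^ a <= 2 * n%:R `^ alpha * ln q%:R.
    have : n%:R `^ a <= n%:R `^ alpha by rewrite ler_powR // ge_min lexx.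
    have := powR_ge0 (n%:R : R) alpha; move: lnq; set x := ln _; set y := _ `^ alpha; nra.
  case/andP: (truncn_itv (le_trans (powR_ge0 _ _) h)) => _.
  exact: le_lt_trans h.
set t := minn _ _; have [tn|tn] : t = n \/ t = maxn 2 u.
- by rewrite /t; case: (leqP n (maxn 2 u)); [left | right].
- by rewrite tn -[X in (X <= _)%N]expn1 leq_pexp2l // ltnW.
have t2 : (2 <= t)%N by rewrite tn leq_maxl.
have h : n%:R `^ a <= t%:R ^+ 2 :> R.
  apply: ltW; apply: lt_le_trans u_gt _; rewrite -natrX ler_nat.
  apply: (@leq_trans t.+1); first by rewrite ltnS tn leq_maxr.
  by move: t2; clear; rewrite -mulnn; nia.
rewrite -(ler_nat R) natrX -powR_mulrn //.
have -> : n%:R = (n%:R `^ a) `^ a^-1 :> R by rewrite -powRrM divff ?gt_eqF // powRr1.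
apply: (@le_trans _ _ ((t%:R ^+ 2) `^ a^-1)).
  by apply: ge0_ler_powR => //; rewrite ?nnegrE ?powR_ge0 ?exprn_ge0 // invr_ge0 ltW.
rewrite -powR_mulrn // -powRrM ler_powR // ler1n.
exact: ltnW.
Qed.

(** The walk length is a power of 2, so h is squared when J grows by one; t can be trapped between
    powers of h only up to a factor 2 in the exponent. *)
Lemma dyadic_scale t T : (1 < T)%N -> (T ^ 40 <= t)%N ->
  exists J, let h := (2 ^ 2 ^ J)%N in [/\ (T <= h)%N, (h ^ 20 <= t)%N & (t < h ^ 40)%N].
Proof.
move=> T2 tT; have t0 : (0 < t)%N by apply: leq_trans tT; rewrite expn_gt0 ltnW.
have /andP[l1 l2] := trunc_log_bounds (isT : 1 < 2)%N t0; set l := trunc_log 2 t in l1 l2.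
have l40 : (40 <= l)%N.
  rewrite -ltnS -(@ltn_exp2l 2) //; apply: leq_ltn_trans l2; apply: leq_trans tT.
  by rewrite leq_exp2r.
have l20 : (0 < l %/ 20)%N by rewrite divn_gt0 //; apply: leq_trans l40.
have /andP[j1 j2] := trunc_log_bounds (isT : 1 < 2)%N l20; set J := trunc_log 2 _ in j1 j2.
have hu : (t < (2 ^ 2 ^ J) ^ 40)%N.
  apply: (leq_trans l2); rewrite -expnM leq_exp2l //.
  move: j2; rewrite expnS ltn_divLR // => j2; apply: leq_trans j2 _.
  by move: (2 ^ J)%N; clear; lia.
exists J; split=> //.
  by rewrite -(@leq_exp2r _ _ 40) // ltnW //; apply: leq_ltn_trans tT hu.
rewrite -expnM; apply: leq_trans l1; rewrite leq_exp2l //.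
by apply: leq_trans (leq_divM l 20); rewrite leq_mul2r j1 orbT.
Qed.

Lemma expR_pow2 (R : realType) (M : nat) (x : R) : M%:R <= x -> expR (- x) <= 2^-1 ^+ M.
Proof.
move=> h; have h1 : expR (-1) <= 2^-1 :> R.
  rewrite expRN lef_pV2 ?posrE ?expR_gt0 //; have := @expR_ge1Dx R 1; lra.
apply: le_trans (_ : expR (- M%:R) <= _); first by rewrite ler_expR lerN2.
by rewrite -mulN1r expRM_natr lerXn2r // ?nnegrE ?expR_ge0 // invr_ge0.
Qed.

(** For q = 1 the logarithm vanishes and the degree does not grow with n; this case is settled
    apart. *)
Lemma value_alphabet1 (F : realFieldType) n (I : instance F n 1) x : unique_games I -> value I x = 1.
Proof.
move=> UG; rewrite -[RHS](wt_sum1 I) /value; apply: eq_bigr => i _;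
  apply: eq_bigr => j /andP[_ aij].
by have [s ->] := UG i j aij; rewrite [x j]ord1 [s _]ord1 eqxx mulr1.
Qed.

(** The exponent 2 B^2 + 8 B + 4 of [decode_rows] at B = 40 K: from t < h^40 and n <= t^K follows n
    <= h^(40 K). *)
Definition exponent K := (2 * (40 * K) ^ 2 + 8 * (40 * K) + 4)%N.

(** A lower bound for h that covers both q and the 2^(2 B + 8) required of it. *)
Definition label_scale q K := (q + 2 ^ (2 * (40 * K) + 8))%N.

Lemma decode_large (F : realFieldType) n q t K (I : instance F n q) (m : pseudodist F n q t) :
  unique_games I -> (0 < q)%N -> (0 < K)%N -> (label_scale q K ^ 40 <= t <= n)%N ->
  (n <= t ^ K)%N -> 1 - 512^-1 <= sa_objective I m ->
  forall R : {set 'I_n}, \sum_(v in ~: R) vol I v <= 1 / 2 ->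
    exists (S : {set 'I_n}) (z : {ffun 'I_n -> 'I_q}) (Lb : 'I_n -> 'I_q) (U : {set 'I_n}),
    [/\ #|S| = t.-1, U != finset.set0, U \subset R &
      forall v, v \in U ->
      [/\ v \in S -> z v = Lb v,
          v \notin S -> 0 < row_prob m S z v (Lb v) /\
            forall a, a != Lb v -> row_prob m S z v a < row_prob m S z v (Lb v) &
          2^-1 ^+ exponent K * vol I v <=
          \sum_(u in U) edge_wt I v u * (cstr I v u (Lb v) (Lb u))%:R]].
Proof.
move=> UG q0 K0 /andP[Tt tn] nt obj R hR.
have T2 : (1 < label_scale q K)%N.
  by rewrite /label_scale -(prednK q0) addSn ltnS addn_gt0 expn_gt0 orbT.
have [J [Th ht th]] := dyadic_scale T2 Tt.
have nh : (n <= (2 ^ 2 ^ J) ^ (40 * K))%N.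
  by apply: leq_trans nt _; rewrite [leqRHS]expnM leq_exp2r // ltnW.
apply: (decode_rows (B := 40 * K) (J := J) UG) => //.
- by rewrite q0 (leq_trans _ Th) // /label_scale leq_addr.
- by rewrite muln_gt0.
- by rewrite (leq_trans _ Th) // /label_scale leq_addl.
- by rewrite ht.
Qed.

Lemma polytime_rounding M : polytime_on is_input (compile (rounding M)).
Proof.
apply: compile_polytime (rounding_wf M) _ => _ [n [q [t [I [m ->]]]]].
exact: leq_trans (input_size_ge I m) (size_le_bitsize _).
Qed.

Lemma computes_rounding M inp : computes (compile (rounding M)) inp (out (run inp (rounding M) (start inp))).
Proof.
have [T [h _]] := compile_computes (rounding_wf M) (leq_addr (nth 0%N inp 0) (bitsize inp)) (leq_addl _ _).
by exists T.
Qed.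

Theorem theorem4p5 (R : realType) :
  exists2 C : R, 0 < C &
  forall alpha : R, 0 < alpha ->
  exists eps : R,
    [/\ 0 < eps,
        expR (- (C / Num.min alpha 1 ^+ 3)) <= eps &
        exists2 A : program, polytime_on is_input A &
        forall q : nat, (0 < q)%N ->
        exists n0 : nat, forall n : nat, (n0 <= n)%N ->
          (forall I : instance R n q,
             unique_games I ->
             1 - eps <= sherali_adams (sa_degree alpha n q) I ->
             exists x : {ffun 'I_n -> 'I_q}, eps / 8 <= value I x)
          /\
          (forall (I : instance rat n q)
                  (m : pseudodist rat n q (sa_degree alpha n q)),
             unique_games I ->
             1 - eps <= ratr (sa_objective I m) ->
             exists2 x : {ffun 'I_n -> 'I_q},
               computes A (enc_input I m) (enc_assignment x) &
               eps / 8 <= ratr (value I x))].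
Proof.
(* [M] is at most (60 K)^2 and K * a <= 3, so M * a^2 <= 180^2; since a <= 1 the cube leaves
   room. *)
exists (180 ^+ 2); [by rewrite exprn_gt0 | move=> alpha a0]; set a := Num.min alpha 1.
have a_gt0 : 0 < a by rewrite lt_min a0 ltr01.
have a_le1 : a <= 1 by rewrite ge_min lexx orbT.
have fa0 : 0 <= 2 / a by rewrite divr_ge0 // ltW.
pose K := (Num.truncn (2 / a)).+1; pose M := exponent K.
have /andP[K1 K2] := truncn_itv fa0; rewrite -/K in K2.
have hM : M%:R <= 180 ^+ 2 / a ^+ 3 :> R.
  have Ka : K%:R * a <= 3.
    have : K%:R <= 2 / a + 1 by rewrite /K -addn1 natrD lerD2r.
    by move=> h; have := ler_wpM2r (ltW a_gt0) h; rewrite mulrDl divfK ?gt_eqF //; lra.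
  have K1' : (1 <= K)%N by [].
  have MK : (M <= (60 * K) ^ 2)%N by rewrite /M /exponent; move: K1'; clear;
    rewrite !expnS !expn0; nia.
  rewrite ler_pdivlMr ?exprn_gt0 //.
  apply: (@le_trans _ _ (M%:R * a ^+ 2)).
    by rewrite ler_wpM2l // exprS -[leRHS]mul1r ler_wpM2r // exprn_ge0 // ltW.
  apply: (@le_trans _ _ ((60 * K)%:R ^+ 2 * a ^+ 2)).
    apply: ler_wpM2r; first by rewrite exprn_ge0 // ltW.
    by rewrite -natrX (ler_nat R).
  rewrite -exprMn lerXn2r // ?nnegrE ?mulr_ge0 ?(ltW a_gt0) // natrM -mulrA.
  by move: Ka; set w := K%:R * a; lra.
have M10 : (10 <= M)%N by rewrite /M /exponent /K; move: (Num.truncn _) => k; clear; lia.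
(* The factor 2 leaves room for a second loss of 2^-M, when the supremum is approached by an actual
   pseudodistribution; M >= 10 keeps the total below 1/512. *)
have small (F : realFieldType) : 2^-1 ^+ M <= 1 / 4 :> F /\ 1 - 512^-1 <= 1 - 2 * 2^-1 ^+ M :> F.
  have -> : 512^-1 = 2 * 2^-1 ^+ 10 :> F.
    by rewrite [_ ^+ 10]exprS mulVKf ?pnatr_eq0 // exprVn -natrX.
  have h : 2^-1 ^+ M <= 2^-1 ^+ 10 :> F by rewrite ler_wiXn2l // ?invr_ge0 // invf_le1 ?ler1n.
  split; last by rewrite lerD2l lerN2 ler_pM2l.
  apply: le_trans h _; have -> : 1 / 4 = 2^-1 ^+ 2 :> F by field.
  by rewrite ler_wiXn2l // ?invr_ge0 // invf_le1 ?ler1n.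
exists (2^-1 ^+ M); split; [by rewrite exprn_gt0 ?invr_gt0 | exact: expR_pow2 |].
exists (compile (rounding M)); first exact: polytime_rounding.
(* The bound 2^M serves the program; the other threshold forces [label_scale q K ^ 40] <= t by way
   of n <= t^K. *)
move=> q q0; exists (maxn (2 ^ M) ((label_scale q K ^ 40) ^ K).+1) => n.
rewrite geq_max => /andP[nM nT].
have n2 : (1 < n)%N by apply: leq_trans nM; rewrite (@leq_exp2l 2 1) //; apply: leq_trans M10.
have /andP[t2 tn] := degree_bounds alpha q n2; set t := sa_degree alpha n q in t2 tn *.
have t0 : (0 < t)%N by apply: ltnW.
have big : (1 < q)%N -> (n <= t ^ K)%N /\ (label_scale q K ^ 40 <= t <= n)%N.
  move=> q2; have nt : (n <= t ^ K)%N by apply: degree_pow => //; apply: ltW.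
  by rewrite nt tn andbT -(@leq_exp2r _ _ K) //; split=> //; apply: leq_trans nt; apply: ltnW.
have c0 (F : realFieldType) : 0 <= 2^-1 ^+ M :> F by rewrite exprn_ge0 // invr_ge0.
have c1 : (2^-1 ^+ M : R) / 8 <= 2^-1 ^+ M / 4 by have := c0 R; set c := _ ^+ _; lra.
have [q1|q2] : q = 1%N \/ (1 < q)%N by move: q0; clear; lia.
  subst q; split=> [I UG _|I m UG _].
    exists [ffun=> ord0]; rewrite value_alphabet1 //; have := (small R).1; move: (_ ^+ M) => c;
      clear; lra.
  have [x outE _] := rounding_correct I m q0 t0 tn nM; exists x.
    by rewrite -outE; apply: computes_rounding.
  by rewrite value_alphabet1 // rmorph1; have := (small R).1; move: (_ ^+ M) => c; clear; lra.
have [nt hT] := big q2; split=> [I UG obj|I m UG obj].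
  have [m hm] : exists m : pseudodist R n q t, 1 - 512^-1 <= sa_objective I m.
    pose E := range (fun m : pseudodist R n q t => sa_objective I m).
    have hE : has_sup E.
      (* A set without a supremum has [sup] 0 by convention, which a value of at least 3/4
         excludes. *)
      apply: contrapT => /sup_out e; move: obj; rewrite /sherali_adams -/t -/E e.
      by have := (small R).1; move: (_ ^+ M) => c; clear; lra.
    have e0 : 0 < 2^-1 ^+ M :> R by rewrite exprn_gt0 // invr_gt0.
    have [_ [m _ <-] hm] := sup_adherent e0 hE.
    exists m; apply: le_trans (small R).2 _.
    move: obj hm; rewrite /sherali_adams -/t -/E.
    by move: (_ ^+ M) (sup _) (sa_objective I m) => c s o; clear; lra.
  have [|x hx] := @greedy_value _ _ _ I (2^-1 ^+ M) (c0 R) q0.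
    move=> Rs /(decode_large UG q0 _ hT nt hm)[//|S [z [Lb [U [_ U0 UR hU]]]]].
    by exists U, Lb; split=> // v /hU[].
  by exists x; apply: le_trans hx.
have [x outE hx] := rounding_correct I m q0 t0 tn nM; exists x.
  by rewrite -outE; apply: computes_rounding.
have E (k : nat) : ratr (2^-1 ^+ M / k%:R) = 2^-1 ^+ M / k%:R :> R.
  by rewrite rmorphM rmorphXn /= !fmorphV !rmorph_nat.
apply: le_trans c1 _; rewrite -E ler_rat; apply: hx.
suff hm : 1 - 512^-1 <= sa_objective I m by apply: decode_large UG q0 _ hT nt hm.
apply: le_trans (small rat).2 _.
move: obj; rewrite -[2^-1 ^+ M]divr1 -(E 1%N) -(rmorph1 (@ratr R)) -rmorphB ler_rat divr1.
have := c0 rat.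
by move: (_ ^+ M) (sa_objective I m) => c o; clear; lra.
Qed.
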